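(* Let $\hbar$ be a formal parameter and let $$\tau_{MM}(\mathbf t)=\sum_{\lambda\in DP}\left(\frac{\hbar}{16}\right)^{|\lambda|/3}2^{-l(\lambda)}\,\frac{Q_\lambda(\delta_{k,1})\,Q_{2\lambda}(\delta_{k,3}/3)}{Q_{2\lambda}(\delta_{k,1})}\,Q_\lambda(\mathbf t),$$ where $DP$ is the set of strict partitions. For $m\ge -1$ let $$L_m=\frac14\sum_{a+b=2m}\frac{\partial^2}{\partial t_a\partial t_b}+\frac12\sum_{k\ge1,\ k\text{ odd}}k\,t_k\frac{\partial}{\partial t_{k+2m}}-\frac1{2\hbar}\frac{\partial}{\partial t_{2m+3}}+\frac14 t_1t_1\,\delta_{m,-1}+\frac{\delta_{m,0}}{16}.$$ Then $L_m\,\tau_{MM}=0$ for all $m\ge -1$.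
   Context: Variables: $\mathbf t=(t_1,t_3,t_5,\dots)$, indexed by positive odd integers. In $L_m$ the first sum is over positive odd integers $a,b$ with $a+b=2m$, and terms involving $\partial/\partial t_j$ with $j\le 0$ are zero. Partitions: a partition of length $l(\lambda)=l$ is a finite sequence $\lambda=(\lambda_1,\dots,\lambda_l)$ of non-negative integers (in any order); $|\lambda|=\sum_i\lambda_i$; $2\lambda=(2\lambda_1,\dots,2\lambda_l)$. It is strict if $\lambda_1>\cdots>\lambda_l>0$ (the empty partition $\emptyset$ counts as strict). It is positive if all parts are positive, and weakly positive if at most one part is $0$. Schur Q-polynomials (normalized as in Macdonald's book): define $q_k(\mathbf t)$ by $\sum_{k\ge0}q_k(\mathbf t)z^k=\exp\big(2\sum_{k\ge0}t_{2k+1}z^{2k+1}\big)$. For non-negative integers $(r,s)\ne(0,0)$ put $M_{(r,s)}=q_rq_s+2\sum_{i=1}^s(-1)^iq_{r+i}q_{s-i}$, and $M_{(0,0)}=0$. For a weakly positive partition $\lambda=(\lambda_1,\dots,\lambda_{2m})$ of even length, $Q_\lambda(\mathbf t)=\mathrm{Pf}(M_{(\lambda_i,\lambda_j)})_{1\le i,j\le 2m}$; for positive $\lambda$ of odd length, $Q_\lambda=Q_{(\lambda,0)}$, where $(\lambda,0)$ is $\lambda$ with a part $0$ appended; $Q_\emptyset=1$. $Q_\lambda(\delta_{k,1})$ is the value of $Q_\lambda$ at $t_k=\delta_{k,1}$ for all $k$; $Q_\lambda(\delta_{k,3}/3)$ is the value at $t_k=\delta_{k,3}/3$ for all $k$.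 $\tau_{MM}$ is regarded as a formal series in $\mathbf t$. *)

(* Defs.v *)
From HB Require Import structures.
From mathcomp Require Import all_boot all_order all_fingroup all_algebra.
From mathcomp Require Import classical_sets cardinality fsbigop.
From mathcomp Require Import finmap monalg.

Set Implicit Arguments.
Unset Strict Implicit.
Unset Printing Implicit Defensive.

Import Order.TTheory GRing.Theory Num.Theory.

Local Open Scope ring_scope.
Local Open Scope classical_set_scope.

(* Index set of the times t_1, t_3, t_5, ... *)
Definition oddn := {k : nat | odd k}.

Fact odd_succ_double j : odd j.*2.+1.
Proof. by rewrite /= odd_double. Qed.

(* The odd integer 2j+1. *)
Definition odd_idx (j : nat) : oddn := Sub j.*2.+1 (odd_succ_double j).

Section SchurQ.
Variables (F : fieldType) (A : comAlgType F).

Fact ltn_even_idx m (i : 'I_m) : (i.*2 < m.*2)%N.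
Proof. by rewrite ltn_double. Qed.
Fact ltn_odd_idx m (i : 'I_m) : (i.*2.+1 < m.*2)%N.
Proof. by rewrite ltn_Sdouble. Qed.

Definition even_ord m (i : 'I_m) : 'I_(m.*2) := Ordinal (ltn_even_idx i).
Definition odd_ord m (i : 'I_m) : 'I_(m.*2) := Ordinal (ltn_odd_idx i).

(* Pfaffian of a skew-symmetric matrix of size 2m:
   (2^m m!)^-1 sum_s sgn(s) prod_i B_{s(2i), s(2i+1)}. *)
Definition pfaffian m (B : 'M[A]_(m.*2)) : A :=
  ((2 ^ m * m`!)%:R^-1 : F) *:
    \sum_(s : 'S_(m.*2))
      (-1) ^+ s * \prod_(i < m) B (s (even_ord i)) (s (odd_ord i)).

(* t : oddn -> A assigns values in an F-algebra to the times; the formal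
   variables, and numerical values of the times, are instances. *)
Variable t : oddn -> A.

(* Coefficient of z^k in exp(2 * sum_j t_{2j+1} z^{2j+1}).  Neither the terms
   of the exponent of degree > k nor its powers of order > k contribute to that
   coefficient, so both sums are truncated. *)
Definition expo_trunc (N : nat) : {poly A} :=
  2 * \sum_(j < N) (t (odd_idx j))%:P * 'X^(j.*2.+1).
Definition q (k : nat) : A :=
  \sum_(n < k.+1) (n`!%:R^-1 : F) *: (expo_trunc k.+1 ^+ n)`_k.

Definition M (r s : nat) : A :=
  if (r == 0%N) && (s == 0%N) then 0
  else q r * q s
       + 2 * \sum_(1 <= i < s.+1) (-1) ^+ i * (q (r + i) * q (s - i)).

Definition Q_even (l : seq nat) : A :=
  pfaffian (\matrix_(i < (size l)./2.*2, j < (size l)./2.*2)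
              M (nth 0%N l i) (nth 0%N l j)).

(* Only meaningful for positive l, and for weakly positive l of even length. *)
Definition Q (l : seq nat) : A :=
  if odd (size l) then Q_even (rcons l 0%N) else Q_even l.

(* A grading of A in which t_k has degree k gives Q_l degree |l|. *)
Section Grading.
Variable G : nat -> A -> Prop.
Hypotheses (G0 : forall n, G n 0) (GD : forall n x y, G n x -> G n y -> G n (x + y)).
Hypotheses (GZ : forall n (c : F) x, G n x -> G n (c *: x)).
Hypotheses (G1 : G 0 1) (GM : forall a b x y, G a x -> G b y -> G (a + b) (x * y)).
Hypothesis Gt : forall k, G (val k) (t k).

Lemma graded_nat n c x : G n x -> G n (c%:R * x).
Proof.
move=> Gx; rewrite mulr_natl; elim: c => [|c IH]; first by rewrite mulr0n.
by rewrite mulrS; apply: GD.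
Qed.

Lemma graded_sign n c x : G n x -> G n ((-1) ^+ c * x).
Proof.
move=> Gx; elim: c => [|c IH]; first by rewrite mul1r.
by rewrite exprS -mulrA mulN1r -scaleN1r; apply: GZ.
Qed.

Lemma graded_sum n I (r : seq I) (P : pred I) (f : I -> A) :
  (forall i, P i -> G n (f i)) -> G n (\sum_(i <- r | P i) f i).
Proof. by move=> Gf; apply: big_ind => //; apply: GD. Qed.

Lemma graded_q k : G k (q k).
Proof.
have Gexpo N n i : G i (expo_trunc N ^+ n)`_i.
  elim: n i => [|n IH] i.
    by rewrite expr0 coef1; case: i => [|i] /=.
  rewrite exprS coefM; apply: graded_sum => j _.
  rewrite -[X in G X _](subnKC (leq_ord j)); apply: GM => //.
  rewrite /expo_trunc mulr_natl coefMn -mulr_natl; apply: graded_nat.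
  rewrite coef_sum; apply: graded_sum => p _.
  rewrite coefCM coefXn; case: eqP => [->|_]; last by rewrite mulr0.
  by rewrite mulr1; apply: (Gt (odd_idx p)).
by apply: graded_sum => n _; apply: GZ.
Qed.

Lemma graded_M r s : G (r + s) (M r s).
Proof.
rewrite /M; case: ifP => // _; apply: GD; first by apply: GM; apply: graded_q.
apply: graded_nat; rewrite big_nat_cond; apply: graded_sum => i.
rewrite andbT ltnS => /andP[_ le_is]; apply: graded_sign.
rewrite -[X in G X _](_ : r + i + (s - i) = _)%N; last first.
  by rewrite -addnA subnKC.
by apply: GM; apply: graded_q.
Qed.

Lemma sum_pairs m (f : 'I_(m.*2) -> nat) :
  (\sum_(i < m) (f (even_ord i) + f (odd_ord i)) = \sum_j f j)%N.
Proof.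
have gE g : (\sum_(i < m) (g i.*2 + g i.*2.+1) = \sum_(j < m.*2) g j)%N.
  elim: m {f} => [|m IH]; first by rewrite !big_ord0.
  by rewrite doubleS !big_ord_recr /= IH addnA.
pose g k := if insub k is Some i then f i else 0%N.
have fE (i : 'I_(m.*2)) : f i = g i by rewrite /g valK.
rewrite [RHS](eq_bigr (fun j : 'I__ => g j)) => [|j _]; last exact: fE.
by rewrite -gE; apply: eq_bigr => i _; rewrite !fE.
Qed.

Lemma graded_Q_even l : ~~ odd (size l) -> G (sumn l) (Q_even l).
Proof.
move=> /even_halfK size_l; apply: GZ; apply: graded_sum => s _.
apply: graded_sign.
have sumnE : sumn l =
    (\sum_(i < (size l)./2)
       (nth 0 l (s (even_ord i)) + nth 0 l (s (odd_ord i))))%N.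
  rewrite (sum_pairs (fun j => nth 0%N l (s j))).
  transitivity (\sum_(j < (size l)./2.*2) nth 0 l j)%N.
    by rewrite size_l sumnE (big_nth 0%N) big_mkord.
  by rewrite (reindex_inj (@perm_inj _ s)).
rewrite sumnE.
apply: (@big_ind2 nat A G 0%N addn 1 *%R) => // [a x b y|i _].
  exact: GM.
by rewrite mxE; apply: graded_M.
Qed.

Lemma graded_Q l : G (sumn l) (Q l).
Proof.
rewrite /Q; case: ifP => [odd_l|/negbT]; last exact: graded_Q_even.
have -> : sumn l = sumn (rcons l 0%N) by rewrite sumn_rcons addn0.
by apply: graded_Q_even; rewrite size_rcons /= odd_l.
Qed.

End Grading.
End SchurQ.

(* Q(hbar), the coefficient field. *)
Notation Khbar := {fraction {poly rat}}.
Definition hbar : Khbar := tofrac 'X.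

Definition Q_val (t : oddn -> Khbar) (l : seq nat) : Khbar := @Q Khbar Khbar^o t l.

Definition delta1 (k : oddn) : Khbar := (val k == 1%N)%:R.
Definition delta3 (k : oddn) : Khbar := (val k == 3%N)%:R / 3.

Notation tmonom := {cmonom oddn}.

Definition Q_poly (l : seq nat) : {malg Khbar[tmonom]} :=
  @Q Khbar _ (fun k => << ucm k >>) l.

Definition strict (l : seq nat) : bool := sorted gtn l && (0%N \notin l).

Definition DP : set (seq nat) := [set l | strict l].

(* The exponent |l|/3 is written with Euclidean division; the value chosen for
   |l| not divisible by 3 is irrelevant, by Q_delta3_eq0 below. *)
Definition tau_coef (l : seq nat) : Khbar :=
  (hbar / 16) ^+ (sumn l %/ 3) * 2 ^- size l
  * (Q_val delta1 l * Q_val delta3 (map double l) / Q_val delta1 (map double l)).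

(* Formal power series in the times, as families of coefficients. *)
Definition series := tmonom -> Khbar.

(* The sum over DP is taken coefficientwise; each coefficient is a finite sum,
   by tau_MM_summable below. *)
Definition tau_MM : series :=
  fun a => \sum_(l \in DP) tau_coef l * (Q_poly l)@_a.

Definition mul_t (k : oddn) (f : series) : series :=
  fun a => if a k == 0%N then 0 else f (divcm a (ucm k)).

Definition diff_t (k : oddn) (f : series) : series :=
  fun a => (a k).+1%:R * f (mmul a (ucm k)).

(* d/dt_j for an arbitrary integer j: zero unless j is a positive odd integer. *)
Definition ddt (j : int) (f : series) : series :=
  match j with
  | Posz n => if insub n is Some k then diff_t k f else fun=> 0
  | Negz _ => fun=> 0
  end.

(* Both sums are finite: the index set of the first one is, and in the second
   one the coefficient at a vanishes unless t_k divides the monomial a. *)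
Definition L (m : int) (f : series) : series := fun a =>
  4^-1 * (\sum_(p \in [set p : oddn * oddn | (val p.1 + val p.2)%N%:Z = 2 * m])
            ddt (val p.1)%:Z (ddt (val p.2)%:Z f) a)
  + 2^-1 * (\sum_(k \in [set: oddn])
              (val k)%:R * mul_t k (ddt ((val k)%:Z + 2 * m) f) a)
  - (2 * hbar)^-1 * ddt (2 * m + 3) f a
  + (if m == -1 then 4^-1 * mul_t (odd_idx 0) (mul_t (odd_idx 0) f) a else 0)
  + (if m == 0 then 16^-1 * f a else 0).

Lemma Q_delta3_eq0 l : ~~ (3 %| sumn l)%N -> Q_val delta3 (map double l) = 0.
Proof.
have -> : (3 %| sumn l)%N = (3 %| sumn (map double l))%N.
  have -> : sumn (map double l) = (2 * sumn l)%N.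
    by elim: l => //= x l ->; rewrite mulnDr -mul2n.
  by rewrite Gauss_dvdr.
apply: (@graded_Q Khbar Khbar^o delta3 (fun n x => ~~ (3 %| n)%N -> x = 0)).
- by [].
- by move=> n x y hx hy n3; rewrite hx // hy // addr0.
- by move=> n c x hx n3; rewrite hx // scaler0.
- by [].
- move=> a b x y hx hy; have [a3|na3 _] := boolP (3 %| a)%N.
    by rewrite dvdn_addr // => nb3; rewrite hy // mulr0.
  by rewrite hx // mul0r.
- move=> k; rewrite /delta3; case: eqP => [->//|_ _].
  by rewrite mul0r.
Qed.

Definition wt (a : tmonom) : nat := \sum_(k <- finsupp a) a k * val k.

Lemma wtM (a b : tmonom) : wt (mmul a b) = (wt a + wt b)%N.
Proof.
have wtE (d : {fset oddn}) (c : tmonom) : (finsupp c `<=` d)%fset ->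
    wt c = (\sum_(k <- d) c k * val k)%N.
  move=> le; rewrite /wt (big_fset_incl _ le) // => k _.
  by rewrite -cmE_neq0 negbK => /eqP->; rewrite mul0n.
pose d := (finsupp a `|` finsupp b)%fset.
rewrite (wtE d a) ?fsubsetUl // (wtE d b) ?fsubsetUr //.
rewrite (wtE d (mmul a b)) ?mdomD // -big_split /=.
by apply: eq_bigr => k _; rewrite cmM mulnDl.
Qed.

(* Q_l is homogeneous of degree |l| for the grading deg t_k = k. *)
Lemma Q_poly_homog l (a : tmonom) : (Q_poly l)@_a != 0 -> wt a = sumn l.
Proof.
pose G n (p : {malg Khbar[tmonom]}) := forall a, p@_a != 0 -> wt a = n.
suff : G (sumn l) (Q_poly l) by apply.
apply: graded_Q.
- by move=> n b; rewrite mcoeff0 eqxx.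
- move=> n x y hx hy b; rewrite mcoeffD.
  by have [->|/hx//] := eqVneq x@_b 0; rewrite add0r => /hy.
- move=> n c x hx b; rewrite mcoeffZ mulf_eq0 negb_or => /andP[_]; exact: hx.
- move=> b; rewrite mcoeff1; case: (b =P mone) => [->|]; last by rewrite eqxx.
  by rewrite /wt mdom1 big_seq_fset0.
- move=> n m x y hx hy b; rewrite mcoeff_neq0 => /msuppM_le[b1 [b2 [b1x b2y ->]]].
  by rewrite wtM (hx b1) ?(hy b2) // mcoeff_neq0.
- move=> k b; rewrite mcoeffU1; case: (ucm k =P b) => [<-|]; last by rewrite eqxx.
  by rewrite /wt mdomU big_seq_fset1 cmUU mul1n.
Qed.

Lemma finite_strict n : finite_set [set l | strict l /\ sumn l = n].
Proof.
pose f (B : {set 'I_n.+1}) := [seq x <- rev (iota 0 n.+1) | inord x \in B].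
apply: (@sub_finite_set _ _ (f @` setT)); last exact/finite_image/finite_finset.
move=> l [/andP[sl _] sumn_l]; exists [set i : 'I_n.+1 | val i \in l]%SET => //.
have gtn_trans : transitive gtn by move=> x y z xy /ltn_trans; apply.
have le_l x : x \in l -> (x < n.+1)%N.
  by rewrite ltnS -sumn_l => xl; rewrite (perm_sumn (perm_to_rem xl)) leq_addr.
apply: (irr_sorted_eq gtn_trans ltnn) => //.
  apply: sorted_filter => //; rewrite rev_sorted.
  by apply: iota_ltn_sorted.
move=> x; rewrite mem_filter mem_rev mem_iota /= add0n inE.
apply/andP/idP => [[+ xn]|xl]; first by rewrite inordK.
by rewrite inordK le_l.
Qed.

Lemma tau_MM_summable (a : tmonom) :
  finite_set [set l | DP l /\ tau_coef l * (Q_poly l)@_a != 0].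
Proof.
apply: sub_finite_set (finite_strict (wt a)) => l [sl].
by rewrite mulf_eq0 negb_or => /andP[_ /Q_poly_homog ->].
Qed.

(* Main.v *)
(** Setting t_k = sum_i x_i^k / k for N = 2n variables x_i, Q_lambda becomes a
    ratio of Pfaffians, and by Schur's Pfaffian the coefficients of tau are, up to
    normalization, sub-Pfaffians of one antisymmetric array.  Cauchy-Binet for
    Pfaffians then collapses tau to a single normalized Pfaffian of
    (a_i b_j - b_i a_j) / (l_i + l_j), with l_i = 1 / x_i and a_i, b_i the values at
    x_i of two Airy-type series.  Expanding it over the ways to choose a or b in each
    variable leaves Cauchy kernels in l_i^2, and the first-order system relating a
    and b yields a matrix Airy equation in the variables l_i^2.  Conjugating it by
    the product of the x_i + x_j gives, for every i,
      sum_(m >= -1) x_i^(2m) (L_m tau) = 0,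
    all L_m tau being evaluated at the x's.  A Vandermonde determinant in the x_i^2
    separates the values of m, and the algebraic independence of the odd power sums,
    proved with the derivations d/dx_i, lifts the vanishing to formal series. *)

From HB Require Import structures.
Require Import Defs.
From mathcomp Require Import all_boot all_order all_algebra.
From mathcomp Require Import monalg.
From mathcomp Require Import all_fingroup qpoly finmap ring zify.
From mathcomp Require mpoly.
Set Implicit Arguments.
Unset Strict Implicit.
Unset Printing Implicit Defensive.
Import GRing.Theory.
Local Open Scope ring_scope.

(** * Pfaffians *)

(** The Airy series enter through the coefficients of tau. At t_k = delta_(k,1) the entries of the
    Pfaffians are 2^r/r! 2^s/s! (r-s)/(r+s), and doubling the parts does not change (r-s)/(r+s): the
    two Pfaffians of these ratios cancel and leave double factorials times the entries at
    delta_(k,3)/3. The resulting array obeys a recursion whose right-hand side is an antisymmetric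
    product of the asymptotic coefficients of Bi and Bi', so its generating series telescopes to a
    kernel of Christoffel-Darboux type.

    A formal variable 'X marking |lambda| replaces hbar, with 'X^3 standing for hbar/16. It is
    truncated beyond 'X^W, so that every series is a polynomial and the Airy relations hold only
    after a quotient map. The equation for L_m then links the parts of tau of weights w and w + 3,
    and 1/(2 hbar) times hbar/16 is the constant 1/32.

    Pfaffians are divided by the product of a second antisymmetric kernel over all pairs. The
    quotient does not depend on the order of the indices, so its expansions are sums over subsets
    without alternating signs. *)

Lemma sum_lift_perm (V : nmodType) n (i j : 'I_n.+1) (G : 'S_n.+1 -> V) :
  \sum_(s : 'S_n.+1 | s i == j) G s = \sum_(s : 'S_n) G (lift_perm i j s).
Proof.
have lift_ex (s : 'S_n.+1) (k : 'I_n) : {l | s (lift i k) = lift (s i) l}.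
  have : s i != s (lift i k) by rewrite (inj_eq perm_inj) neq_lift.
  by case/unlift_some=> l -> _; exists l.
have [r rP] : exists r : 'S_n.+1 -> 'I_n -> 'I_n, forall (s : 'S_n.+1) k, s (lift i k) = lift (s i) (r s k).
  by exists (fun s k => sval (lift_ex s k)) => s k; case: lift_ex.
have r_inj s : injective (r s).
  by move=> k l /(congr1 (lift (s i))); rewrite -!rP => /perm_inj/lift_inj.
rewrite (reindex (lift_perm i j)) /=.
  by apply: eq_bigl => s; rewrite lift_perm_id eqxx.
exists (fun s => perm (@r_inj s)) => [s _|s].
  apply/permP => k; rewrite permE; apply: (@lift_inj _ j).
  by have := rP (lift_perm i j s) k; rewrite lift_perm_lift lift_perm_id => <-.
rewrite inE => /eqP si; apply/permP => k.
case: (unliftP i k) => [k'|] ->; last by rewrite lift_perm_id si.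
by rewrite lift_perm_lift permE rP si.
Qed.

Section Pfaffians.
Variables (F : fieldType) (A : comAlgType F).
Hypothesis F0 : forall n, n.+1%:R != 0 :> F.

Lemma natf_neq0 n : (0 < n)%N -> n%:R != 0 :> F.
Proof. by case: n => // n _; apply: F0. Qed.

(** The indexing [f] may be any function, not only an injection: the Cauchy-Binet formula is first
    summed over all functions. *)
Definition pff (T : Type) (B : T -> T -> A) m (f : 'I_m.*2 -> T) : A :=
  pfaffian (\matrix_(i, j) B (f i) (f j)).

Definition pairing (T : Type) (B : T -> T -> A) m (f : 'I_m.*2 -> T) : A :=
  \prod_(i < m) B (f (even_ord i)) (f (odd_ord i)).

Lemma pffE T (B : T -> T -> A) m (f : 'I_m.*2 -> T) :
  pff B f = ((2 ^ m * m`!)%:R^-1 : F) *: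
    \sum_(s : 'S_m.*2) (-1) ^+ s * pairing B (f \o s).
Proof.
rewrite /pff /pfaffian; congr (_ *: _); apply: eq_bigr => s _; congr (_ * _).
by apply: eq_bigr => i _; rewrite mxE.
Qed.

Lemma eq_pff T (B B' : T -> T -> A) m (f f' : 'I_m.*2 -> T) :
  B =2 B' -> f =1 f' -> pff B f = pff B' f'.
Proof.
move=> eB ef; rewrite /pff; congr pfaffian.
by apply/matrixP=> i j; rewrite !mxE eB !ef.
Qed.

Lemma pff_perm T (B : T -> T -> A) m (f : 'I_m.*2 -> T) (s : 'S_m.*2) :
  pff B (f \o s) = (-1) ^+ s * pff B f.
Proof.
rewrite !pffE -scalerAr mulr_sumr; congr (_ *: _).
rewrite (reindex_inj (mulIg s^-1)%g); apply: eq_bigr => t _.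
rewrite odd_permM odd_permV signr_addb mulrA [(-1) ^+ t * _]mulrC.
by congr (_ * _); rewrite /pairing; apply: eq_bigr => i _ /=; rewrite !permM !permKV.
Qed.

Lemma even_odd_neq m (i j : 'I_m) : even_ord i != odd_ord j.
Proof. by apply/eqP => /(congr1 (odd \o val)) /=; rewrite !odd_double. Qed.

Lemma even_ord_inj m : injective (@even_ord m).
Proof. by move=> i j /(congr1 val) /= /double_inj/val_inj. Qed.

Lemma odd_ord_inj m : injective (@odd_ord m).
Proof. by move=> i j /(congr1 val) /= [/double_inj/val_inj]. Qed.

Section Antisym.
Variables (T : Type) (B : T -> T -> A).
Hypothesis Banti : forall x y, B y x = - B x y.

Lemma pairing_swap m (f : 'I_m.*2 -> T) (p : 'I_m) :
  pairing B (f \o tperm (even_ord p) (odd_ord p)) = - pairing B f.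
Proof.
rewrite /pairing (bigD1 p) //= [in RHS](bigD1 p) //= tpermL tpermR -mulNr -Banti.
congr (_ * _); apply: eq_bigr => i ip.
have ne : (even_ord p != even_ord i) && (odd_ord p != odd_ord i).
  by rewrite (inj_eq (@even_ord_inj m)) (inj_eq (@odd_ord_inj m)) eq_sym ip.
by case/andP: ne => ne1 ne2; rewrite !tpermD // 1?eq_sym ?even_odd_neq // eq_sym even_odd_neq.
Qed.

Lemma pairing_move m (f : 'I_m.*2 -> T) (p q : 'I_m) :
  pairing B (f \o (tperm (even_ord p) (even_ord q) * tperm (odd_ord p) (odd_ord q))%g)
  = pairing B f.
Proof.
rewrite /pairing [RHS](reindex_inj (@perm_inj _ (tperm p q))) /=.
apply: eq_bigr => i _; rewrite !permM; congr (B (f _) (f _)).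
  by rewrite -(inj_tperm _ _ _ (@even_ord_inj m)) tpermD // eq_sym even_odd_neq.
by rewrite [tperm (even_ord _) _ _]tpermD ?even_odd_neq // inj_tperm //; apply: odd_ord_inj.
Qed.

Definition pf_term m (f : 'I_m.*2 -> T) (s : 'S_m.*2) : A :=
  (-1) ^+ s * pairing B (f \o s).

(** All positions contribute equally. Exchanging two pairs is an even permutation that preserves the
    pairing; exchanging the two members of a pair changes the sign of both the permutation and the
    pairing. *)
Lemma sum_pf_term_fix m (f : 'I_m.+1.*2 -> T) (i : 'I_m.+1.*2) :
  \sum_(s : 'S_m.+1.*2 | s i == even_ord ord0) pf_term f s
  = \sum_(s : 'S_m.+1.*2 | s (even_ord ord0) == even_ord ord0) pf_term f s.
Proof.
have Emove (p : 'I_m.+1) : let j := even_ord p in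
  \sum_(s : 'S_m.+1.*2 | s j == even_ord ord0) pf_term f s
  = \sum_(s : 'S_m.+1.*2 | s (even_ord ord0) == even_ord ord0) pf_term f s.
  pose t := (tperm (even_ord ord0) (even_ord p) * tperm (odd_ord ord0) (odd_ord p))%g.
  move=> j; rewrite (reindex_inj (mulgI t)); apply: eq_big => [s|s _].
    rewrite !permM tpermR tpermD //; by rewrite eq_sym even_odd_neq.
  rewrite /pf_term odd_permM signr_addb.
  rewrite odd_permM !odd_tperm (inj_eq (@even_ord_inj _)) (inj_eq (@odd_ord_inj _)) addbb mul1r.
  congr (_ * _); rewrite -[RHS](pairing_move _ ord0 p) /pairing.
  by apply: eq_bigr => k _ /=; rewrite !permM.
have Eswap (p : 'I_m.+1) :
  \sum_(s : 'S_m.+1.*2 | s (odd_ord p) == even_ord ord0) pf_term f s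
  = \sum_(s : 'S_m.+1.*2 | s (even_ord p) == even_ord ord0) pf_term f s.
  pose t := tperm (even_ord p) (odd_ord p).
  rewrite (reindex_inj (mulgI t)); apply: eq_big => [s|s _].
    by rewrite permM tpermR.
  rewrite /pf_term odd_permM odd_tperm even_odd_neq signr_addb mulN1r mulNr -mulrN.
  congr (_ * _); rewrite -[RHS]opprK -(pairing_swap (f \o s) p).
  by congr (- _); rewrite /pairing; apply: eq_bigr => k _ /=; rewrite !permM.
have [p ip] : exists p : 'I_m.+1, i = even_ord p \/ i = odd_ord p.
  have hp : (i./2 < m.+1)%N by rewrite ltn_half_double.
  exists (Ordinal hp); have := odd_double_half i; case: (odd i) => /= e; [right|left];
    by apply: val_inj; rewrite /= -[LHS]e ?add1n.
by case: ip => ->; rewrite ?Eswap Emove.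
Qed.

Lemma pairing_recl m (h : 'I_m.+1.*2 -> T) :
  pairing B h = B (h (ord0 : 'I_m.*2.+2)) (h (lift (ord0 : 'I_m.*2.+2) ord0)) *
    pairing B (fun k : 'I_m.*2 => h (lift (ord0 : 'I_m.*2.+2) (lift ord0 k))).
Proof.
rewrite /pairing big_ord_recl; congr (B (h _) (h _) * _); try exact: val_inj.
by apply: eq_bigr => i _; congr (B (h _) (h _)); apply: val_inj.
Qed.

(** The index 0 can sit at any of 2m + 2 equivalent positions, and this number turns the prefactor
    1/(2^(m+1) (m+1)!) into 1/(2^m m!). Once 0 is in front and its partner is chosen, a permutation
    of the remaining 2m indices is left. *)
Lemma pff_row m (f : 'I_m.+1.*2 -> T) :
  pff B f = \sum_(j : 'I_m.*2.+1) (-1) ^+ j *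
    B (f ord0) (f (lift ord0 j)) * pff B (fun k : 'I_m.*2 => f (lift ord0 (lift j k))).
Proof.
rewrite pffE (eq_bigr (pf_term f)) //.
have -> : \sum_(s : 'S_m.+1.*2) pf_term f s =
    \sum_(i : 'I_m.+1.*2) \sum_(s : 'S_m.+1.*2 | s i == even_ord ord0) pf_term f s.
  rewrite (exchange_big_dep xpredT) //=; apply: eq_bigr => s _.
  rewrite (eq_bigl (pred1 (s^-1 (even_ord ord0))%g)) ?big_pred1_eq // => i.
  by rewrite /= -(inj_eq (@perm_inj _ s) i) permKV.
rewrite (eq_bigr _ (fun i _ => sum_pf_term_fix f i)) sumr_const card_ord.
rewrite -scaler_nat scalerA.
have -> : ((2 ^ m.+1 * m.+1`!)%:R^-1 : F) * (m.+1.*2)%:R = (2 ^ m * m`!)%:R^-1.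
  apply: (mulfI (natf_neq0 (_ : 0 < 2 ^ m.+1 * m.+1`!)%N)).
    by rewrite muln_gt0 expn_gt0 fact_gt0.
  rewrite mulrA divff ?natf_neq0 ?muln_gt0 ?expn_gt0 ?fact_gt0 // mul1r.
  have -> : (2 ^ m.+1 * m.+1`! = m.+1.*2 * (2 ^ m * m`!))%N.
    by rewrite expnS factS -muln2; ring.
  by rewrite natrM mulfK // natf_neq0 // muln_gt0 expn_gt0 fact_gt0.
have -> : even_ord (ord0 : 'I_m.+1) = (ord0 : 'I_m.*2.+2) by apply: val_inj.
rewrite [X in _ *: X](@sum_lift_perm _ m.*2.+1) scaler_sumr.
rewrite [LHS](partition_big (fun s : 'S_m.*2.+1 => s ord0) xpredT) //=.
apply: eq_bigr => j _; rewrite sum_lift_perm pffE -scalerAr mulr_sumr scaler_sumr.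
apply: eq_bigr => s _; congr (_ *: _); rewrite /pf_term.
rewrite [odd_perm (lift_perm _ _ _)](@odd_lift_perm m.*2.+1) odd_lift_perm /= signr_addb signr_odd.
rewrite pairing_recl /= lift_perm_id lift_perm_lift lift_perm_id.
have -> : pairing B (fun k : 'I_m.*2 => f (lift_perm (ord0 : 'I_m.*2.+2) ord0 (lift_perm ord0 j s)
        (lift ord0 (lift ord0 k))))
   = pairing B ((fun k : 'I_m.*2 => f (lift ord0 (lift j k))) \o s).
  by apply: eq_bigr => i _; rewrite !lift_perm_lift.
exact: mulrACA.
Qed.

End Antisym.
End Pfaffians.

(** An injection is an enumeration of its image, and a set of size k has k! enumerations, on which
    [G] takes the same value. *)
Lemma sum_ffun_sym (V : zmodType) (T : finType) (x0 : T) k (G : ('I_k -> T) -> V) :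
  (forall f g, f =1 g -> G f = G g) ->
  (forall f (s : 'S_k), G (f \o s) = G f) ->
  (forall f, ~~ injectiveb f -> G f = 0) ->
  \sum_(f : {ffun 'I_k -> T}) G f
  = (\sum_(X : {set T} | #|X| == k) G (fun i => nth x0 (enum X) i)) *+ k`!.
Proof.
move=> Gext Gsym Gninj.
rewrite (bigID (fun f : {ffun 'I_k -> T} => injectiveb f)) /= [X in _ + X]big1 ?addr0; last by move=> f; apply: Gninj.
rewrite (partition_big (fun f : {ffun 'I_k -> T} => f @: setT) (fun X : {set T} => #|X| == k)) /=; last first.
  by move=> f /injectiveP finj; rewrite card_imset // cardsT card_ord.
rewrite -sumrMnl; apply: eq_bigr => X /eqP cX.
have memP (f : {ffun 'I_k -> T}) : injectiveb f && (f @: setT == X)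
   = (f \in [set f : {ffun 'I_k -> T} in ffun_on (mem X) | injectiveb f]).
  rewrite inE andbC; case finj: (injectiveb f); rewrite ?andbF ?andbT //.
  apply/eqP/ffun_onP => [<- i|fX]; first by rewrite imset_f.
  apply/eqP; rewrite eqEcard; apply/andP; split.
    by apply/subsetP => y /imsetP[i _ ->]; apply: fX.
  by rewrite cX card_imset ?cardsT ?card_ord //; apply/injectiveP.
rewrite (eq_bigl _ _ memP) (eq_bigr (fun=> G (fun i => nth x0 (enum X) i))).
  by rewrite sumr_const card_inj_ffuns_on card_ord cX ffactnn.
move=> f; rewrite -memP => /andP[/injectiveP finj /eqP fX].
have sz : size (enum X) == k by rewrite -cardE cX.
have : perm_eq (map f (enum 'I_k)) (Tuple sz).
  apply: uniq_perm; rewrite ?enum_uniq ?(map_inj_uniq finj) ?enum_uniq // => y /=.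
  rewrite mem_enum -fX; apply/mapP/imsetP => -[i _ ->]; exists i; rewrite ?mem_enum //.
case/tuple_permP => s fs; rewrite -[RHS](Gsym _ s); apply: Gext => i /=.
have := congr1 (nth x0 ^~ i) fs; rewrite /= (nth_map i) ?size_enum_ord // nth_ord_enum => ->.
by rewrite (nth_map i) ?size_enum_ord // nth_ord_enum (tnth_nth x0).
Qed.

Section Pfaffians.
Variables (F : fieldType) (A : comAlgType F).
Hypothesis F0 : forall n, n.+1%:R != 0 :> F.

Lemma mulr2n_eq0 (a : A) : a = - a -> a = 0.
Proof.
move=> /eqP; rewrite -addr_eq0 -mulr2n -scaler_nat => /eqP a2.
by rewrite -[a]scale1r -(mulVf (F0 1)) -scalerA a2 scaler0.
Qed.

Lemma pff_ninj (T : eqType) (B : T -> T -> A) m (f : 'I_m.*2 -> T) :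
  ~~ injectiveb f -> pff B f = 0.
Proof.
case/injectivePn=> i [j ij fij]; apply: mulr2n_eq0.
have := pff_perm B f (tperm i j); rewrite odd_tperm ij expr1 mulN1r => <-.
by apply: eq_pff => // k /=; case: tpermP => // ->; rewrite fij.
Qed.

Lemma prodr_pairs m (h : 'I_m.*2 -> A) :
  \prod_(i < m) (h (even_ord i) * h (odd_ord i)) = \prod_j h j.
Proof.
have gE g : \prod_(i < m) (g i.*2 * g i.*2.+1) = \prod_(j < m.*2) g j :> A.
  elim: m {h} => [|m IH]; first by rewrite !big_ord0.
  by rewrite doubleS !big_ord_recr /= IH mulrA.
pose g k := if insub k is Some i then h i else 0.
have hE (i : 'I_m.*2) : h i = g i by rewrite /g valK.
rewrite [RHS](eq_bigr (fun j : 'I__ => g j)) => [|j _]; last exact: hE.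
by rewrite -gE; apply: eq_bigr => i _; rewrite !hE.
Qed.

Lemma half_ord_proof m (k : 'I_m.*2) : (k./2 < m)%N.
Proof. by rewrite ltn_half_double. Qed.

Definition half_ord m (k : 'I_m.*2) : 'I_m := Ordinal (half_ord_proof k).

Lemma half_even_ord m (p : 'I_m) : half_ord (even_ord p) = p.
Proof. by apply: val_inj; rewrite /= doubleK. Qed.

Lemma half_odd_ord m (p : 'I_m) : half_ord (odd_ord p) = p.
Proof. by apply: val_inj; rewrite /= uphalf_double. Qed.

Lemma even_half_ord m (k : 'I_m.*2) : ~~ odd k -> even_ord (half_ord k) = k.
Proof. by move=> ek; apply: val_inj; rewrite /= even_halfK. Qed.

Lemma odd_half_ord m (k : 'I_m.*2) : odd k -> odd_ord (half_ord k) = k.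
Proof. by move=> ok; apply: val_inj; rewrite /= -[RHS]odd_double_half ok. Qed.

(** In matrix notation V J V^T; [contraction] below is V^T c V. Cauchy-Binet trades one for the
    other. *)
Definition congruence (S T : finType) (V : S -> T -> A) (J : T -> T -> A) (x y : S) : A :=
  \sum_i \sum_j V x i * J i j * V y j.

Lemma pairing_congruence (S T : finType) (V : S -> T -> A) (J : T -> T -> A) m (s : 'I_m.*2 -> S) :
  pairing (congruence V J) s
  = \sum_(f : {ffun 'I_m.*2 -> T}) pairing J f * \prod_k V (s k) (f k).
Proof.
rewrite /pairing /congruence.
under eq_bigr do rewrite pair_bigA /=.
rewrite bigA_distr_bigA /=.
(* Distributing a product of m double sums picks one pair of indices per factor; [h] and [h']
   identify such choices with functions on the 2m positions. *)
pose h (f : {ffun 'I_m.*2 -> T}) := [ffun p : 'I_m => (f (even_ord p), f (odd_ord p))].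
pose h' (g : {ffun 'I_m -> T * T}) :=
  [ffun k : 'I_m.*2 => if odd k then (g (half_ord k)).2 else (g (half_ord k)).1].
rewrite (reindex h) /=; last first.
  exists h' => [f _|g _]; apply/ffunP => k; rewrite !ffunE.
    by case: ifP => ok /=; rewrite ?odd_half_ord ?even_half_ord ?ok.
  by rewrite /= !odd_double /= half_even_ord half_odd_ord; case: (g k).
apply: eq_bigr => f _; rewrite -(prodr_pairs (fun k => V (s k) (f k))) -big_split /=.
by apply: eq_bigr => p _; rewrite /h !ffunE /=; ring.
Qed.

Definition contraction (S T : finType) (V : S -> T -> A) (c : S -> S -> A) (i j : T) : A :=
  \sum_x \sum_y V x i * c x y * V y j.

Lemma pff_contraction (S T : finType) (V : S -> T -> A) (c : S -> S -> A) m (f : 'I_m.*2 -> T) :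
  pff (contraction V c) f = \sum_(s : {ffun 'I_m.*2 -> S}) pff c s * \prod_k V (s k) (f k).
Proof.
rewrite pffE; under [RHS]eq_bigr do rewrite pffE -scalerAl mulr_suml.
rewrite -scaler_sumr; congr (_ *: _); rewrite exchange_big /=; apply: eq_bigr => t _.
rewrite (@pairing_congruence T S (fun i x => V x i) c) mulr_sumr.
pose h (s : {ffun 'I_m.*2 -> S}) := [ffun k => s (t k)].
rewrite [LHS](reindex h) /=; last first.
  exists (fun s => [ffun k => s ((t^-1)%g k)]) => s _; apply/ffunP => k; rewrite !ffunE.
    by rewrite permKV.
  by rewrite permK.
apply: eq_bigr => s _; rewrite -mulrA; congr (_ * (_ * _)).
  by apply: eq_bigr => p _; rewrite !ffunE.
rewrite [RHS](reindex_inj (@perm_inj _ t)); by apply: eq_bigr => k _; rewrite /= ffunE.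
Qed.

(** In a sum over all functions, one of the two Pfaffians may be replaced by a multiple of a single
    pairing, since the other one absorbs each permutation and its sign. Both sides then reduce to
    the same double sum of [pff c s], [pairing J f] and the products of entries of [V]. *)
Lemma pff_cauchy_binet (S T : finType) (V : S -> T -> A) (c : S -> S -> A) (J : T -> T -> A) m :
  \sum_(s : {ffun 'I_m.*2 -> S}) pff c s * pff (congruence V J) s
  = \sum_(f : {ffun 'I_m.*2 -> T}) pff J f * pff (contraction V c) f.
Proof.
have sum_pf (X : finType) (a b : X -> X -> A) :
    \sum_(s : {ffun 'I_m.*2 -> X}) pff a s * pff b s
    = ((2 ^ m * m`!)%:R^-1 : F) *: (\sum_(s : {ffun 'I_m.*2 -> X}) pff a s * pairing b s) *+ (m.*2)`!.
  under eq_bigr do rewrite [X in _ * X]pffE -scalerAr mulr_sumr.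
  rewrite -scaler_sumr scalerMnr; congr (_ *: _); rewrite exchange_big /=.
  rewrite -[LHS]/(\sum_(t : 'S_m.*2) _) -card_Sn -sumr_const; apply: eq_bigr => t _.
  pose h (s : {ffun 'I_m.*2 -> X}) := [ffun k => s ((t^-1)%g k)].
  rewrite (reindex h) /=; last first.
    exists (fun s => [ffun k => s (t k)]) => s _; apply/ffunP => k; rewrite !ffunE.
      by rewrite permK.
    by rewrite permKV.
  apply: eq_bigr => s _; rewrite mulrA [_ * (-1) ^+ t]mulrC -pff_perm; congr (_ * _).
    by apply: eq_pff => // k /=; rewrite ffunE permK.
  by apply: eq_bigr => p _ /=; rewrite !ffunE !permK.
rewrite sum_pf; under [RHS]eq_bigr do rewrite mulrC.
rewrite sum_pf; congr (_ *: _ *+ _).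
under eq_bigr do rewrite pairing_congruence mulr_sumr.
rewrite exchange_big /=; apply: eq_bigr => f _.
rewrite pff_contraction mulr_suml; apply: eq_bigr => s _; ring.
Qed.

End Pfaffians.

(** * Pfaffians divided by a product over pairs *)

Section NormalizedPfaffian.
Variables (F : fieldType) (A : comAlgType F).
Hypothesis F0 : forall n, n.+1%:R != 0 :> F.

(** The bound [(size l)./2.*2] equals the size for lists of even length; a last entry in excess is
    dropped. *)
Definition pfseq (T : Type) (x0 : T) (B : T -> T -> A) (l : seq T) : A :=
  pff B (fun i : 'I_(size l)./2.*2 => nth x0 l i).

Lemma pfseqE (T : Type) (x0 : T) (B : T -> T -> A) (l : seq T) m :
  size l = m.*2 -> pfseq x0 B l = pff B (fun i : 'I_m.*2 => nth x0 l i).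
Proof.
move=> sl; have sm : (size l)./2 = m by rewrite sl doubleK.
by case: _ / sm.
Qed.

Lemma pfseq_nil (T : Type) (x0 : T) (B : T -> T -> A) : pfseq x0 B [::] = 1.
Proof.
rewrite /pfseq pffE /= expn0 fact0 mul1n invr1 scale1r.
rewrite (eq_bigr (fun=> 1)) => [|s _]; first by rewrite sumr_const card_Sn.
rewrite (_ : s = 1%g) ?odd_perm1 ?mul1r; last by apply/permP => -[].
by rewrite /pairing big_ord0.
Qed.

Lemma pfseq_cons (T : Type) (x0 : T) (B : T -> T -> A) x l :
  (forall x y, B y x = - B x y) -> odd (size l) ->
  pfseq x0 B (x :: l) = \sum_(j < size l) (-1) ^+ j * B x (nth x0 l j)
                          * pfseq x0 B (take j l ++ drop j.+1 l).
Proof.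
move=> Banti ol; set m := (size l)./2.
have sl : size l = m.*2.+1 by rewrite -[LHS]odd_double_half ol.
rewrite (@pfseqE _ _ _ (x :: l) m.+1) /= ?sl // (pff_row F0 Banti).
apply: eq_bigr => j _; congr (_ * B x _ * _).
have sj : size (take j l ++ drop j.+1 l) = m.*2.
  rewrite size_cat size_drop size_takel sl; last exact: ltnW.
  by rewrite subSS subnKC // -ltnS.
rewrite (pfseqE _ _ sj); apply: eq_pff => // k /=.
rewrite nth_cat size_takel ?sl; last exact: ltnW.
rewrite /bump; case: ltnP => kj /=.
  by rewrite add0n nth_take.
by rewrite add1n nth_drop addSn subnKC.
Qed.

Lemma pfseq_scale (T : eqType) (x0 : T) (h : T -> A) (B : T -> T -> A) l :
  ~~ odd (size l) ->
  pfseq x0 (fun x y => h x * h y * B x y) l = (\prod_(x <- l) h x) * pfseq x0 B l.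
Proof.
move=> el; rewrite /pfseq !pffE -scalerAr mulr_sumr; congr (_ *: _).
have -> : \prod_(x <- l) h x = \prod_(i : 'I_(size l)./2.*2) h (nth x0 l i).
  by rewrite (big_nth x0) big_mkord even_halfK.
apply: eq_bigr => s _; rewrite mulrCA; congr (_ * _).
rewrite (reindex_inj (@perm_inj _ s)) -prodr_pairs -big_split /=.
by apply: eq_bigr => p _.
Qed.

Section Normalization.
Variables (T : eqType) (x0 : T) (s : T -> T -> F).
Hypothesis santi : forall x y, s y x = - s x y.

(** The analogue of the Vandermonde product: [s x y] over all pairs, in list order. *)
Fixpoint vdm (l : seq T) : F :=
  if l is x :: l' then (\prod_(y <- l') s x y) * vdm l' else 1.

Lemma vdm_move l1 y l2 :
  vdm (l1 ++ y :: l2) = (-1) ^+ size l1 * (\prod_(k <- l1 ++ l2) s y k) * vdm (l1 ++ l2).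
Proof.
elim: l1 => [|x l1 IH] /=; first by rewrite mul1r.
rewrite IH !big_cat !big_cons /= exprS (santi x y) !big_cat /=; ring.
Qed.

Lemma vdm_neq0 l : uniq l -> {in l &, forall x y, x != y -> s x y != 0} -> vdm l != 0.
Proof.
elim: l => [|x l IH] /=; first by rewrite oner_neq0.
case/andP=> xl ul sl; rewrite mulf_neq0 //.
  rewrite prodf_seq_neq0; apply/allP => y yl /=.
  apply: sl; rewrite ?inE ?eqxx ?yl ?orbT //.
  by apply: contraNneq xl => ->.
by apply: IH => // y z yl zl; apply: sl; rewrite inE ?yl ?zl orbT.
Qed.

Variable B : T -> T -> A.
Hypothesis Banti : forall x y, B y x = - B x y.

(** Numerator and denominator both change sign under a transposition of the list. The quotient thus
    depends on the underlying set only, which is why no alternating sign appears in [npf_cons]. *)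
Definition npf (l : seq T) : A := (vdm l)^-1 *: pfseq x0 B l.

Lemma npf_cons x l : uniq l -> odd (size l) ->
  npf (x :: l) = \sum_(y <- l)
    ((s x y)^-1 * \prod_(k <- rem y l) (s x k * s y k)^-1) *: (B x y * npf (rem y l)).
Proof.
move=> ul ol; rewrite /npf pfseq_cons // scaler_sumr [RHS](big_nth x0) big_mkord.
apply: eq_bigr => j _; set y := nth x0 l j.
have jy : index y l = j by rewrite index_uniq.
have yl : y \in l by rewrite mem_nth.
have remE : rem y l = take j l ++ drop j.+1 l by rewrite remE jy.
have lE : l = take j l ++ y :: drop j.+1 l by rewrite -drop_nth ?cat_take_drop.
rewrite -remE.
have vE : vdm l = (-1) ^+ j * (\prod_(k <- rem y l) s y k) * vdm (rem y l).
  by rewrite {1}lE vdm_move -remE size_takel // ltnW.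
have xE : \prod_(k <- l) s x k = s x y * \prod_(k <- rem y l) s x k.
  by rewrite {1}lE big_cat big_cons remE big_cat /= mulrCA.
have sgE : (-1) ^+ j = (-1) ^+ j *: (1 : A) by rewrite -signr_odd -[in RHS]signr_odd;
  case: (odd j); rewrite ?expr1 ?expr0 ?scaleN1r ?scale1r.
move: (pfseq x0 B (rem y l)) => P.
rewrite [vdm (x :: l)]/= vE xE sgE -!scalerAl mul1r scalerA -scalerAr scalerA; congr (_ *: _).
rewrite prodfV big_split /= !invfM.
have : (-1) ^- j * (-1) ^+ j = 1 :> F by rewrite mulVf // signr_eq0.
move: ((-1 : F) ^- j) ((-1 : F) ^+ j) (s x y)^-1 (\prod_(k <- rem y l) s x k)^-1
  (\prod_(k <- rem y l) s y k)^-1 (vdm (rem y l))^-1.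
by move=> u v a b c d uv; ring: uv.
Qed.

Lemma npf_nil : npf [::] = 1.
Proof. by rewrite /npf pfseq_nil /= invr1 scale1r. Qed.

End Normalization.

Section OnSets.
Variables (T : finType) (x0 : T) (s : T -> T -> F) (B : T -> T -> A).
Hypotheses (santi : forall x y, s y x = - s x y) (Banti : forall x y, B y x = - B x y).

Definition npfset (X : {set T}) : A := npf x0 s B (enum X).

Lemma npfset0 : npfset set0 = 1.
Proof. by rewrite /npfset enum_set0 npf_nil. Qed.

Lemma enum_rem (X : {set T}) x : enum (X :\ x) = rem x (enum X).
Proof.
rewrite rem_filter ?enum_uniq // {1}/enum_mem -filter_predI; apply: eq_filter => y.
by rewrite /= !inE.
Qed.

Lemma npfset_rec (X : {set T}) x : ohead (enum X) = Some x -> ~~ odd #|X| ->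
  npfset X = \sum_(y in X :\ x)
    ((s x y)^-1 * \prod_(k in X :\ x :\ y) (s x k * s y k)^-1) *:
      (B x y * npfset (X :\ x :\ y)).
Proof.
move=> hX eX; have [l eXl] : exists l, enum X = x :: l.
  by case: (enum X) hX => // z l [<-]; exists l.
have ul := enum_uniq X; rewrite eXl /= in ul; case/andP: ul => xl ul.
have lE : enum (X :\ x) = l by rewrite enum_rem eXl /= eqxx.
rewrite /npfset eXl npf_cons //; last by move: eX; rewrite cardE eXl /= negbK.
rewrite -[in LHS]lE big_enum /=; apply: eq_bigr => y _.
by rewrite !enum_rem eXl /= eqxx -big_enum !enum_rem eXl /= eqxx.
Qed.

End OnSets.
End NormalizedPfaffian.

(** * Schur's Pfaffian *)

Section Lagrange.
Variables (F : fieldType) (T : finType).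
Implicit Types (K J : {set T}) (z : T -> F) (P : {poly F}).

Lemma size_prod_XaddC K z : size (\prod_(k in K) ('X + (z k)%:P)) = #|K|.+1.
Proof.
rewrite -big_enum /= (eq_bigr (fun k => 'X - (- z k)%:P)) => [|k _]; last by rewrite polyCN opprK.
by rewrite size_prod_XsubC -cardE.
Qed.

Lemma poly_roots_set K z P : {in K &, injective z} -> (size P <= #|K|)%N ->
  {in K, forall k, P.[z k] = 0} -> P = 0.
Proof.
move=> zinj szP rP; apply/eqP/negPn/negP => P0.
have := @max_poly_roots _ P (map z (enum K)) P0; rewrite size_map -cardE ltnNge szP.
have -> : all (root P) [seq z i | i <- enum K].
  by apply/allP => _ /mapP[k + ->]; rewrite mem_enum => kK; apply/rootP/rP.
have -> : uniq [seq z i | i <- enum K].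
  by rewrite map_inj_in_uniq ?enum_uniq // => k l; rewrite !mem_enum; apply: zinj.
by move=> /(_ isT isT).
Qed.

Lemma lagrange K z P : {in K &, injective z} -> (size P <= #|K|)%N ->
  P = \sum_(j in K) (P.[z j] * \prod_(k in K :\ j) (z j - z k)^-1)
        *: \prod_(k in K :\ j) ('X - (z k)%:P).
Proof.
move=> zinj szP; apply/eqP; rewrite -subr_eq0; apply/eqP.
apply: (@poly_roots_set K z) => //.
  rewrite (leq_trans (size_polyD _ _)) // geq_max szP size_polyN.
  apply: (leq_trans (size_sum _ _ _)); apply/bigmax_leqP => j jK.
  apply: (leq_trans (size_scale_leq _ _)).
  rewrite -big_enum size_prod_XsubC -cardE.
  by rewrite [X in (_ <= X)%N](cardsD1 j) jK.
move=> i iK; rewrite hornerD hornerN horner_sum (bigD1 i) //= [X in - (_ + X)]big1 => [|j /andP[jK ji]].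
  rewrite addr0 hornerZ horner_prod -mulrA -big_split /= big1 ?mulr1 ?subrr // => k.
  rewrite !inE hornerXsubC => /andP[ki kK]; rewrite mulVf // subr_eq0.
  by apply: contra_neq ki => /zinj ->.
have iKj : i \in K :\ j by rewrite !inE eq_sym ji.
by rewrite hornerZ horner_prod [X in _ * X](big_setD1 i iKj) /= hornerXsubC subrr mul0r mulr0.
Qed.

Lemma lagrange_eval K z P y : {in K &, injective z} -> (size P <= #|K|)%N ->
  P.[y] = \sum_(j in K) P.[z j] * \prod_(k in K :\ j) ((y - z k) / (z j - z k)).
Proof.
move=> zinj szP; rewrite {1}(lagrange zinj szP) horner_sum; apply: eq_bigr => j jK.
rewrite hornerZ horner_prod -mulrA -big_split /=; congr (_ * _).
by apply: eq_bigr => k _; rewrite hornerXsubC mulrC.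
Qed.

(** The sum is the coefficient of degree |K| - 1 of the interpolating polynomial, and [P] has
    smaller degree. *)
Lemma lagrange_lead K z P : {in K &, injective z} -> (size P < #|K|)%N ->
  \sum_(j in K) P.[z j] * \prod_(k in K :\ j) (z j - z k)^-1 = 0.
Proof.
move=> zinj szP; have := congr1 (coefp #|K|.-1) (lagrange zinj (ltnW szP)).
rewrite /= nth_default; last by rewrite -ltnS prednK //; case: #|K| szP.
rewrite coef_sum => e; rewrite [RHS]e; apply: eq_bigr => j jK.
rewrite coefZ; pose Q := \prod_(k in K :\ j) ('X - (z k)%:P); rewrite -/Q.
have -> : Q`_#|K|.-1 = lead_coef Q.
  rewrite /lead_coef /Q -big_enum size_prod_XsubC -cardE.
  by rewrite (cardsD1 j K) jK.
by rewrite /Q -big_enum lead_coef_prod_XsubC mulr1.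
Qed.

Lemma deriv_prod_XsubC K z : 
  (\prod_(k in K) ('X - (z k)%:P))^`() = \sum_(k in K) \prod_(l in K :\ k) ('X - (z l)%:P).
Proof.
have [n] := ubnP #|K|; elim: n K => // n IH K; rewrite ltnS => cK.
have [->|[k kK]] := set_0Vmem K; first by rewrite !big_set0 derivC.
rewrite (big_setD1 k) //= derivM derivXsubC mul1r IH; last first.
  by rewrite (leq_trans _ cK) // [X in (_ < X)%N](cardsD1 k) kK.
rewrite (big_setD1 k kK) /=; congr (_ + _); rewrite mulr_sumr; apply: eq_bigr => l.
rewrite !inE => /andP[lk lK]; rewrite [RHS](big_setD1 k) ?inE 1?eq_sym ?lk //=.
by rewrite !setDDl setUC.
Qed.

Lemma deriv_eval_prod_XaddC K z y : (forall k, k \in K -> y + z k != 0) ->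
  (\prod_(k in K) ('X + (z k)%:P))^`().[y] =
  (\prod_(k in K) (y + z k)) * \sum_(k in K) (y + z k)^-1.
Proof.
move=> nz; rewrite (eq_bigr (fun k => 'X - (- z k)%:P)) => [|k _]; last by rewrite polyCN opprK.
rewrite deriv_prod_XsubC horner_sum mulr_sumr; apply: eq_bigr => k kK.
rewrite horner_prod [in RHS](big_setD1 k) //= [RHS]mulrAC divff ?nz // mul1r.
by apply: eq_bigr => l _; rewrite hornerXsubC opprK.
Qed.

(** The derivative of the interpolation formula at a node: the basis polynomial of [i] contributes
    its logarithmic derivative, while that of [j] contributes only the term in which its factor
    vanishing at [z i] is differentiated. *)
Lemma lagrange_deriv K z P i : {in K &, injective z} -> (size P <= #|K|)%N -> i \in K ->
  P^`().[z i] = P.[z i] * (\sum_(k in K :\ i) (z i - z k)^-1)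
    + \sum_(j in K :\ i) P.[z j] / (z j - z i) * \prod_(k in K :\ i :\ j) ((z i - z k) / (z j - z k)).
Proof.
move=> zinj szP iK; rewrite {1}(lagrange zinj szP) raddf_sum horner_sum (big_setD1 i) //=.
have zne k l : k \in K -> l \in K -> k != l -> z k - z l != 0.
  by move=> kK lK; apply: contra_neq => /eqP; rewrite subr_eq0 => /eqP/zinj ->.
congr (_ + _).
  rewrite linearZ hornerZ /= -mulrA; congr (_ * _).
  rewrite (eq_bigr (fun k => 'X + (- z k)%:P)) => [|k _]; last by rewrite polyCN.
  rewrite deriv_eval_prod_XaddC => [|k]; last first.
    by rewrite !inE => /andP[ki kK]; rewrite zne // eq_sym.
  rewrite mulrA -big_split /= big1 ?mul1r // => k; rewrite !inE => /andP[ki kK].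
  by rewrite mulVf // zne // eq_sym.
apply: eq_bigr => j; rewrite !inE => /andP[ji jK].
have iKj : i \in K :\ j by rewrite !inE eq_sym ji.
rewrite linearZ hornerZ /= (big_setD1 i iKj) /= [X in _ * X^`().[_]](big_setD1 i iKj) /=.
rewrite derivM derivXsubC mul1r hornerD hornerM hornerXsubC subrr mul0r addr0.
have -> : K :\ i :\ j = K :\ j :\ i.
  by apply/setP => k; rewrite !inE; case: (k == i); case: (k == j).
have hE : (\prod_(k in K :\ j :\ i) ('X - (z k)%:P)).[z i] = \prod_(k in K :\ j :\ i) (z i - z k).
  by rewrite horner_prod; apply: eq_bigr => k _; rewrite hornerXsubC.
rewrite hE big_split /=; ring.
Qed.

End Lagrange.

(** * Rational identities behind the row expansions *)

Section SchurIdentities.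
Variables (F : fieldType) (T : finType).
Hypothesis F0 : forall n, n.+1%:R != 0 :> F.
Implicit Types (K J : {set T}) (x : T -> F).

Definition gcoef x K j : F := \prod_(k in K :\ j) ((x j + x k) / (x j - x k)).

Definition distinct x K := {in K &, forall i j, i != j -> (x i - x j != 0) && (x i + x j != 0)}.

Lemma distinct_inj x K : distinct x K -> {in K &, injective x}.
Proof.
move=> dx i j iK jK e; apply/eqP/negPn/negP => /(dx i j iK jK).
by rewrite e subrr eqxx.
Qed.

Lemma distinctS x K J : J \subset K -> distinct x K -> distinct x J.
Proof. by move=> /subsetP JK dx i j /JK iK /JK jK; apply: dx. Qed.

Lemma size_sub_prod x K :
  (size (\prod_(k in K) ('X - (x k)%:P) - \prod_(k in K) ('X + (x k)%:P))%R <= #|K|)%N.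
Proof.
have -> : \prod_(k in K) ('X + (x k)%:P) = \prod_(k in K) ('X - (- x k)%:P).
  by apply: eq_bigr => k _; rewrite polyCN opprK.
rewrite -!big_enum /=; apply/leq_sizeP => j; rewrite leq_eqVlt coefB => /orP[/eqP<-|jK].
  have lc (h : T -> F) : (\prod_(k <- enum K) ('X - (h k)%:P))`_#|K| = 1.
    by rewrite -[RHS](lead_coef_prod_XsubC (enum K) xpredT h) /lead_coef size_prod_XsubC -cardE.
  by rewrite !lc subrr.
by rewrite !nth_default ?subrr // size_prod_XsubC -cardE.
Qed.

(** Partial fractions in y. The difference of the two products has degree below |K|, and it is
    interpolated at the poles - x_k, where the second product vanishes; [gcoef] gives the
    residues. *)
Lemma prod_ratio x K y : distinct x K -> (forall k, k \in K -> y + x k != 0) ->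
  \prod_(k in K) ((y - x k) / (y + x k)) = 1 - \sum_(j in K) 2 * x j * gcoef x K j / (y + x j).
Proof.
move=> dx yx.
set P := \prod_(k in K) ('X - (x k)%:P) - \prod_(k in K) ('X + (x k)%:P).
have ninj : {in K &, injective (fun k => - x k)}.
  by move=> i j iK jK /oppr_inj; apply: (distinct_inj dx).
have := lagrange_eval y ninj (size_sub_prod x K); rewrite -/P.
have PE z : P.[z] = \prod_(k in K) (z - x k) - \prod_(k in K) (z + x k).
  rewrite hornerD hornerN !horner_prod; congr (_ - _); apply: eq_bigr => k _; by rewrite !hornerE.
rewrite PE => e.
have nzp : \prod_(k in K) (y + x k) != 0 by apply/prodf_neq0.
rewrite big_split /= prodfV; apply: (mulIf nzp); rewrite mulfVK // mulrBl mul1r.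
have -> : \prod_(k in K) (y - x k) = \prod_(k in K) (y + x k) +
   (\prod_(k in K) (y - x k) - \prod_(k in K) (y + x k)) by ring.
rewrite e; congr (_ + _); rewrite mulr_suml -sumrN; apply: eq_bigr => j jK.
have splitK : \prod_(k in K) (y + x k) = (y + x j) * \prod_(k in K :\ j) (y + x k) by rewrite (big_setD1 j).
rewrite PE splitK [X in X - _](big_setD1 j) //= [X in _ - X](big_setD1 j) //=.
rewrite addNr mul0r subr0 /gcoef.
have yj := yx j jK.
have -> : \prod_(k in K :\ j) ((y - - x k) / (- x j - - x k)) =
   \prod_(k in K :\ j) (y + x k) * \prod_(k in K :\ j) (- (x j - x k))^-1.
  by rewrite -big_split /=; apply: eq_bigr => k _; congr (_ / _); ring.
have -> : \prod_(k in K :\ j) (- x j - x k) = \prod_(k in K :\ j) (- (x j + x k)).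
  by apply: eq_bigr => k _; ring.
have -> : \prod_(k in K :\ j) ((x j + x k) / (x j - x k)) =
   \prod_(k in K :\ j) (- (x j + x k)) * \prod_(k in K :\ j) (- (x j - x k))^-1.
  by rewrite -big_split /=; apply: eq_bigr => k _; rewrite invrN mulrNN.
by field.
Qed.

(** The case y = 0 of [prod_ratio] when no node vanishes. A zero node has to be allowed, because the
    parts of partitions serve as nodes later and a part 0 may complete the length. Such a node
    contributes a factor 1 to the other coefficients, so it can be split off. *)
Lemma sum_gcoef x K : distinct x K -> 2 * \sum_(j in K) gcoef x K j = 1 - (-1) ^+ #|K|.
Proof.
have nz_case K' : distinct x K' -> (forall k, k \in K' -> x k != 0) ->
    2 * \sum_(j in K') gcoef x K' j = 1 - (-1) ^+ #|K'|.
  move=> dx nx; have := @prod_ratio x K' 0 dx; rewrite (eq_bigr (fun=> -1)); last first.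
    by move=> k kK; rewrite sub0r add0r mulNr divff // nx.
  rewrite prodr_const => ->; last by move=> k kK; rewrite add0r nx.
  rewrite subKr mulr_sumr; apply: eq_bigr => j jK; rewrite add0r; field; exact: nx.
move=> dx; case: (pickP [pred k in K | x k == 0]) => [i /andP[iK /eqP xi]|nz]; last first.
  by apply: nz_case => // k kK; have := nz k; rewrite inE /= kK => /negbT.
have nzi k : k \in K :\ i -> x k != 0.
  rewrite !inE => /andP[ki kK]; have := dx k i kK iK ki.
  by rewrite xi subr0; case/andP.
have dxi : distinct x (K :\ i) by apply: distinctS dx; apply: subsetDl.
have gi : gcoef x K i = (-1) ^+ #|K :\ i|.
  rewrite -prodr_const; apply: eq_bigr => k kK; rewrite xi add0r sub0r invrN mulrN divff //.
  exact: nzi.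
rewrite (big_setD1 i) //= mulrDr (eq_bigr (gcoef x (K :\ i))) => [|j]; last first.
  move=> jK; have := jK; rewrite !inE => /andP[ji jK'].
  rewrite /gcoef (big_setD1 i) ?inE 1?eq_sym ?ji //= xi addr0 subr0 divff ?nzi // mul1r.
  by apply: eq_bigl => k; rewrite !inE; case: (k == i); case: (k == j).
by rewrite nz_case // gi [in RHS](cardsD1 i) iK exprS; ring.
Qed.

Lemma sum_gcoef_ratio x K y : distinct x K -> (forall k, k \in K -> y + x k != 0) ->
  \sum_(j in K) gcoef x K j * ((y - x j) / (y + x j))
  = \prod_(k in K) ((y - x k) / (y + x k)) - 1 + \sum_(j in K) gcoef x K j.
Proof.
move=> dx yx; rewrite prod_ratio // [1 - _]addrC addrK -sumrN -big_split /=.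
by apply: eq_bigr => j jK; field; apply: yx.
Qed.

(* This is the row expansion of the Schur Pfaffian. *)
Lemma schur_row x K y : distinct x K -> odd #|K| ->
  (forall k, k \in K -> (y + x k != 0) && (y - x k != 0)) ->
  \sum_(j in K) \prod_(k in K :\ j) ((y + x k) * (x j + x k) / ((y - x k) * (x j - x k))) = 1.
Proof.
move=> dx oK yx.
have nzp : \prod_(k in K) ((y + x k) / (y - x k)) != 0.
  by apply/prodf_neq0 => k /yx /andP[? ?]; rewrite mulf_neq0 ?invr_neq0.
have invp : \prod_(k in K) ((y - x k) / (y + x k)) = (\prod_(k in K) ((y + x k) / (y - x k)))^-1.
  by rewrite -prodfV; apply: eq_bigr => k _; rewrite invfM invrK mulrC.
have := sum_gcoef_ratio dx (fun k kK => proj1 (andP (yx k kK))).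
have -> : \sum_(j in K) gcoef x K j = 1.
  apply: (mulfI (F0 1)); rewrite sum_gcoef // -signr_odd oK expr1; ring.
rewrite subrK invp => e; apply: (mulfI (invr_neq0 nzp)); rewrite mulr1 -[RHS]e mulr_sumr.
apply: eq_bigr => j jK; have /andP[yj yj'] := yx j jK.
have -> : \prod_(k in K :\ j) ((y + x k) * (x j + x k) / ((y - x k) * (x j - x k)))
   = \prod_(k in K :\ j) ((y + x k) / (y - x k)) * gcoef x K j.
  by rewrite /gcoef -big_split /=; apply: eq_bigr => k _; rewrite invfM; ring.
have pE : \prod_(k in K) ((y + x k) / (y - x k)) =
    (y + x j) / (y - x j) * \prod_(k in K :\ j) ((y + x k) / (y - x k)).
  by rewrite (big_setD1 j).
rewrite pE in nzp *; move: nzp; rewrite mulf_eq0 negb_or => /andP[_ nzq].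
by field; rewrite nzq yj yj'.
Qed.

(* The coefficient of [a_J b_K] in the expansion of the Pfaffian of
   [(a_i b_j - b_i a_j) / (l_i + l_j)] along the row of [i], with [J = i |: J']. *)
Lemma bipartite_row (l : T -> F) i J K : distinct l (i |: (J :|: K)) ->
  i \notin K -> #|K| = #|J|.+1 -> [disjoint J & K] -> i \notin J ->
  \sum_(j in K) \prod_(k in K :\ j) ((l k + l i) / (l k - l j))
     * \prod_(k in J) ((l j + l k) / (l k - l i)) = 1.
Proof.
move=> dl iK cK JK iJ.
have dK : distinct l K by apply: distinctS dl; apply/subsetP => k kK; rewrite !inE kK !orbT.
(* The sum is the interpolation of this polynomial at the |J| + 1 nodes of [K], evaluated at -
   l_i. *)
pose P : {poly F} := \prod_(k in J) ('X + (l k)%:P).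
have szP : (size P <= #|K|)%N by rewrite size_prod_XaddC cK.
have PE z : P.[z] = \prod_(k in J) (z + l k).
  by rewrite horner_prod; apply: eq_bigr => k _; rewrite !hornerE.
have := lagrange_eval (- l i) (distinct_inj dK) szP; rewrite PE => e.
have nzJ : \prod_(k in J) (- l i + l k) != 0.
  apply/prodf_neq0 => k kJ; have ki : k != i by apply: contraNneq iJ => <-.
  have := dl k i; rewrite !inE kJ eqxx ki orbT => /(_ isT isT isT) /andP[+ _].
  by rewrite addrC.
apply: (mulfI nzJ); rewrite mulr1 [RHS]e mulr_sumr; apply: eq_bigr => j jK.
rewrite PE !big_split /= !prodfV.
have -> : \prod_(k in J) (l k - l i) = \prod_(k in J) (- l i + l k).
  by apply: eq_bigr => k _; ring.
have cKj : #|K :\ j| = #|J| by move: cK; rewrite (cardsD1 j) jK => -[].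
have -> : \prod_(k in K :\ j) (- l i - l k) = (-1) ^+ #|J| * \prod_(k in K :\ j) (l k + l i).
  by rewrite -cKj -prodrN; apply: eq_bigr => k _; ring.
have -> : \prod_(k in K :\ j) (l k - l j) = (-1) ^+ #|J| * \prod_(k in K :\ j) (l j - l k).
  by rewrite -cKj -prodrN; apply: eq_bigr => k _; ring.
have nzK : \prod_(k in K :\ j) (l j - l k) != 0.
  apply/prodf_neq0 => k; rewrite !inE => /andP[kj kK].
  by have := dK j k jK kK; rewrite eq_sym kj => /(_ isT)/andP[].
have sgn : ((-1) ^+ #|J|) ^+ 2 = 1 :> F by rewrite sqrr_sign.
have sgn0 : (-1) ^+ #|J| != 0 :> F by rewrite signr_eq0.
move: ((-1) ^+ #|J|) sgn sgn0 => e1 sgn sgn0.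
by field: sgn; rewrite nzJ nzK sgn0.
Qed.

End SchurIdentities.

(** * The matrix Airy equation *)

Definition derivation (R : pzRingType) (d : R -> R) :=
  (forall x y, d (x + y) = d x + d y) /\ (forall x y, d (x * y) = d x * y + x * d y).

Section Derivations.
Variables (R : pzRingType) (d : R -> R).
Hypothesis dd : derivation d.

Lemma derD x y : d (x + y) = d x + d y. Proof. exact: dd.1. Qed.
Lemma derM x y : d (x * y) = d x * y + x * d y. Proof. exact: dd.2. Qed.
Lemma der0 : d 0 = 0.
Proof. by have := derD 0 0; rewrite addr0 => /eqP; rewrite -subr_eq0 opprD addNKr oppr_eq0 => /eqP. Qed.
Lemma der1 : d 1 = 0.
Proof. by have := derM 1 1; rewrite mulr1 mul1r mulr1 => /eqP; rewrite -subr_eq0 opprD addNKr oppr_eq0 => /eqP. Qed.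
Lemma derN x : d (- x) = - d x.
Proof. by apply/eqP; rewrite -addr_eq0 -derD addNr der0. Qed.
Lemma derB x y : d (x - y) = d x - d y.
Proof. by rewrite derD derN. Qed.
Lemma der_sum I (r : seq I) (P : pred I) (f : I -> R) :
  d (\sum_(i <- r | P i) f i) = \sum_(i <- r | P i) d (f i).
Proof. by elim/big_rec2: _ => [|i x y _ <-]; rewrite ?der0 // derD. Qed.
Lemma der_nat n : d n%:R = 0.
Proof. by elim: n => [|n IH]; rewrite ?der0 // mulrS derD der1 IH addr0. Qed.
End Derivations.

Section FieldDerivations.
Variables (F : fieldType) (d : F -> F).
Hypothesis dd : derivation d.

Lemma derV x : d x^-1 = - d x / x ^+ 2.
Proof.
have [->|x0] := eqVneq x 0; first by rewrite invr0 (der0 dd) oppr0 mul0r.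
have := derM dd x x^-1; rewrite divff // (der1 dd) => /esym/eqP.
rewrite addrC addr_eq0 => /eqP e; apply: (mulfI x0); rewrite e; field; exact: x0.
Qed.

Lemma der_prod_log I (r : seq I) (P : pred I) (f : I -> F) :
  (forall i, P i -> f i != 0) ->
  d (\prod_(i <- r | P i) f i) = \prod_(i <- r | P i) f i * \sum_(i <- r | P i) d (f i) / f i.
Proof.
move=> f0; elim: r => [|i r IH]; first by rewrite !big_nil (der1 dd) mulr0.
rewrite !big_cons; case: ifP => // Pi; rewrite (derM dd) IH.
by field; exact: f0.
Qed.
End FieldDerivations.

(** * Cauchy products over a splitting in two blocks *)

Section Cauchy.
Variables (F : fieldType) (T : finType) (mu : T -> F) (o : T).
Hypothesis mu_inj : injective mu.
Implicit Types (I J K : {set T}).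

Lemma mu_neq i j : i != j -> mu i - mu j != 0.
Proof. by apply: contra_neq => /eqP; rewrite subr_eq0 => /eqP/mu_inj. Qed.

(** Up to sign, the Vandermonde product of I times that of its complement, divided by the full one:
    the weight of I in a Laplace expansion divided by a Vandermonde determinant. *)
Definition cauchy I : F := \prod_(i in I) \prod_(j in ~: I) (mu j - mu i)^-1.

Local Notation y j := (mu o - mu j)^-1.

Lemma prod_sign K a (b : T -> F) :
  \prod_(k in K) (b k - a) = (-1) ^+ #|K| * \prod_(k in K) (a - b k).
Proof. by rewrite -prodrN; apply: eq_bigr => k _; rewrite opprB. Qed.

Lemma cauchy_add J j : j \notin J ->
  cauchy (j |: J) = (-1) ^+ #|~: J :\ j| * cauchy J
     * \prod_(i in J) (mu j - mu i) * \prod_(k in ~: J :\ j) (mu j - mu k)^-1.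
Proof.
move=> jJ; have jJ' : j \in ~: J by rewrite inE.
have JE : ~: (j |: J) = ~: J :\ j by apply/setP => k; rewrite !inE negb_or.
rewrite /cauchy big_setU1 //= JE.
rewrite [X in _ = _ * X * _ * _](eq_bigr (fun i => (mu j - mu i)^-1 * \prod_(k in ~: J :\ j) (mu k - mu i)^-1)); last first.
  by move=> i _; rewrite (big_setD1 j).
rewrite [in RHS]big_split /= !prodfV prod_sign invr_signM.
have nz : \prod_(i in J) (mu j - mu i) != 0.
  by apply/prodf_neq0 => i iJ; apply: mu_neq; apply: contraNneq jJ => ->.
have nz' : \prod_(k in ~: J :\ j) (mu j - mu k) != 0.
  by apply/prodf_neq0 => k; rewrite !inE => /andP[kj _]; apply: mu_neq; rewrite eq_sym.
by field; rewrite ?nz ?nz'.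
Qed.

Lemma cauchyC I : cauchy (~: I) = (-1) ^+ (#|I| * #|~: I|) * cauchy I.
Proof.
have -> : (-1) ^+ (#|I| * #|~: I|) = \prod_(i in I) \prod_(j in ~: I) (-1) :> F.
  by rewrite mulnC exprM -prodr_const; apply: eq_bigr => i _; rewrite prodr_const.
rewrite /cauchy setCK exchange_big /= -big_split /=.
apply: eq_bigr => i _; rewrite -big_split /=; apply: eq_bigr => j _.
by rewrite mulN1r -invrN opprB.
Qed.

Lemma cauchy_del J j : j \in J ->
  cauchy (J :\ j) = (-1) ^+ #|~: J| * cauchy J
     * \prod_(k in ~: J) (mu j - mu k) * \prod_(i in J :\ j) (mu j - mu i)^-1.
Proof.
move=> jJ; have := @cauchy_add (J :\ j) j; rewrite setD1K // !inE eqxx => /(_ isT) ->.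
have -> : ~: (J :\ j) :\ j = ~: J.
  by apply/setP => k; rewrite !inE; case: eqP => // ->; rewrite jJ.
have nz : \prod_(i in J :\ j) (mu j - mu i) != 0.
  by apply/prodf_neq0 => i; rewrite !inE => /andP[ij _]; apply: mu_neq; rewrite eq_sym.
have nz' : \prod_(i in ~: J) (mu j - mu i) != 0.
  by apply/prodf_neq0 => i; rewrite !inE => iJ; apply: mu_neq; apply: contraNneq iJ => <-.
have sgn : ((-1) ^+ #|~: J|) ^+ 2 = 1 :> F by rewrite sqrr_sign.
rewrite !prodfV; move: ((-1) ^+ #|~: J|) sgn => e sgn.
by field: sgn; rewrite nz nz'.
Qed.

Lemma size_prod_XsubC_set K : size (\prod_(k in K) ('X - (mu k)%:P)) = #|K|.+1.
Proof. by rewrite -big_enum size_prod_XsubC -cardE. Qed.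

Lemma horner_prod_XsubC K z : (\prod_(k in K) ('X - (mu k)%:P)).[z] = \prod_(k in K) (z - mu k).
Proof. by rewrite horner_prod; apply: eq_bigr => k _; rewrite hornerXsubC. Qed.

Lemma deriv_eval_prod K z : z \notin [seq mu k | k in K] ->
  (\prod_(k in K) ('X - (mu k)%:P))^`().[z]
  = (\prod_(k in K) (z - mu k)) * \sum_(k in K) (z - mu k)^-1.
Proof.
move=> zK; rewrite (eq_bigr (fun k => 'X + (- mu k)%:P)) => [|k _]; last by rewrite polyCN.
rewrite deriv_eval_prod_XaddC // => k kK; rewrite subr_eq0.
by apply: contraNneq zK => ->; apply: image_f.
Qed.

Let setD1in K j : j \in K -> #|K| = #|K :\ j|.+1.
Proof. by move=> jK; rewrite (cardsD1 j) jK. Qed.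

(** This collects the ways to reach J by deleting one element. If o is outside J, it is the
    derivative at mu_o of the product of X - mu_k over J, interpolated at the nodes outside J. If o
    is in J, the factor of o is dropped and a leading coefficient vanishes. *)
Lemma cauchy_lower J : #|~: J| = #|J|.+2 ->
  (if o \in J then 0 else
     cauchy (o |: J) * (\sum_(i in J) y i - \sum_(k in ~: J :\ o) y k))
  = \sum_(j in ~: J | j != o) y j * cauchy (j |: J).
Proof.
move=> cJ; have [oJ|oJ] := boolP (o \in J); last first.
  have oK : o \in ~: J by rewrite inE.
  pose P := \prod_(k in J) ('X - (mu k)%:P).
  have szP : (size P <= #|~: J|)%N by rewrite size_prod_XsubC_set cJ.
  have := lagrange_deriv (in2W mu_inj) szP oK.
  rewrite deriv_eval_prod; last first.
    by apply/imageP => -[k kJ /mu_inj e]; rewrite e kJ in oJ.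
  rewrite !horner_prod_XsubC -/P => e.
  rewrite cauchy_add // -!mulrA [_ * (\sum_(i in J) _ - _)]mulrC.
  have -> : \prod_(i in J) (mu o - mu i) *
     (( \sum_(i in J) y i - \sum_(k in ~: J :\ o) y k)* \prod_(k in ~: J :\ o) (mu o - mu k)^-1)
    = (\sum_(j in ~: J :\ o) P.[mu j] / (mu j - mu o) *
        \prod_(k in ~: J :\ o :\ j) ((mu o - mu k) / (mu j - mu k)))
       * \prod_(k in ~: J :\ o) (mu o - mu k)^-1.
    by rewrite mulrA mulrBr e; congr (_ * _); ring.
  rewrite [RHS](eq_bigl (mem (~: J :\ o))) => [|j]; last by rewrite !inE andbC.
  rewrite mulr_suml !mulr_sumr; apply: eq_bigr => j; rewrite !inE => /andP[jo jJ].
  have jKo : j \in ~: J :\ o by rewrite !inE jo jJ.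
  have oKj : o \in ~: J :\ j by rewrite !inE eq_sym jo.
  have jK : j \in ~: J by rewrite inE.
  rewrite cauchy_add // horner_prod_XsubC.
  rewrite [\prod_(k in ~: J :\ o) _](big_setD1 j jKo) [\prod_(k in ~: J :\ j) _](big_setD1 o oKj) /=.
  have -> : ~: J :\ j :\ o = ~: J :\ o :\ j.
    by apply/setP => k; rewrite !inE; case: (k == o); case: (k == j).
  have -> : #|~: J :\ o| = #|~: J :\ j|.
    by apply/eqP; rewrite -eqSS -!setD1in.
  rewrite big_split /= !prodfV.
  have nz : \prod_(k in ~: J :\ o :\ j) (mu o - mu k) != 0.
    by apply/prodf_neq0 => k; rewrite !inE => /and3P[_ ko _]; rewrite mu_neq // eq_sym.
  have nz' : \prod_(k in ~: J :\ o :\ j) (mu j - mu k) != 0.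
    by apply/prodf_neq0 => k; rewrite !inE => /and3P[kj _ _]; rewrite mu_neq // eq_sym.
  have nz1 := mu_neq jo; have nz2 : mu o - mu j != 0 by rewrite mu_neq // eq_sym.
  by field; rewrite nz nz' nz1 nz2.
pose P := \prod_(k in J :\ o) ('X - (mu k)%:P).
have szP : (size P < #|~: J|)%N by rewrite size_prod_XsubC_set -setD1in // cJ.
have := lagrange_lead (in2W mu_inj) szP => e.
rewrite [RHS](eq_bigl (mem (~: J))) => [|j]; last first.
  by rewrite !inE; case: eqP => [->|]; rewrite ?oJ ?andbT.
apply: etrans (_ : - (-1) ^+ #|J|.+1 * cauchy J *
  (\sum_(j in ~: J) P.[mu j] * \prod_(k in ~: J :\ j) (mu j - mu k)^-1) = _).
  by rewrite e mulr0.
rewrite mulr_sumr; apply: eq_bigr => j jK; have jJ : j \notin J by rewrite inE in jK.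
have jo : o != j by apply: contraNneq jJ => <-.
have cKj : #|~: J :\ j| = #|J|.+1 by apply/eqP; rewrite -eqSS -setD1in // cJ.
rewrite cauchy_add // (big_setD1 o oJ) /= horner_prod_XsubC cKj.
by field; apply: mu_neq.
Qed.

(** The counterpart for adding one element, with nodes in J. The additional factor X of the
    interpolated polynomial provides the values mu_j on the right, and its derivative provides the
    summand 1 on the left. *)
Lemma cauchy_raise J : #|J| = #|~: J|.+2 ->
  (if o \in J then
     cauchy (J :\ o) * (1 + mu o * (\sum_(k in ~: J) y k - \sum_(i in J :\ o) y i)) else 0)
  = \sum_(j in J | j != o) y j * mu j * cauchy (J :\ j).
Proof.
move=> cJ; have [oJ|oJ] := boolP (o \in J).
  pose P := 'X * \prod_(k in ~: J) ('X - (mu k)%:P).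
  have szP : (size P <= #|J|)%N.
    by rewrite /P mulrC size_mulX ?size_prod_XsubC_set ?cJ // -size_poly_gt0 size_prod_XsubC_set.
  have PE z : P.[z] = z * \prod_(k in ~: J) (z - mu k).
    by rewrite /P hornerM hornerX horner_prod_XsubC.
  have := lagrange_deriv (in2W mu_inj) szP oJ.
  rewrite {1}/P derivM derivX mul1r hornerD hornerM hornerX horner_prod_XsubC deriv_eval_prod; last first.
    by apply/imageP => -[k kJ /mu_inj e]; rewrite -e inE oJ in kJ.
  rewrite !PE => e.
  rewrite cauchy_del // -!mulrA.
  have -> : \prod_(k in ~: J) (mu o - mu k) * (\prod_(i in J :\ o) y i *
       (1 + mu o * (\sum_(k in ~: J) y k - \sum_(i in J :\ o) y i)))
    = (\sum_(j in J :\ o) P.[mu j] / (mu j - mu o) *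
        \prod_(k in J :\ o :\ j) ((mu o - mu k) / (mu j - mu k)))
       * \prod_(k in J :\ o) y k.
    rewrite mulrCA mulrC; congr (_ * _); apply: (addrI (mu o * \prod_(k in ~: J) (mu o - mu k) * \sum_(i in J :\ o) y i)).
    rewrite -e; ring.
  rewrite [RHS](eq_bigl (mem (J :\ o))) => [|j]; last by rewrite !inE andbC.
  rewrite mulr_suml !mulr_sumr; apply: eq_bigr => j; rewrite !inE => /andP[jo jJ].
  have jKo : j \in J :\ o by rewrite !inE jo jJ.
  have oKj : o \in J :\ j by rewrite !inE eq_sym jo.
  rewrite cauchy_del // PE.
  rewrite [\prod_(k in J :\ o) _](big_setD1 j jKo) [\prod_(k in J :\ j) _](big_setD1 o oKj) /=.
  have -> : J :\ j :\ o = J :\ o :\ j.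
    by apply/setP => k; rewrite !inE; case: (k == o); case: (k == j).
  rewrite big_split /= !prodfV.
  have nz : \prod_(k in J :\ o :\ j) (mu o - mu k) != 0.
    by apply/prodf_neq0 => k; rewrite !inE => /and3P[_ ko _]; rewrite mu_neq // eq_sym.
  have nz' : \prod_(k in J :\ o :\ j) (mu j - mu k) != 0.
    by apply/prodf_neq0 => k; rewrite !inE => /and3P[kj _ _]; rewrite mu_neq // eq_sym.
  have nz1 := mu_neq jo; have nz2 : mu o - mu j != 0 by rewrite mu_neq // eq_sym.
  by field; rewrite nz nz' nz1 nz2.
have oK : o \in ~: J by rewrite inE.
pose P := 'X * \prod_(k in ~: J :\ o) ('X - (mu k)%:P).
have szP : (size P < #|J|)%N.
  by rewrite /P mulrC size_mulX ?size_prod_XsubC_set -?setD1in ?cJ // -size_poly_gt0 size_prod_XsubC_set.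
have := lagrange_lead (in2W mu_inj) szP => e.
rewrite [RHS](eq_bigl (mem J)) => [|j]; last first.
  by rewrite !inE; case: eqP => [->|]; rewrite ?(negPf oJ) ?andbT.
apply: etrans (_ : - (-1) ^+ #|~: J| * cauchy J *
  (\sum_(j in J) P.[mu j] * \prod_(k in J :\ j) (mu j - mu k)^-1) = _).
  by rewrite e mulr0.
rewrite mulr_sumr; apply: eq_bigr => j jJ.
have jo : o != j by apply: contraNneq oJ => ->.
rewrite cauchy_del // [\prod_(k in ~: J) _](big_setD1 o oK) /= /P hornerM hornerX horner_prod_XsubC.
by field; apply: mu_neq.
Qed.

Section CauchyDerivatives.
Variable D : T -> F -> F.
Hypothesis dD : forall j, derivation (D j).
Hypothesis Dmu : forall j k, D j (mu k) = (j == k)%:R.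

Lemma der_cauchy I j : D j (cauchy I) = cauchy I *
  (if j \in I then \sum_(k in ~: I) (mu k - mu j)^-1 else - \sum_(i in I) (mu j - mu i)^-1).
Proof.
have nz i k : i \in I -> k \in ~: I -> mu k - mu i != 0.
  by rewrite inE => iI kI; apply: mu_neq; apply: contraNneq kI => ->.
have dlog i k : i \in I -> k \in ~: I ->
    D j (mu k - mu i)^-1 / (mu k - mu i)^-1 = ((j == i)%:R - (j == k)%:R) * (mu k - mu i)^-1.
  move=> iI kI; rewrite (derV (dD j)) (derB (dD j)) !Dmu; field; rewrite oner_neq0 nz //.
rewrite {1}/cauchy (der_prod_log (dD j)) // => [|i iI]; last first.
  by apply/prodf_neq0 => k kI; rewrite invr_neq0 // nz.
rewrite -/(cauchy I); congr (_ * _).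
rewrite (eq_bigr (fun i => \sum_(k in ~: I) ((j == i)%:R - (j == k)%:R) * (mu k - mu i)^-1)); last first.
  move=> i iI; rewrite (der_prod_log (dD j)) // => [|k kI]; last by rewrite invr_neq0 // nz.
  rewrite mulrAC divff ?mul1r; last by apply/prodf_neq0 => k kI; rewrite invr_neq0 // nz.
  by apply: eq_bigr => k kI; apply: dlog.
case: ifP => jI.
  rewrite (big_setD1 j) //= [X in _ + X]big1 ?addr0 => [|i].
    apply: eq_bigr => k; rewrite inE eqxx => kI.
    by rewrite (_ : (j == k) = false) ?subr0 ?mul1r //; apply: contraNF kI => /eqP<-.
  rewrite !inE => /andP[ij iI]; apply: big1 => k; rewrite inE => kI.
  rewrite (_ : (j == k) = false) 1?eq_sym ?(negPf ij) ?subrr ?mul0r //.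
  by apply: contraNF kI => /eqP->.
rewrite -sumrN; apply: eq_bigr => i iI.
have jK : j \in ~: I by rewrite inE jI.
rewrite (_ : (j == i) = false); last by apply: contraFF jI => /eqP->.
rewrite (big_setD1 j) //= big1 ?addr0 => [|k].
  by rewrite eqxx sub0r mulN1r.
by rewrite !inE => /andP[kj _]; rewrite eq_sym (negPf kj) subrr mul0r.
Qed.

(** A diagonal entry of the squared matrix derivative, acting on functions of the eigenvalues mu of
    a matrix. *)
Let wave (f : F) := D o (D o f) + \sum_(j | j != o) y j * (D o f - D j f).

(** With S the sum of y k over k outside I, D_o multiplies the product by - S. The square of S and
    the double poles cancel between D_o^2 and the terms with j outside I. What is left is a sum over
    j in I, j != o, and k outside I, each term of which vanishes by partial fractions. *)
Lemma cauchy_wave_in I : o \in I -> wave (cauchy I) = 0.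
Proof.
move=> oI; have nz k : k \in ~: I -> mu k - mu o != 0.
  by rewrite inE => kI; apply: mu_neq; apply: contraNneq kI => ->.
have nz' i k : i \in I -> k \in ~: I -> mu k - mu i != 0.
  by rewrite inE => iI kI; apply: mu_neq; apply: contraNneq kI => ->.
pose S := \sum_(k in ~: I) y k.
have yE k : y k = - (mu k - mu o)^-1 by rewrite -invrN opprB.
have DoE : D o (cauchy I) = cauchy I * - S.
  by rewrite der_cauchy oI -sumrN; congr (_ * _); apply: eq_bigr => k _; rewrite yE opprK.
have DS : D o S = - \sum_(k in ~: I) y k ^+ 2.
  rewrite (der_sum (dD o)) -sumrN; apply: eq_bigr => k kI.
  have ok : (o == k) = false by move: kI; rewrite inE; apply: contraNF => /eqP <-.
  by rewrite (derV (dD o)) (derB (dD o)) !Dmu eqxx ok subr0 mulN1r exprVn.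
rewrite /wave DoE (derM (dD o)) (derN (dD o)) DS DoE opprK.
have -> : \sum_(j | j != o) y j * (cauchy I * - S - D j (cauchy I)) = cauchy I *
   (\sum_(j in I | j != o) y j * (- S - \sum_(k in ~: I) (mu k - mu j)^-1) +
    \sum_(k in ~: I) y k * (- S + \sum_(j in I) (mu k - mu j)^-1)).
  rewrite (bigID (mem I)) /= mulrDr !mulr_sumr; congr (_ + _).
    apply: eq_big => [j|j]; first by rewrite andbC.
    by move=> /andP[_ jI]; rewrite der_cauchy jI; ring.
  apply: eq_big => [j|j]; first by rewrite inE; case: eqP => // ->; rewrite oI.
  by move=> /andP[_ jI]; rewrite der_cauchy (negPf jI); ring.
have -> : \sum_(k in ~: I) y k * (- S + \sum_(j in I) (mu k - mu j)^-1)
  = - S * S - \sum_(k in ~: I) y k ^+ 2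
    + \sum_(j in I | j != o) \sum_(k in ~: I) y k * (mu k - mu j)^-1.
  rewrite [X in _ = _ + X]exchange_big /= {3}/S mulr_sumr -sumrB -big_split /=.
  apply: eq_bigr => k kI; rewrite (bigD1 o) //= !mulrDr mulr_sumr [(mu k - mu o)^-1](_ : _ = - y k).
    ring.
  by rewrite yE opprK.
have : \sum_(j in I | j != o) y j * (- S - \sum_(k in ~: I) (mu k - mu j)^-1)
   + \sum_(j in I | j != o) \sum_(k in ~: I) y k * (mu k - mu j)^-1 = 0.
  rewrite -big_split big1 //= => j /andP[jI jo].
  rewrite -opprD {1}/S -big_split mulrN mulr_sumr -sumrN -big_split /= big1 // => k kI.
  have nz1 : mu o - mu j != 0 by apply: mu_neq; rewrite eq_sym.
  have nz2 : mu o - mu k != 0 by rewrite -oppr_eq0 opprB nz.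
  by field; rewrite nz1 nz2 nz'.
move: (\sum_(j in I | j != o) _) (\sum_(j in I | j != o) _) => u v /eqP.
by rewrite addr_eq0 => /eqP ->; ring.
Qed.

(** Passing to the complement multiplies the Cauchy product by a constant sign, so o may be assumed
    to lie in I. *)
Lemma cauchy_wave I : wave (cauchy I) = 0.
Proof.
have [oI|oI] := boolP (o \in I); first exact: cauchy_wave_in.
have der_sgn n j f : D j ((-1) ^+ n * f) = (-1) ^+ n * D j f.
  by rewrite -signr_odd; case: odd; rewrite ?expr1 ?expr0 ?mulN1r ?mul1r ?(derN (dD j)).
have := @cauchy_wave_in (~: I); rewrite inE => /(_ oI); rewrite cauchyC /wave !der_sgn.
rewrite (eq_bigr (fun j => (-1) ^+ (#|I| * #|~: I|) * (y j * (D o (cauchy I) - D j (cauchy I))))) => [|j _]; last first.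
  by rewrite der_sgn; ring.
by rewrite -mulr_sumr -mulrDr => /eqP; rewrite mulf_eq0 signr_eq0 => /eqP.
Qed.

End CauchyDerivatives.
End Cauchy.

Section SubsetSums.
Variables (V : nmodType) (T : finType).

(** Regroups a sum over sets I with a marked element by the set left after its deletion; this is how
    coefficients of equal monomials are collected in [flip_sum]. *)
Lemma sum_setD1 k (f : {set T} -> T -> V) (P : pred T) :
  \sum_(I : {set T} | #|I| == k.+1) \sum_(j in I | P j) f (I :\ j) j
  = \sum_(J : {set T} | #|J| == k) \sum_(j in ~: J | P j) f J j.
Proof.
rewrite !pair_big_dep /=.
rewrite (reindex_onto (fun p => (p.2 |: p.1, p.2)) (fun p => (p.1 :\ p.2, p.2))) /=; last first.
  by move=> [I j] /= /andP[_ /andP[jI _]]; rewrite setD1K.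
apply: eq_big => [[J j]|[J j]] /=; last first.
  by case/andP=> _ /eqP[->].
rewrite xpair_eqE eqxx andbT !inE eqxx /=; have [jJ|jJ] := boolP (j \in J).
  rewrite andbF; apply/negP => /andP[_ /eqP/setP/(_ j)].
  by rewrite !inE eqxx jJ.
by rewrite setU1K // eqxx andbT cardsU1 jJ add1n eqSS.
Qed.
End SubsetSums.

(** * The Airy operator on sums of monomials in a and b *)

Section MatrixAiry.
Variables (F : fieldType) (T : finType) (mu : T -> F) (o : T) (n : nat).
Hypotheses (mu_inj : injective mu) (cT : #|T| = n.*2).
Variable D : T -> F -> F.
Hypothesis dD : forall j, derivation (D j).
Hypothesis Dmu : forall j k, D j (mu k) = (j == k)%:R.

Variables (A : comAlgType F) (w : A) (dl : T -> A -> A) (s : T -> A).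
Hypothesis ddl : forall j, derivation (dl j).
Hypothesis dlA : forall j c, dl j (c%:A) = w * (D j c)%:A.
Hypothesis dlw : forall j, dl j w = 0.
(** The derivative w d/d mu_j conjugated by a prefactor whose logarithmic derivative is [s j]. The
    relations between [a] and [b] below hold only under [pi], which will be the truncation of
    series; hence the identities under [pi] in this section. *)
Let nabla j f := dl j f + s j * f.

Variables (a b : T -> A).
Hypotheses (dla : forall j i, j != i -> dl j (a i) = 0) (dlb : forall j i, j != i -> dl j (b i) = 0).

Variables (Rq : comNzRingType) (pi : {rmorphism A -> Rq}).
Hypothesis pi_dl : forall j x y, pi x = pi y -> pi (dl j x) = pi (dl j y).
Hypothesis pi_a : forall j, pi (nabla j (a j)) = pi (b j).
Hypothesis pi_b : forall j, pi (nabla j (b j)) = pi (mu j *: a j).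

Implicit Types (I J : {set T}) (i j : T).

Lemma dlZ j c x : dl j (c *: x) = w * (D j c *: x) + c *: dl j x.
Proof.
by rewrite -[c *: x]mulr_algl (derM (ddl j)) dlA -mulrA !mulr_algl.
Qed.

Lemma nablaZ j c x : nabla j (c *: x) = w * (D j c *: x) + c *: nabla j x.
Proof. by rewrite /nabla dlZ scalerDr -[s j * _]scalerAr addrA. Qed.

Lemma nablaD j x y : nabla j (x + y) = nabla j x + nabla j y.
Proof. by rewrite /nabla (derD (ddl j)) mulrDr addrACA. Qed.

Lemma nabla_w j x : nabla j (w * x) = w * nabla j x.
Proof. by rewrite /nabla (derM (ddl j)) dlw mul0r add0r mulrDr mulrCA. Qed.

Lemma pi_nabla j x y : pi x = pi y -> pi (nabla j x) = pi (nabla j y).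
Proof. by move=> e; rewrite /nabla !rmorphD !rmorphM e (pi_dl j e). Qed.

Lemma pi_scaleE k x : pi (k *: x) = pi (k%:A) * pi x.
Proof. by rewrite -[k *: x]mulr_algl rmorphM. Qed.

Lemma dl_prod0 j (P : pred T) (f : T -> A) : (forall i, P i -> dl j (f i) = 0) ->
  dl j (\prod_(i | P i) f i) = 0.
Proof.
move=> f0; elim/big_rec: _ => [|i x Pi IH]; first exact: (der1 (ddl j)).
by rewrite (derM (ddl j)) f0 // IH mul0r mulr0 addr0.
Qed.

Definition mono (I : {set T}) : A := \prod_i (if i \in I then a i else b i).
Definition mono' (I : {set T}) j : A := \prod_(i | i != j) (if i \in I then a i else b i).

(** What [nabla j] makes of [mono I] modulo [pi]: the factor a_j becomes b_j, and b_j becomes mu_j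
    a_j. *)
Definition flip (I : {set T}) j : A := (if j \in I then b j else mu j *: a j) * mono' I j.

Lemma monoE I j : mono I = (if j \in I then a j else b j) * mono' I j.
Proof. by rewrite /mono (bigD1 j). Qed.

Lemma flip_in I j : j \in I -> flip I j = mono (I :\ j).
Proof.
move=> jI; rewrite /flip jI (monoE _ j) !inE eqxx /=; congr (_ * _).
by apply: eq_bigr => i ij; rewrite !inE ij.
Qed.

Lemma flip_notin I j : j \notin I -> flip I j = mu j *: mono (j |: I).
Proof.
move=> jI; rewrite /flip (negPf jI) (monoE _ j) !inE eqxx /= -scalerAl; congr (_ *: (_ * _)).
by apply: eq_bigr => i ij; rewrite !inE (negPf ij).
Qed.

Lemma dl_mono' I j : dl j (mono' I j) = 0.
Proof. by apply: dl_prod0 => i ij; case: ifP => _; rewrite ?dla ?dlb // eq_sym. Qed.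

Lemma nabla_mulr j x y : dl j y = 0 -> nabla j (x * y) = nabla j x * y.
Proof. by move=> dy; rewrite /nabla (derM (ddl j)) dy mulr0 addr0 mulrDl mulrA. Qed.

Lemma pi_nabla_mono I j : pi (nabla j (mono I)) = pi (flip I j).
Proof.
rewrite (monoE I j) nabla_mulr ?dl_mono' // /flip !rmorphM; congr (_ * _).
by case: ifP => _; rewrite ?pi_a ?pi_b.
Qed.

Lemma pi_nabla_flip I j :
  pi (nabla j (flip I j)) = pi (mu j *: mono I + (if j \in I then 0 else w * mono (j |: I))).
Proof.
rewrite /flip nabla_mulr ?dl_mono' // (monoE I j) rmorphM; case: ifP => jI.
  by rewrite addr0 pi_b -rmorphM scalerAl.
rewrite nablaZ Dmu eqxx scale1r rmorphD mulrDl addrC rmorphD; congr (_ + _).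
  by rewrite pi_scaleE pi_a [RHS]pi_scaleE rmorphM mulrA.
rewrite -rmorphM -mulrA; congr (pi (_ * _)); rewrite (monoE _ j) !inE eqxx /=; congr (_ * _).
by apply: eq_bigr => i ij; rewrite !inE (negPf ij).
Qed.

Local Notation y j := (mu o - mu j)^-1.
Local Notation c := (cauchy mu).

Definition airy_psi : A := \sum_(I : {set T} | #|I| == n) c I *: mono I.

(** A diagonal entry of the matrix Airy equation, read on functions of the eigenvalues, with w in
    the role of Planck's constant. *)
Definition airy_op (f : A) : A :=
  nabla o (nabla o f) + w * (\sum_(j | j != o) y j *: (nabla o f - nabla j f)) - mu o *: f.

Lemma pi_scale k x x' : pi x = pi x' -> pi (k *: x) = pi (k *: x').
Proof. by move=> e; rewrite [LHS]pi_scaleE [RHS]pi_scaleE e. Qed.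

Definition flip_term I : A :=
  (2 * D o (c I)) *: flip I o + c I *: (if o \in I then 0 else mono (o |: I))
   + \sum_(j | j != o) y j *: (c I *: (flip I o - flip I j)).

(** Sorted by explicit powers of w: the quadratic part vanishes by [cauchy_wave], the part without w
    cancels against mu_o, and the linear part is [flip_term]. Differentiating the factor mu_o in
    [flip I o] is what creates the summand with [mono (o |: I)]. *)
Lemma pi_airy_term I : pi (airy_op (c I *: mono I)) = pi (w * flip_term I).
Proof.
have n1 j : pi (nabla j (c I *: mono I)) = pi (w * (D j (c I) *: mono I) + c I *: flip I j).
  by rewrite nablaZ !rmorphD; congr (_ + _); apply: pi_scale; apply: pi_nabla_mono.
have n2 : pi (nabla o (nabla o (c I *: mono I))) = pi (w * (w * (D o (D o (c I)) *: mono I)) +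
     w * ((2 * D o (c I)) *: flip I o) + c I *: (mu o *: mono I + (if o \in I then 0 else w * mono (o |: I)))).
  rewrite (pi_nabla _ (n1 o)) nablaD nabla_w !nablaZ !rmorphD.
  rewrite (pi_scale _ (pi_nabla_flip I o)) !rmorphM !rmorphD (pi_scale _ (pi_nabla_mono I o)).
  have -> : (2 * D o (c I)) *: flip I o = D o (c I) *: flip I o + D o (c I) *: flip I o.
    by rewrite mulr2n mulrDl !mul1r scalerDl.
  rewrite !rmorphM rmorphD; ring.
have wave := cauchy_wave o mu_inj dD Dmu I.
have n3 : pi (\sum_(j | j != o) y j *: (nabla o (c I *: mono I) - nabla j (c I *: mono I)))
   = pi (w * ((\sum_(j | j != o) y j * (D o (c I) - D j (c I))) *: mono I)
       + \sum_(j | j != o) y j *: (c I *: (flip I o - flip I j))).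
  rewrite scaler_suml mulr_sumr -big_split /= !rmorph_sum; apply: eq_bigr => j _ /=.
  rewrite -[RHS](_ : pi (y j *: ((w * (D o (c I) *: mono I) + c I *: flip I o)
       - (w * (D j (c I) *: mono I) + c I *: flip I j))) = _).
    by apply: pi_scale; rewrite !rmorphB !n1.
  congr (pi _); rewrite -[(y j * _) *: _]scalerA -[w * (y j *: _)]scalerAr -scalerDr; congr (_ *: _).
  by rewrite scalerBl mulrBr scalerBr opprD addrACA.
move/(congr1 (fun k => w * (w * (k *: mono I)))): wave.
rewrite scale0r !mulr0 scalerDl !mulrDr => wave.
rewrite /airy_op rmorphB rmorphD rmorphM n3 n2 /= /flip_term.
rewrite -rmorphM -rmorphD -rmorphB; congr (pi _).
have -> : c I *: (mu o *: mono I + (if o \in I then 0 else w * mono (o |: I)))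
   = mu o *: (c I *: mono I) + w * (c I *: (if o \in I then 0 else mono (o |: I))).
  rewrite scalerDr !scalerA [c I * _]mulrC -scalerAr; congr (_ + _ *: _).
  by case: ifP; rewrite ?mulr0.
rewrite !mulrDr -[RHS]add0r -{}wave.
set t1 := w * (w * (D o _ *: _)); set t2 := w * (_ *: flip _ _); set t4 := mu o *: _.
set t5 := w * (c I *: _); set t3 := w * (w * _); set t6 := w * _.
by clearbody t1 t2 t3 t4 t5 t6; ring.
Qed.

Local Notation "'Y' J" := (\sum_(j in J) y j) (at level 10).

(** A flip deletes or adds one element, so the terms fall on sets of size n - 1 and n + 1. The
    coefficient of each monomial vanishes by [cauchy_lower] in the first case and by [cauchy_raise]
    in the second. *)
Lemma flip_sum : \sum_(I : {set T} | #|I| == n) flip_term I = 0.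
Proof.
have oT : (0 < n)%N by have := max_card (pred1 o); rewrite card1 cT; case: n.
have cC (I : {set T}) : #|~: I| = (n.*2 - #|I|)%N by rewrite cardsCs setCK cT.
have termE I : flip_term I =
   ((if o \in I then (c I * (\sum_(i in I :\ o) y i - \sum_(k in ~: I) y k)) *: mono (I :\ o) else 0)
     - \sum_(j in I | j != o) (y j * c I) *: mono (I :\ j))
  + ((if o \in I then 0 else
       (c I * (1 + mu o * (\sum_(k in ~: I :\ o) y k - \sum_(i in I) y i))) *: mono (o |: I))
     - \sum_(j in ~: I | j != o) (y j * mu j * c I) *: mono (j |: I)).
  have sumE : \sum_(j | j != o) y j *: (c I *: (flip I o - flip I j)) =
      ((\sum_(j | j != o) y j) * c I) *: flip I o
      - \sum_(j in I | j != o) (y j * c I) *: mono (I :\ j)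
      - \sum_(j in ~: I | j != o) (y j * mu j * c I) *: mono (j |: I).
    rewrite -addrA -opprD mulr_suml scaler_suml.
    rewrite [X in _ = _ - X](_ : _ = \sum_(j | j != o) (y j * c I) *: flip I j).
      by rewrite -sumrB; apply: eq_bigr => j _; rewrite scalerA scalerBr.
    rewrite [RHS](bigID (mem I)) /=; congr (_ + _); apply: eq_big => [j|j]; rewrite ?inE 1?andbC //.
      by case/andP=> _ jI; rewrite flip_in.
    by case/andP=> _ jI; rewrite flip_notin // scalerA; congr (_ *: _); ring.
  have sumY : \sum_(j | j != o) y j = \sum_(j in I :\ o) y j + \sum_(j in ~: I :\ o) y j.
    rewrite (bigID (mem I)) /=; congr (_ + _); apply: eq_bigl => j; rewrite !inE //.
  rewrite /flip_term sumE der_cauchy //.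
  have S1 (J : {set T}) : \sum_(k in J) (mu k - mu o)^-1 = - \sum_(k in J) y k.
    by rewrite -sumrN; apply: eq_bigr => k _; rewrite -invrN opprB.
  case: ifP => oI; rewrite ?S1 ?scaler0 ?add0r ?addr0.
    rewrite flip_in // !addrA -scalerDl; congr (_ *: _ - _ - _); rewrite sumY.
    rewrite (_ : ~: I :\ o = ~: I); first by ring.
    by apply/setP => k; rewrite !inE; case: eqP => // ->; rewrite oI.
  rewrite flip_notin ?oI // !scalerA ?sub0r !addrA [- _ + _ *: _]addrC -!scalerDl.
  congr (_ *: _ - _ - _); rewrite sumY.
  rewrite (_ : I :\ o = I); first by ring.
  by apply/setP => k; rewrite !inE; case: eqP => // ->; rewrite oI.
rewrite (eq_bigr _ (fun I _ => termE I)) big_split /= !sumrB.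
have [k kE] : exists k, n = k.+1 by case: n oT => // k _; exists k.
have CD (J : {set T}) j : j \in J -> ~: (J :\ j) :\ j = ~: J.
  by move=> jJ; apply/setP => i; rewrite !inE; case: eqP => // ->; rewrite jJ.
have sum_o (J : {set T}) (G : T -> A) : (if o \in J then G o else 0) = \sum_(j in J | j == o) G j.
  case: ifP => oJ; last by rewrite big1 // => j /andP[jJ /eqP e]; rewrite -e jJ in oJ.
  by rewrite (big_pred1 o) // => j /=; case: eqP => [->|_]; rewrite ?oJ ?andbF.
set lower := _ - _; set raise := _ - _.
have -> : lower = 0.
  apply/eqP; rewrite subr_eq0; apply/eqP.
  pose f J j := (c (j |: J) * (\sum_(i in J) y i - \sum_(i in ~: J :\ j) y i)) *: mono J.
  pose g J j := (y j * c (j |: J)) *: mono J.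
  rewrite (eq_bigr (fun I : {set T} => \sum_(j in I | j == o) f (I :\ j) j)); last first.
    move=> I _; rewrite (sum_o I (fun j => (c I * (\sum_(i in I :\ j) y i - \sum_(k in ~: I) y k)) *: mono (I :\ j))).
    apply: eq_bigr => j /andP[jI _].
    by rewrite /f setD1K // CD.
  rewrite [RHS](eq_bigr (fun I : {set T} => \sum_(j in I | j != o) g (I :\ j) j)); last first.
    by move=> I _; apply: eq_bigr => j /andP[jI _]; rewrite /g setD1K.
  rewrite kE !sum_setD1; apply: eq_bigr => J /eqP cJ.
  rewrite [RHS](_ : _ = (\sum_(j in ~: J | j != o) y j * c (j |: J)) *: mono J); last by rewrite scaler_suml.
  rewrite -cauchy_lower //; last by rewrite cC kE cJ; lia.
  by rewrite -sum_o inE; case: (o \in J); rewrite ?scale0r.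
rewrite add0r; apply/eqP; rewrite subr_eq0; apply/eqP.
pose f I j := (c I * (1 + mu o * (\sum_(i in ~: I :\ j) y i - \sum_(i in I) y i))) *: mono (j |: I).
pose g I j := (y j * mu j * c I) *: mono (j |: I).
rewrite (eq_bigr (fun I : {set T} => \sum_(j in ~: I | j == o) f I j)); last first.
  by move=> I _; rewrite -sum_o inE; case: (o \in I).
rewrite -!sum_setD1; apply: eq_bigr => J /eqP cJ.
rewrite [RHS](eq_bigr (fun j => (y j * mu j * c (J :\ j)) *: mono J)); last first.
  by move=> j /andP[jJ _]; rewrite /g setD1K.
rewrite [RHS](_ : _ = (\sum_(j in J | j != o) y j * mu j * c (J :\ j)) *: mono J); last by rewrite scaler_suml.
rewrite -cauchy_raise //; last by rewrite cC cJ; lia.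
by rewrite -sum_o; case: ifP => oJ; rewrite ?scale0r // /f CD // setD1K.
Qed.

Lemma airy_op0 : airy_op 0 = 0.
Proof.
have n0 j : nabla j 0 = 0 by rewrite /nabla mulr0 addr0 (der0 (ddl j)).
rewrite /airy_op !n0 scaler0 big1 ?mulr0 ?addr0 ?subrr // => j _.
by rewrite n0 subrr scaler0.
Qed.

Lemma airy_opD f g : airy_op (f + g) = airy_op f + airy_op g.
Proof.
rewrite /airy_op !nablaD scalerDr.
rewrite (eq_bigr (fun j => y j *: (nabla o f - nabla j f) + y j *: (nabla o g - nabla j g))); last first.
  by move=> j _; rewrite nablaD -scalerDr opprD addrACA.
by rewrite big_split /= mulrDr opprD [X in X + _ = _]addrACA [LHS]addrACA.
Qed.

Lemma matrix_airy : pi (airy_op airy_psi) = 0.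
Proof.
have -> : airy_op airy_psi = \sum_(I : {set T} | #|I| == n) airy_op (c I *: mono I).
  by rewrite /airy_psi; elim/big_rec2: _ => [|I x x' _ <-]; rewrite ?airy_op0 ?airy_opD.
rewrite rmorph_sum (eq_bigr (fun I => pi (w * flip_term I))) => [|I _]; last exact: pi_airy_term.
by rewrite -rmorph_sum -mulr_sumr flip_sum mulr0 rmorph0.
Qed.

End MatrixAiry.

(** * Bipartite expansion and Cauchy-Binet for Pfaffians *)

Section BipartiteExpansion.
Variables (F : fieldType) (A : comAlgType F) (N : nat).
Hypothesis F0 : forall n, n.+1%:R != 0 :> F.
Local Notation T := 'I_N.
Variables (x0 : T) (l : T -> F) (a b : T -> A).
Hypothesis dl : forall i j, i != j -> (l i - l j != 0) && (l i + l j != 0).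
Implicit Types (I J K X : {set T}) (i j k : T).

Definition pair_sum X : F := \prod_(i in X) \prod_(j in X | (i < j)%N) (l i + l j).

Lemma pair_sumD1 X i : i \in X ->
  pair_sum X = \prod_(k in X :\ i) (l i + l k) * pair_sum (X :\ i).
Proof.
move=> iX; rewrite /pair_sum (big_setD1 i) //=.
have -> : \prod_(j in X | (i < j)%N) (l i + l j) = \prod_(j in X :\ i | (i < j)%N) (l i + l j).
  by apply: eq_bigl => j; rewrite !inE; case: (eqVneq j i) => [->|//]; rewrite ltnn !andbF.
have -> : \prod_(p in X :\ i) \prod_(q in X | (p < q)%N) (l p + l q)
   = \prod_(p in X :\ i | (p < i)%N) (l i + l p)
     * \prod_(p in X :\ i) \prod_(q in X :\ i | (p < q)%N) (l p + l q).
  rewrite [X in X * _]big_mkcondr -big_split /=; apply: eq_bigr => p pX.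
  case: ifP => pi.
    rewrite (bigD1 i) ?iX ?pi //= [l p + l i]addrC; congr (_ * _).
    by apply: eq_bigl => q; rewrite !inE andbC andbA.
  rewrite mul1r; apply: eq_bigl => q; rewrite !inE; case: eqP => //= ->.
  by rewrite pi andbF.
rewrite mulrA; congr (_ * _).
rewrite [RHS](bigID (fun k : T => (i < k)%N)) /=; congr (_ * _); apply: eq_bigl => k.
rewrite !inE -leqNgt [X in _ = _ && X]leq_eqVlt; case: (eqVneq k i) => [->|ki] //=.
by rewrite (_ : (k == i :> nat) = false) //; apply: contra_neqF ki => /eqP/val_inj.
Qed.

Lemma prod_setU (f : T -> F) J K : [disjoint J & K] ->
  \prod_(k in J :|: K) f k = \prod_(k in J) f k * \prod_(k in K) f k.
Proof.
by move=> JK; rewrite -bigU //; apply: eq_bigl => k; rewrite !inE.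
Qed.

(** The weight [cauchy] for the nodes l^2, between two given blocks. *)
Definition cross J K : F := \prod_(i in J) \prod_(j in K) (l j ^+ 2 - l i ^+ 2)^-1.

Definition bimono J K : A := (\prod_(i in J) a i) * \prod_(j in K) b j.

Definition bipartite_sum X m : A :=
  \sum_(I : {set T} | (I \subset X) && (#|I| == m)) cross I (X :\: I) *: bimono I (X :\: I).

Let coef X i j : F := (l j ^+ 2 - l i ^+ 2)^-1 * \prod_(k in X :\ i :\ j) ((l k - l i) * (l k - l j))^-1.

(* Both kinds of terms of the row expansion reduce to [bipartite_row]. *)
Lemma cross_row J K i m : i \notin J -> i \notin K -> [disjoint J & K] -> #|J| = m -> #|K| = m.+1 ->
  (-1) ^+ m * \sum_(j in K) coef (i |: (J :|: K)) i j * cross J (K :\ j) = cross (i |: J) K.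
Proof.
move=> iJ iK JK cJ cK.
have dX : distinct l (i |: (J :|: K)) by move=> p q _ _; apply: dl.
have row := bipartite_row dX iK (_ : #|K| = #|J|.+1) JK iJ.
rewrite -[RHS]mulr1 -[X in _ = _ * X]row ?cJ // !mulr_sumr; apply: eq_bigr => j jK.
have ij : i != j by apply: contraNneq iK => ->.
have jJ : j \notin J by apply: contraTN jK => jJ; move/pred0P/(_ j): JK => /=; rewrite jJ /= => ->.
have XE : (i |: (J :|: K)) :\ i :\ j = J :|: (K :\ j).
  apply/setP => k; rewrite !inE; case: (eqVneq k j) => [->|] /=; first by rewrite (negPf jJ).
  by case: (eqVneq k i) => [->|] //=; rewrite (negPf iJ) (negPf iK).
have JKj : [disjoint J & K :\ j] by apply: disjointWr JK; apply: subsetDl.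
have mK : j \notin J :|: (K :\ j) by rewrite !inE eqxx (negPf jJ).
have -> : cross (i |: J) K = (l j ^+ 2 - l i ^+ 2)^-1 * (\prod_(k in K :\ j) (l k ^+ 2 - l i ^+ 2)^-1)
     * (cross J (K :\ j) * \prod_(k in J) (l j ^+ 2 - l k ^+ 2)^-1).
  rewrite /cross big_setU1 //= (big_setD1 j) //= -big_split /=; congr (_ * _).
  by apply: eq_bigr => p _; rewrite (big_setD1 j) //= mulrC.
rewrite /coef XE prod_setU // -cJ.
have -> : \prod_(k in K :\ j) ((l k - l i) * (l k - l j))^-1 =
   \prod_(k in K :\ j) (l k ^+ 2 - l i ^+ 2)^-1 * \prod_(k in K :\ j) ((l k + l i) / (l k - l j)).
  rewrite -big_split /=; apply: eq_bigr => k; rewrite !inE => /andP[kj kK].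
  have ki : k != i by apply: contraNneq iK => <-.
  case/andP: (dl kj) => k1 _; case/andP: (dl ki) => k2 k3.
  by rewrite subr_sqr; field; rewrite k1 k2 k3.
have eJ : (-1) ^+ #|J| * \prod_(k in J) ((l k - l i) * (l k - l j))^-1 =
   \prod_(k in J) (l j ^+ 2 - l k ^+ 2)^-1 * \prod_(k in J) ((l j + l k) / (l k - l i)).
  rewrite -prodrN -big_split /=; apply: eq_bigr => k kJ.
  have ki : k != i by apply: contraNneq iJ => <-.
  have jk : j != k by apply: contraNneq jJ => ->.
  case/andP: (dl jk) => k1 k1'; case/andP: (dl ki) => k2 k3.
  by rewrite subr_sqr; field; rewrite k1 k1' k2 -opprB oppr_eq0 k1.
move: eJ; set p1 := \prod_(k in J) _; set p2 := \prod_(k in J) _; set p3 := \prod_(k in J) _ => eJ.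
by ring: eJ.
Qed.

Lemma crossC J K : cross J K = (-1) ^+ (#|J| * #|K|) * cross K J.
Proof.
have -> : (-1) ^+ (#|J| * #|K|) = \prod_(i in K) \prod_(j in J) (-1) :> F.
  by rewrite exprM -prodr_const; apply: eq_bigr => i _; rewrite prodr_const.
rewrite /cross exchange_big /= -big_split /=.
apply: eq_bigr => i _; rewrite -big_split /=; apply: eq_bigr => j _.
by rewrite mulN1r -invrN opprB.
Qed.

Lemma cross_row' J K i m : i \notin J -> i \notin K -> [disjoint J & K] -> #|J| = m.+1 -> #|K| = m ->
  (-1) ^+ m * \sum_(j in J) - coef (i |: (J :|: K)) i j * cross (J :\ j) K = cross J (i |: K).
Proof.
move=> iJ iK JK cJ cK; rewrite disjoint_sym in JK.
rewrite crossC cardsU1 iK cJ cK -(cross_row iK iJ JK cK cJ).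
have sg n (k : F) : (-1) ^+ (n.+1 * n.+1) * ((-1) ^+ n * ((-1) ^+ (n * n) * k)) = (-1) ^+ n * - k :> F.
  rewrite !mulrA -!exprD -signr_odd -[in RHS]signr_odd !oddD !oddM /=.
  by case: odd; rewrite ?expr0 ?expr1 ?mulN1r ?mul1r ?opprK.
rewrite (setUC J K) [in RHS](eq_bigr (fun j => (-1) ^+ (m * m) * (coef (i |: (K :|: J)) i j * cross (J :\ j) K))).
  by rewrite -mulr_sumr sg -sumrN; congr (_ * _); apply: eq_bigr => j _; rewrite mulNr.
move=> j jJ; rewrite crossC cK (_ : #|J :\ j| = m); last by move: cJ; rewrite (cardsD1 j) jJ => -[].
by rewrite mulrCA.
Qed.

Lemma sum_subset_in_out (V : nmodType) X i j m (f : {set T} -> V) : i \in X -> j \in X -> i != j ->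
  \sum_(I : {set T} | [&& I \subset X, #|I| == m.+1, i \in I & j \notin I]) f I
  = \sum_(I : {set T} | (I \subset X :\ i :\ j) && (#|I| == m)) f (i |: I).
Proof.
move=> iX jX ij.
rewrite (reindex_onto (fun I => i |: I) (fun I => I :\ i)) /=; last first.
  by move=> I /and4P[_ _ iI _]; rewrite setD1K.
apply: eq_bigl => I; rewrite !subsetD1 !inE subUset sub1set iX eqxx (eq_sym j i) (negPf ij) /=.
case: (boolP (i \in I)) => iI /=.
  rewrite andbF; apply/negbTE; rewrite negb_and; apply/orP; right.
  by apply/eqP => /setP/(_ i); rewrite !inE eqxx iI.
rewrite setU1K // eqxx andbT andbT cardsU1 iI add1n eqSS.
by case: (I \subset X) => //=; rewrite andbC.
Qed.

(** The sum is split by the block that contains i. The row identities spread each weight over the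
    possible partners j of i in the other block, and exchanging the sums regroups by j. A block with
    i gives a_i b_j, a block without i gives - b_i a_j. *)
Lemma bipartite_rec X i m : i \in X -> #|X| = m.+1.*2 ->
  bipartite_sum X m.+1 = (-1) ^+ m *: \sum_(j in X :\ i)
     coef X i j *: ((a i * b j - b i * a j) * bipartite_sum (X :\ i :\ j) m).
Proof.
move=> iX cX; rewrite /bipartite_sum (bigID (fun I : {set T} => i \in I)) /=.
have cK (I : {set T}) : I \subset X -> #|X :\: I| = (#|X| - #|I|)%N.
  by move=> IX; rewrite cardsD (setIidPr IX).
have disj (I : {set T}) : [disjoint I & X :\: I].
  by rewrite -setI_eq0; apply/eqP/setP => k; rewrite !inE; case: (k \in I).
have partD (I : {set T}) k : I \subset X -> k \in I -> k |: (I :\ k :|: (X :\: I)) = X.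
  move=> IX kI; apply/setP => p; rewrite !inE; case: (eqVneq p k) => [->|] /=.
    by rewrite (subsetP IX).
  by case: (boolP (p \in I)) => //= /(subsetP IX).
have partD' (I : {set T}) k : I \subset X -> k \in X -> k \notin I -> k |: (I :|: (X :\: I :\ k)) = X.
  move=> IX kX kI; apply/setP => p; rewrite !inE; case: (eqVneq p k) => [->|] //=.
  by case: (boolP (p \in I)) => //= /(subsetP IX).
have in_part : \sum_(I : {set T} | (I \subset X) && (#|I| == m.+1) && (i \in I))
      cross I (X :\: I) *: bimono I (X :\: I)
  = (-1) ^+ m *: \sum_(j in X :\ i) coef X i j *: (a i * b j *
      \sum_(I : {set T} | (I \subset X :\ i :\ j) && (#|I| == m))
         cross I (X :\ i :\ j :\: I) *: bimono I (X :\ i :\ j :\: I)).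
  rewrite (eq_bigr (fun I : {set T} => (-1) ^+ m *: \sum_(j in X :\: I)
     (coef X i j * cross (I :\ i) (X :\: I :\ j)) *: (a i * b j * bimono (I :\ i) (X :\: I :\ j)))); last first.
    move=> I /andP[/andP[IX /eqP cI] iI].
    have XI : X = i |: (I :\ i :|: (X :\: I)) by rewrite partD.
    rewrite -{1}(setD1K iI) -(@cross_row _ _ _ m) ?inE ?eqxx ?iI ?andbF //; first last.
    - by rewrite cK // cX cI; lia.
    - by move: cI; rewrite (cardsD1 i) iI => -[].
    - by apply: disjointWl (disj I); apply: subsetDl.
    rewrite -scalerA -XI scaler_suml; congr (_ *: _); apply: eq_bigr => j jK; congr (_ *: _).
    rewrite /bimono (big_setD1 i iI) (big_setD1 j jK) /=; ring.
  rewrite -scaler_sumr; congr (_ *: _).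
  rewrite (exchange_big_dep (fun j => j \in X :\ i)) /=; last first.
    move=> I j /andP[/andP[IX _] iI]; rewrite !inE => /andP[jI jX]; rewrite jX andbT.
    by apply: contraNneq jI => ->.
  apply: eq_bigr => j; rewrite !inE => /andP[ji jX].
  rewrite mulr_sumr scaler_sumr.
  rewrite (eq_bigl (fun I : {set T} => [&& I \subset X, #|I| == m.+1, i \in I & j \notin I])); last first.
    by move=> I; rewrite !inE jX andbT -!andbA.
  rewrite sum_subset_in_out // 1?eq_sym //; apply: eq_bigr => I /andP[IX _].
  have iI : i \notin I by apply/negP => /(subsetP IX); rewrite !inE eqxx andbF.
  rewrite setU1K // (_ : X :\: (i |: I) :\ j = X :\ i :\ j :\: I).
    by rewrite -scalerAr scalerA.
  by apply/setP => k; rewrite !inE; case: (k == i); case: (k == j); case: (k \in I).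
have out_part : \sum_(I : {set T} | (I \subset X) && (#|I| == m.+1) && (i \notin I))
      cross I (X :\: I) *: bimono I (X :\: I)
  = (-1) ^+ m *: \sum_(j in X :\ i) coef X i j *: (- (b i * a j) *
      \sum_(I : {set T} | (I \subset X :\ i :\ j) && (#|I| == m))
         cross I (X :\ i :\ j :\: I) *: bimono I (X :\ i :\ j :\: I)).
  rewrite (eq_bigr (fun I : {set T} => (-1) ^+ m *: \sum_(j in I)
     (coef X i j * cross (I :\ j) (X :\: I :\ i)) *: (- (b i * a j) * bimono (I :\ j) (X :\: I :\ i)))); last first.
    move=> I /andP[/andP[IX /eqP cI] iI].
    have XI : X = i |: (I :|: (X :\: I :\ i)) by rewrite partD'.
    have iK : i \in X :\: I by rewrite inE iI.
    rewrite -{1}(setD1K iK) -(@cross_row' _ _ _ m) ?inE ?eqxx ?iI ?andbF //; first last.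
    - by have := cK I IX; rewrite (cardsD1 i (X :\: I)) iK cX cI add1n -addnn addnK => -[].
    - by apply: disjointWr (disj I); apply: subsetDl.
    rewrite -scalerA -XI scaler_suml; congr (_ *: _); apply: eq_bigr => j jK.
    rewrite mulNr scaleNr mulNr scalerN; congr (- (_ *: _)).
    rewrite /bimono (big_setD1 i iK) (big_setD1 j jK) /=; ring.
  rewrite -scaler_sumr; congr (_ *: _).
  rewrite (exchange_big_dep (fun j => j \in X :\ i)) /=; last first.
    move=> I j /andP[/andP[IX _] iI] jI; rewrite !inE (subsetP IX) // andbT.
    by apply: contraNneq iI => <-.
  apply: eq_bigr => j; rewrite !inE => /andP[ji jX].
  rewrite mulr_sumr scaler_sumr.
  rewrite (eq_bigl (fun I : {set T} => [&& I \subset X, #|I| == m.+1, j \in I & i \notin I])); last first.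
    by move=> I; rewrite -!andbA [(i \notin I) && _]andbC.
  rewrite sum_subset_in_out //.
  have XE : X :\ j :\ i = X :\ i :\ j.
    by apply/setP => k; rewrite !inE; case: (k == i); case: (k == j).
  rewrite XE; apply: eq_bigr => I /andP[IX _].
  have jI : j \notin I by apply/negP => /(subsetP IX); rewrite !inE eqxx.
  rewrite setU1K // (_ : X :\: (j |: I) :\ i = X :\ i :\ j :\: I).
    by rewrite -scalerAr scalerA.
  by apply/setP => k; rewrite !inE; case: (k == i); case: (k == j); case: (k \in I).
rewrite in_part out_part -scalerDr -big_split /=; congr (_ *: _); apply: eq_bigr => j _.
by rewrite -scalerDr -mulrDl.
Qed.

(** Both sides obey the same expansion along the first index. Passing from m to m + 1 costs the sign
    (-1)^m, and 0 + 1 + ... + (m-1) = C(m,2). *)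
Lemma npfset_bipartite X m : #|X| = m.*2 ->
  npfset x0 (fun i j => (l j - l i) / (l i + l j))
    (fun i j => (l i + l j)^-1 *: (a i * b j - b i * a j)) X
  = ((-1) ^+ 'C(m, 2) * pair_sum X) *: bipartite_sum X m.
Proof.
elim: m X => [|m IH] X cX.
  have -> : X = set0 by apply/eqP; rewrite -cards_eq0 cX.
  rewrite npfset0 /pair_sum big_set0 mulr1 scale1r /bipartite_sum (big_pred1 set0) => [|I].
    by rewrite /cross /bimono set0D !big_set0 mulr1 scale1r.
  rewrite subset0 cards_eq0 andbb //.
have [i hi] : exists i, ohead (enum X) = Some i.
  by move: cX; rewrite cardE; case: (enum X) => // i t; exists i.
have iX : i \in X by rewrite -mem_enum; case: (enum X) hi => // k t [->]; rewrite inE eqxx.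
rewrite (npfset_rec F0 _ _ _ hi) ?cX ?odd_double //; first last.
- by move=> p q; rewrite [l q + _]addrC -scalerN opprB [b q * _]mulrC [a q * _]mulrC.
- by move=> p q; rewrite [l q + _]addrC -mulNr opprB.
rewrite (bipartite_rec iX cX) scalerA scaler_sumr; apply: eq_bigr => j jX.
have ij : i != j by move: jX; rewrite !inE eq_sym => /andP[].
have cXij : #|X :\ i :\ j| = m.*2.
  by move: cX; rewrite (cardsD1 i) iX (cardsD1 j (X :\ i)) jX doubleS !add1n => -[].
rewrite IH // -scalerAl -scalerAr !scalerA; congr (_ *: _).
rewrite (pair_sumD1 iX) (pair_sumD1 jX) (big_setD1 j jX) /= /coef.
have -> : (-1) ^+ 'C(m.+1, 2) = (-1) ^+ m * (-1) ^+ 'C(m, 2) :> F.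
  by rewrite binS bin1 exprD mulrC.
have -> : \prod_(k in X :\ i :\ j)
    ((l k - l i) / (l i + l k) * ((l k - l j) / (l j + l k)))^-1
  = \prod_(k in X :\ i :\ j) (l i + l k) * \prod_(k in X :\ i :\ j) (l j + l k)
    * \prod_(k in X :\ i :\ j) ((l k - l i) * (l k - l j))^-1.
  rewrite -!big_split /=; apply: eq_bigr => k; rewrite !inE => /and3P[kj ki _].
  case/andP: (dl kj) => k1 k1'; case/andP: (dl ki) => k2 k2'.
  by field; rewrite k1 k2 [l i + _]addrC k2' [l j + _]addrC k1'.
have sgn : ((-1) ^+ m) ^+ 2 = 1 :> F by rewrite sqrr_sign.
move: ((-1) ^+ m) sgn => e sgn.
have ji : j != i by rewrite eq_sym.
case/andP: (dl ij) => k1 k1'; case/andP: (dl ji) => k2 k2'.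
rewrite subr_sqr; field: sgn; by rewrite ?k1 ?k2 ?k1' ?k2'.
Qed.

End BipartiteExpansion.

(** * The Pfaffian of a sum with a Schur kernel *)

Section PfaffianSum.
Variables (F : fieldType) (A : comAlgType F) (T : finType) (x0 : T).
Hypothesis F0 : forall n, n.+1%:R != 0 :> F.
Variables (s : T -> T -> F) (f : T -> T -> A).
Hypotheses (santi : forall x y, s y x = - s x y) (fanti : forall x y, f y x = - f x y).
Hypothesis s_neq0 : forall x y, x != y -> s x y != 0.
Hypothesis s_row : forall i (Y : {set T}), i \notin Y -> odd #|Y| ->
  \sum_(j in Y) \prod_(k in Y :\ j) (s i k * s j k)^-1 = 1.
Implicit Types (I J X Y : {set T}) (i j k : T).

Definition cross_inv I J : F := \prod_(p in I) \prod_(k in J) (s p k)^-1.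

Lemma ohead_enumS X I i : I \subset X -> ohead (enum X) = Some i -> i \in I -> ohead (enum I) = Some i.
Proof.
move=> IX hX iI; have -> : enum I = [seq x <- enum X | x \in I].
  rewrite /enum_mem -filter_predI; apply: eq_filter => x /=.
  by case: (boolP (x \in I)) => // /(subsetP IX) ->.
by case: (enum X) hX => // x t [->] /=; rewrite iI.
Qed.

(** Induction along the row of the first index i. The entries f i j produce the subsets containing
    i. The entries s i j produce those avoiding i: for a fixed I, the partner j runs over the rest
    of the complement, where the row identity [s_row] makes the weights add up to the required
    one. *)
Lemma npfset_add X : ~~ odd #|X| ->
  npfset x0 s (fun i j => (s i j)%:A + f i j) X
  = \sum_(I : {set T} | (I \subset X) && ~~ odd #|I|) cross_inv I (X :\: I) *: npfset x0 s f I.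
Proof.
have [m] := ubnP #|X|; elim: m X => // m IH X; rewrite ltnS => cX eX.
have [X0|[i0 i0X]] := set_0Vmem X.
  rewrite X0 npfset0 (big_pred1 set0) => [|I].
    by rewrite /cross_inv big_set0 scale1r npfset0.
  by rewrite /= subset0; case: (eqVneq I set0) => [->|//]; rewrite cards0.
have [i hi] : exists i, ohead (enum X) = Some i.
  by move: i0X; rewrite -mem_enum; case: (enum X) => // i t _; exists i.
have iX : i \in X by rewrite -mem_enum; case: (enum X) hi => // k t [->]; rewrite inE eqxx.
rewrite (npfset_rec F0 _ santi _ hi) //; last first.
  by move=> p q; rewrite fanti santi scaleNr opprD.
have cXij j : j \in X :\ i -> #|X| = #|X :\ i :\ j|.+2.
  by move=> jX; rewrite (cardsD1 i) iX (cardsD1 j (X :\ i)) jX.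
rewrite (eq_bigr (fun j => (\prod_(k in X :\ i :\ j) (s i k * s j k)^-1) *:
      (\sum_(I : {set T} | (I \subset X :\ i :\ j) && ~~ odd #|I|)
          cross_inv I (X :\ i :\ j :\: I) *: npfset x0 s f I)
   + ((s i j)^-1 * \prod_(k in X :\ i :\ j) (s i k * s j k)^-1) *: (f i j *
      (\sum_(I : {set T} | (I \subset X :\ i :\ j) && ~~ odd #|I|)
          cross_inv I (X :\ i :\ j :\: I) *: npfset x0 s f I)))); last first.
  move=> j jX; have ij : i != j by move: jX; rewrite !inE eq_sym => /andP[].
  rewrite IH; first last.
  - by move: eX; rewrite (cXij j jX) /= negbK.
  - by move: cX; rewrite (cXij j jX); lia.
  rewrite mulrDl scalerDr mulr_algl !scalerA; congr (_ *: _ + _).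
  by rewrite mulrAC mulVf ?mul1r // s_neq0.
rewrite big_split /= [RHS](bigID (fun I : {set T} => i \in I)) /= addrC; congr (_ + _).
  rewrite (eq_bigr (fun j => \sum_(I : {set T} | (I \subset X :\ i :\ j) && ~~ odd #|I|)
     (((s i j)^-1 * \prod_(k in X :\ i :\ j) (s i k * s j k)^-1) *
        cross_inv I (X :\ i :\ j :\: I)) *: (f i j * npfset x0 s f I))); last first.
    by move=> j _; rewrite mulr_sumr scaler_sumr; apply: eq_bigr => I _; rewrite -scalerAr scalerA.
  rewrite [RHS](eq_bigr (fun I : {set T} => \sum_(j in I :\ i) (cross_inv I (X :\: I) *
     ((s i j)^-1 * \prod_(k in I :\ i :\ j) (s i k * s j k)^-1)) *: (f i j * npfset x0 s f (I :\ i :\ j)))); last first.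
    move=> I /andP[/andP[IX eI] iI]; rewrite (npfset_rec F0 _ santi fanti (ohead_enumS IX hi iI)) //.
    by rewrite scaler_sumr; apply: eq_bigr => j _; rewrite scalerA.
  rewrite [RHS](exchange_big_dep (fun j => j \in X :\ i)) /=; last first.
    move=> I j /andP[/andP[IX _] _]; rewrite !inE => /andP[-> jI]; exact: (subsetP IX).
  apply: eq_bigr => j jX; have /andP[ji jX'] : (j != i) && (j \in X) by move: jX; rewrite !inE.
  rewrite [RHS](reindex_onto (fun I => i |: (j |: I)) (fun I => I :\ i :\ j)) /=; last first.
    by move=> I; rewrite !inE => /andP[/andP[_ iI] /andP[_ jI]]; rewrite setD1K ?setD1K // !inE ji.
  have mem_ij I : i \notin I -> j \notin I -> (i |: (j |: I)) :\ i :\ j = I.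
    move=> iI jI; rewrite setU1K ?setU1K // !inE eq_sym negb_or ji //.
  apply: eq_big => [I|I /andP[IX eI]].
    rewrite !subsetD1 !inE !subUset !sub1set iX jX' eqxx /= eqxx ji orbT /= !andbT.
    case: (boolP (i \in I)) => iI; rewrite ?andbF.
      apply/esym/negP => /andP[_ /eqP/setP/(_ i)]; rewrite !inE eqxx iI; by case: (i == j).
    case: (boolP (j \in I)) => jI; rewrite ?andbF /=.
      by apply/esym/negP => /andP[_ /eqP/setP/(_ j)]; rewrite !inE eqxx jI.
    rewrite mem_ij // eqxx andbT !cardsU1 !inE (eq_sym i j) (negPf ji) (negPf iI) (negPf jI) !add1n /= negbK.
    by rewrite !andbT.
  move: IX; rewrite !subsetD1 => /andP[/andP[IX iI] jI].
  rewrite mem_ij //; congr (_ *: _).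
  have ZE : X :\: (i |: (j |: I)) = X :\ i :\ j :\: I.
    by apply/setP => k; rewrite !inE; case: (k == i); case: (k == j); case: (k \in I).
  rewrite ZE /cross_inv (big_setU1 i) /= ?inE ?negb_or 1?eq_sym ?ji // (big_setU1 j) //=.
  rewrite [\prod_(k in X :\ i :\ j) _](big_setID I) /=.
  rewrite (setIidPr _); last by rewrite !subsetD1 IX iI jI.
  rewrite [X in _ * (_ * X) * _ = _](eq_bigr (fun k => (s i k)^-1 * (s j k)^-1)) => [|k _]; last exact: invfM.
  rewrite [X in _ * (_ * X) * _ = _]big_split /=; ring.
rewrite (eq_bigr (fun j => \sum_(I : {set T} | (I \subset X :\ i :\ j) && ~~ odd #|I|)
     (\prod_(k in X :\ i :\ j) (s i k * s j k)^-1 * cross_inv I (X :\ i :\ j :\: I)) *: npfset x0 s f I)); last first.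
  by move=> j _; rewrite scaler_sumr; apply: eq_bigr => I _; rewrite scalerA.
rewrite (exchange_big_dep (fun I : {set T} => (I \subset X) && ~~ odd #|I| && (i \notin I))) /=; last first.
  by move=> j I _ /andP[]; rewrite !subsetD1 => /andP[/andP[-> ->] _] ->.
apply: eq_bigr => I /andP[/andP[IX eI] iI]; rewrite -scaler_suml; congr (_ *: _).
have iZ : i \in X :\: I by rewrite inE iI.
have oY : odd #|X :\: I :\ i|.
  have := cardsID I X; rewrite (setIidPr IX) (cardsD1 i (X :\: I)) iZ add1n => cE.
  by move: eX; rewrite -cE oddD (negPf eI) /= negbK.
have iY : i \notin X :\: I :\ i by rewrite !inE eqxx.
rewrite -[RHS]mulr1 -[X in _ = _ * X](s_row iY oY) mulr_sumr.
rewrite (eq_bigl (fun j => j \in X :\: I :\ i)) => [|j]; last first.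
  by rewrite !subsetD1 !inE IX eI iI /= andbT andbAC -andbA; case: (j == i); case: (j \in I).
apply: eq_bigr => j jY; have /and3P[ji jI jX] : [&& j != i, j \notin I & j \in X].
  by move: jY; rewrite !inE.
rewrite [\prod_(k in X :\ i :\ j) _](big_setID I) /= (setIidPr _); last first.
  by rewrite !subsetD1 IX iI jI.
have ZE : X :\ i :\ j :\: I = X :\: I :\ i :\ j.
  by apply/setP => k; rewrite !inE; case: (k == i); case: (k == j); case: (k \in I).
rewrite ZE -mulrA [RHS]mulrC [RHS]mulrC.
have -> : cross_inv I (X :\: I) = \prod_(k in I) (s i k * s j k)^-1 * cross_inv I (X :\: I :\ i :\ j).
  rewrite /cross_inv -big_split /=; apply: eq_bigr => p _.
  rewrite (big_setD1 i iZ) (big_setD1 j jY) /= mulrA (santi i p) (santi j p).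
  by rewrite !invrN mulrNN invfM.
ring.
Qed.

End PfaffianSum.

(** * Schur Q-polynomials *)

Section QPolynomials.
Variables (F : fieldType) (A : comAlgType F).
Hypothesis F0 : forall n, n.+1%:R != 0 :> F.

Lemma mulrnI_alg n (x y : A) : n.+1%:R * x = n.+1%:R * y -> x = y.
Proof.
rewrite !mulr_natl -!scaler_nat => e.
by rewrite -[x]scale1r -[y]scale1r -(mulVf (F0 n)) -!scalerA e.
Qed.

Lemma coef_expr_eq (R : comNzRingType) (p p' : {poly R}) k n :
  (forall i, (i <= k)%N -> p`_i = p'`_i) -> forall i, (i <= k)%N -> (p ^+ n)`_i = (p' ^+ n)`_i.
Proof.
move=> e; elim: n => [|n IH] i ik; first by rewrite !expr0.
rewrite !exprS !coefM; apply: eq_bigr => j _.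
have ji : (j <= i)%N by rewrite -ltnS.
by rewrite e ?IH // ?(leq_trans _ ik) // leq_subr.
Qed.

(** The coefficient of z^i in the derivative of the exponent 2 sum_j t_(2j+1) z^(2j+1). *)
Definition dlogq (t : oddn -> A) i : A :=
  if odd i then 0 else 2 * i.+1%:R * t (odd_idx i./2).

Section Recursion.
Variable t : oddn -> A.

Lemma coef_expo N i : (expo_trunc t N)`_i = if odd i && (i./2 < N)%N then 2 * t (odd_idx i./2) else 0.
Proof.
rewrite /expo_trunc -[2]polyC_natr coefCM coef_sum; case: ifP => [/andP[oi iN]|h].
  rewrite (bigD1 (Ordinal iN)) //= big1 => [|j ji].
    by rewrite addr0 coefCM coefXn -[X in X == _]odd_double_half oi add1n eqxx mulr1.
  rewrite coefCM coefXn -[X in X == _]odd_double_half oi add1n eqSS (inj_eq double_inj).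
  by rewrite eq_sym (_ : (j == i./2 :> nat) = false) ?mulr0 //; apply: contraNF ji => /eqP ?; apply/eqP/val_inj.
rewrite big1 ?mulr0 // => j _; rewrite coefCM coefXn; case: eqP => [e|]; last by rewrite mulr0.
by move: h; rewrite e /= odd_double uphalf_double ltn_ord.
Qed.

Lemma coef_expo_pow N n k : (k < n)%N -> (expo_trunc t N ^+ n)`_k = 0.
Proof.
elim: n k => // n IH k kn; rewrite exprS coefM big1 // => -[[|j] /= jk] _.
  by rewrite coef_expo mul0r.
by rewrite IH ?mulr0 //; lia.
Qed.

(** Both truncation bounds may be enlarged, so that several coefficients can be read off the same
    truncated exponential. *)
Lemma qE N m k : (k < N)%N -> (k < m)%N ->
  q t k = \sum_(n < m) (n`!%:R^-1 : F) *: (expo_trunc t N ^+ n)`_k.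
Proof.
move=> kN km; rewrite /q (big_ord_widen m (fun n => (n`!%:R^-1 : F) *: (expo_trunc t k.+1 ^+ n)`_k)) //.
rewrite [RHS](bigID (fun n : 'I_m => (n < k.+1)%N)) /= [X in _ = _ + X]big1 ?addr0 => [|n]; last first.
  by rewrite -leqNgt => kn; rewrite coef_expo_pow // scaler0.
apply: eq_bigr => n _; congr (_ *: _).
apply: (@coef_expr_eq _ _ _ k) => // i ik; rewrite !coef_expo; case: (odd i) => //=.
by rewrite !ifT //; lia.
Qed.

Lemma q0 : q t 0 = 1.
Proof. by rewrite /q big_ord1 expr0 coef1 fact0 invr1 scale1r. Qed.

Lemma q_rec k : k.+1%:R * q t k.+1 = \sum_(i < k.+1) dlogq t i * q t (k - i).
Proof.
pose N := k.+2; pose E := expo_trunc t N.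
have dE i : (i <= k)%N -> (E^`())`_i = dlogq t i.
  move=> ik; rewrite coef_deriv coef_expo /dlogq /= uphalf_half.
  case: (boolP (odd i)) => oi /=; first by rewrite mul0rn.
  rewrite add0n ifT; last by rewrite /N; lia.
  by rewrite -[LHS]mulr_natl mulrCA mulrA.
pose G m : {poly A} := \sum_(n < m) ((n`!%:R^-1 : F)%:A)%:P * E ^+ n.
have GE m i : (i < N)%N -> (i < m)%N -> (G m)`_i = q t i.
  move=> iN im; rewrite (qE iN im) coef_sum; apply: eq_bigr => n _.
  by rewrite coefCM mulr_algl.
(* The derivative of a partial sum of the exponential is exactly E' times the partial sum with one
   term less; no error term appears. *)
have dG m : (G m.+1)^`() = E^`() * G m.
  rewrite /G big_ord_recl expr0 mulr1 derivD derivC add0r raddf_sum mulr_sumr; apply: eq_bigr => n _ /=.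
  rewrite derivM derivC mul0r add0r deriv_exp /bump /= add1n /=.
  have key : ((n.+1`!%:R^-1 : F)%:A)%:P * n.+1%:R = ((n`!%:R^-1 : F)%:A)%:P :> {poly A}.
    rewrite -polyC_natr -polyCM mulr_algl -scaler_nat scalerA factS natrM invfM.
    by rewrite mulrAC mulVf ?F0 // mul1r.
  by rewrite -key -mulr_natl; ring.
have := congr1 (fun p : {poly A} => p`_k) (dG k.+1).
rewrite coef_deriv GE // -[LHS]mulr_natl => ->.
rewrite coefM; apply: eq_bigr => i _; have ik : (i <= k)%N by rewrite -ltnS.
by rewrite dE // GE // /N; lia.
Qed.

End Recursion.

(** In characteristic zero the recursion determines the sequence; the closed forms [q_time1],
    [q_time3] and [q_miwa1] are verified by checking it. *)
Lemma q_unique (t : oddn -> A) (r : nat -> A) :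
  r 0%N = 1 -> (forall k, k.+1%:R * r k.+1 = \sum_(i < k.+1) dlogq t i * r (k - i)%N) ->
  r =1 q t.
Proof.
move=> r0 rS k; have [n] := ubnP k; elim: n k => // n IH [|k]; first by rewrite r0 q0.
rewrite ltnS => kn; apply: (@mulrnI_alg k); rewrite rS q_rec; apply: eq_bigr => i _.
by rewrite IH //; lia.
Qed.

Section Convolution.
Variables (t1 t2 t3 : oddn -> A).
Hypothesis tD : forall i, dlogq t3 i = dlogq t1 i + dlogq t2 i.

Lemma q_conv k : q t3 k = \sum_(i < k.+1) q t1 i * q t2 (k - i).
Proof.
apply/esym; apply: (q_unique (r := fun k => \sum_(i < k.+1) q t1 i * q t2 (k - i))) => {k}.
  by rewrite big_ord1 !q0 mulr1.
move=> k; pose P N (r : nat -> A) := \poly_(i < N) r i.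
have PE N r i : (i < N)%N -> (P N r)`_i = r i by move=> iN; rewrite coef_poly iN.
have convE r1 r2 N i : (i < N)%N -> (P N r1 * P N r2)`_i = \sum_(j < i.+1) r1 j * r2 (i - j)%N.
  move=> iN; rewrite coefM; apply: eq_bigr => j _; rewrite !PE //; have := ltn_ord j; lia.
have dP t i : (i <= k)%N -> ((P k.+2 (q t))^`())`_i = (P k.+2 (dlogq t) * P k.+2 (q t))`_i.
  by move=> ik; rewrite coef_deriv PE ?convE ?ltnS // ?(leqW ik) // -q_rec mulr_natl.
rewrite -(convE _ _ k.+2) // mulr_natl -coef_deriv derivM coefD.
rewrite -[RHS](convE (dlogq t3) (fun k => \sum_(i < k.+1) q t1 i * q t2 (k - i)) k.+1) //.
have cE : forall i, (i <= k)%N -> (P k.+1 (fun k => \sum_(i < k.+1) q t1 i * q t2 (k - i)))`_i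
    = (P k.+2 (q t1) * P k.+2 (q t2))`_i.
  by move=> i ik; rewrite PE // convE // ltnS leqW.
have step1 : ((P k.+2 (q t1))^`() * P k.+2 (q t2))`_k
   = (P k.+2 (dlogq t1) * (P k.+2 (q t1) * P k.+2 (q t2)))`_k.
  rewrite mulrA !coefM; apply: eq_bigr => i _; rewrite dP //; by rewrite -ltnS.
have step2 : (P k.+2 (q t1) * (P k.+2 (q t2))^`())`_k
   = (P k.+2 (dlogq t2) * (P k.+2 (q t1) * P k.+2 (q t2)))`_k.
  rewrite mulrCA !coefM; apply: eq_bigr => i _; rewrite dP //; by rewrite leq_subr.
rewrite step1 step2 !coefM -big_split /=; apply: eq_bigr => i _.
rewrite !(PE k.+2) ?(PE k.+1 (dlogq t3)) ?cE ?leq_subr ?tD ?mulrDl //; have := ltn_ord i; lia.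
Qed.
End Convolution.

Section Alternating.
Variable t : oddn -> A.

(* [Q(z) Q(-z) = 1], since only odd times occur. *)
Lemma q_alternating k : \sum_(i < k.+2) (-1) ^+ i * q t i * q t (k.+1 - i) = 0.
Proof.
pose t' k := - t k; pose z (k : oddn) := 0 : A.
have q' : (fun k => (-1) ^+ k * q t k) =1 q t'.
  apply: q_unique => [|j]; first by rewrite q0 mulr1.
  rewrite mulrCA q_rec mulr_sumr; apply: eq_bigr => i _.
  have -> : dlogq t' i = - dlogq t i.
    by rewrite /dlogq /t'; case: ifP => _; rewrite ?oppr0 // mulrN.
  case: (boolP (odd i)) => oi; first by rewrite /dlogq oi oppr0 !mul0r mulr0.
  have -> : (-1) ^+ (j - i) = (-1) ^+ j :> A.
    have ij : (i <= j)%N by rewrite -ltnS.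
    by rewrite -signr_odd -[in RHS]signr_odd oddB // (negPf oi) addbF.
  by rewrite exprS mulN1r !mulNr; congr (- _); rewrite mulrCA.
have qz j : q z j = (j == 0%N)%:R.
  rewrite -(@q_unique z (fun j => (j == 0%N)%:R)) // => i.
  by rewrite mulr0 big1 // => p _; rewrite /dlogq /z mulr0 if_same mul0r.
have hz i : dlogq z i = dlogq t' i + dlogq t i.
  by rewrite /dlogq /z /t'; case: ifP => _; rewrite ?addr0 // mulrN mulr0 addNr.
have := q_conv hz k.+1; rewrite qz /= => e.
by rewrite [RHS]e; apply: eq_bigr => i _; rewrite -q'.
Qed.

Local Notation M := (M t).

Lemma M_r0 r : M r.+1 0 = q t r.+1.
Proof. by rewrite /Defs.M /= big_geq // mulr0 addr0 q0 mulr1. Qed.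

Lemma M00 : M 0 0 = 0.
Proof. by []. Qed.

Lemma M_0s s : M 0 s.+1 = - q t s.+1.
Proof.
rewrite /Defs.M /= q0 mul1r big_add1 big_mkord /=.
have := q_alternating s; rewrite big_ord_recl /= mul1r q0 mul1r subn0 => /eqP.
rewrite addrC addr_eq0 => /eqP e.
rewrite (eq_bigr (fun i : 'I_s.+1 => (-1) ^+ lift ord0 i * q t (lift ord0 i) * q t (s.+1 - lift ord0 i))).
  by rewrite e; ring.
by move=> i _; rewrite /= /bump add1n add0n mulrA.
Qed.

(** Together with the column s = 0, this recursion determines the whole array. [M_time1], [M_time3]
    and [M_miwa] are proved by verifying it for the proposed closed form. *)
Lemma M_rec r s : M r.+1 s + M r s.+1 = q t r * q t s.+1 - q t r.+1 * q t s.
Proof.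
rewrite /Defs.M /= andbF big_add1 [in X in _ + X]big_add1 /= !big_mkord big_ord_recl /=.
rewrite [X in _ + (_ + 2 * (_ + X))](eq_bigr (fun i : 'I_s => - ((-1) ^+ i.+1 * (q t (r.+1 + i.+1) * q t (s - i.+1))))).
  by rewrite sumrN addn1 subn1 /= expr1; ring.
by move=> i _; rewrite /bump add1n exprS mulN1r mulNr addSnnS subSS.
Qed.

Lemma M_anti r s : M s r = - M r s.
Proof.
apply/eqP; rewrite -addr_eq0; apply/eqP; elim: s r => [|s IH] r.
  by case: r => [|r]; rewrite ?M00 ?addr0 // M_0s M_r0 addNr.
have e1 := M_rec r s; have e2 := M_rec s r; have e3 := IH r.+1.
have -> : M s.+1 r = q t s * q t r.+1 - q t s.+1 * q t r - M s r.+1 by rewrite -e2 addrK.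
have -> : M r s.+1 = q t r * q t s.+1 - q t r.+1 * q t s - M r.+1 s by rewrite -e1 addrAC subrr add0r.
by rewrite -[RHS]oppr0 -e3; ring.
Qed.
End Alternating.
End QPolynomials.

(** * Values at the two special points and the Airy coefficients *)

Section SpecialTimes.
Variable F : fieldType.
Hypothesis F0 : forall n, n.+1%:R != 0 :> F.

Let Fn n : (0 < n)%N -> n%:R != 0 :> F. Proof. by case: n => // n _; apply: F0. Qed.
Let Ff n : n`!%:R != 0 :> F. Proof. exact: Fn (fact_gt0 n). Qed.
Let F2 : (2 : F) != 0. Proof. exact: Fn. Qed.
Let F3 : (3 : F) != 0. Proof. exact: Fn. Qed.

Definition time1 (k : oddn) : F^o := (val k == 1%N)%:R.
Definition time3 (k : oddn) : F^o := (val k == 3%N)%:R / 3.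

Lemma dlogq_time1 i : dlogq time1 i = if i == 0%N then 2 else 0 :> F^o.
Proof.
rewrite /dlogq; case: (boolP (odd i)) => oi; first by case: eqP oi => // ->.
rewrite /time1 /= even_halfK // eqSS; case: eqP => [->|_]; last by rewrite mulr0.
by rewrite !mulr1.
Qed.

Lemma q_time1 k : q time1 k = 2 ^+ k / k`!%:R.
Proof.
apply/esym; apply: (q_unique F0 (r := fun k => 2 ^+ k / k`!%:R : F^o)) => {k} [|k].
  by rewrite expr0 fact0 divr1.
rewrite big_ord_recl big1 ?addr0 => [|i _]; last by rewrite dlogq_time1 mul0r.
rewrite dlogq_time1 /= subn0 factS natrM exprS -[_ * _ :> F^o]/(_ * _ : F); field.

by rewrite Ff nat1r F0.
Qed.

(** At r = s = 0 the quotient 0 / 0 is 0, in agreement with the convention M_(0,0) = 0. *)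
Lemma M_time1 r s : M time1 r s =
  2 ^+ r / r`!%:R * (2 ^+ s / s`!%:R) * ((r%:R - s%:R) / (r%:R + s%:R)).
Proof.
elim: s r => [|s IH] [|r].
- by rewrite M00 subrr mul0r mulr0.
- by rewrite M_r0 q_time1 expr0 fact0 subr0 addr0 !divff ?oner_eq0 ?F0 // !mulr1.
- by rewrite (M_0s F0) q_time1 expr0 fact0 sub0r add0r mulNr !divff ?oner_eq0 ?F0 // !mul1r mulrN1.
have rs : (r%:R + 1 + (s%:R + 1) : F) != 0 by rewrite !natr1 -natrD addSn.
have := M_rec time1 r.+1 s; rewrite addrC => /(canRL (addrK _)) ->.
rewrite IH !q_time1 !factS !natrM !exprS.
have f1 := F0 r; have f2 := F0 r.+1; have f3 := F0 s; rewrite -!natr1 in f1 f2 f3 *.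
by field; rewrite rs f1 f2 f3 !Ff.
Qed.

(** The coefficients of exp(2 z^3 / 3) as a series in z^3, which is the generating series of q at
    t_3 = 1/3. *)
Definition u3 n : F := (2 / 3) ^+ n / n`!%:R.

Lemma u3S n : n.+1%:R * u3 n.+1 = 2 / 3 * u3 n.
Proof. by rewrite /u3 factS natrM exprS; field; rewrite F3 Ff nat1r F0. Qed.

Lemma div3 a i : (i < 3)%N -> (((a * 3 + i) %/ 3 = a)%N * ((a * 3 + i) %% 3 = i)%N)%type.
Proof. by move=> i3; rewrite divnMDl // divn_small // addn0 modnMDl modn_small. Qed.

Definition q3 k : F := if (k %% 3 == 0)%N then u3 (k %/ 3) else 0.

Lemma q_time3 k : q time3 k = q3 k.
Proof.
apply/esym; apply: (q_unique F0 (r := q3 : nat -> F^o)) => {k} [|k].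
  by rewrite /q3 /= /u3 expr0 fact0 divr1.
have dE i : dlogq time3 i = if i == 2%N then 2 else 0 :> F^o.
  rewrite /dlogq; case: (boolP (odd i)) => oi; first by case: eqP oi => // ->.
  rewrite /time3 /= -[X in X == 3%N](_ : i.+1 = _); last by rewrite even_halfK.
  rewrite !eqSS; case: eqP => [->|_] /=; last by rewrite mul0r mulr0.
  by rewrite mul1r -mulrA mulfV ?F3 // mulr1.
have -> : \sum_(i < k.+1) dlogq time3 i * q3 (k - i) = if (2 <= k)%N then 2 * q3 (k - 2) else 0.
  case: ifP => k2.
    rewrite (bigD1 (Ordinal (k2 : (2 < k.+1)%N))) //= big1 ?addr0 ?dE //= => i.
    by rewrite -val_eqE dE /= => /negPf ->; rewrite mul0r.
  rewrite big1 // => i _; rewrite dE ifF ?mul0r //; have := ltn_ord i; lia.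
have [a [i [i3 ->]]] : exists a, exists i, (i < 3)%N /\ k = (a * 3 + i)%N.
  by exists (k %/ 3)%N, (k %% 3)%N; rewrite ltn_mod -divn_eq.
case: i i3 => [|[|[|//]]] _.
- rewrite -addnS /q3 div3 //= mulr0; case: ifP => // h.
  by have -> : (a * 3 + 0 - 2 = a.-1 * 3 + 1)%N by [lia]; rewrite div3 //= mulr0.
- rewrite -addnS /q3 div3 //= mulr0; case: ifP => // h.
  by have -> : (a * 3 + 1 - 2 = a.-1 * 3 + 2)%N by [lia]; rewrite div3 //= mulr0.
rewrite ifT; last by lia.
have -> : ((a * 3 + 2).+1 = a.+1 * 3 + 0)%N by lia.
have -> : (a * 3 + 2 - 2 = a * 3 + 0)%N by lia.
rewrite /q3 !div3 //= addn0 natrM mulrAC u3S; field; exact: F3.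
Qed.

(** By homogeneity only pairs with r + s divisible by 3 survive, which leaves three pairs of
    residues. *)
Definition M3 r s : F :=
  match (r %% 3)%N, (s %% 3)%N with
  | 0%N, 0%N => u3 (r %/ 3) * u3 (s %/ 3) * (((r %/ 3)%:R - (s %/ 3)%:R) / ((r %/ 3)%:R + (s %/ 3)%:R))
  | 1%N, 2%N => 4 / 3 * u3 (r %/ 3) * u3 (s %/ 3) / (r %/ 3 + s %/ 3).+1%:R
  | 2%N, 1%N => - (4 / 3 * u3 (r %/ 3) * u3 (s %/ 3) / (r %/ 3 + s %/ 3).+1%:R)
  | _, _ => 0
  end.

Lemma mod3_cases k : exists a i, (i < 3)%N /\ k = (a * 3 + i)%N.
Proof. by exists (k %/ 3)%N, (k %% 3)%N; rewrite ltn_mod -divn_eq. Qed.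

Lemma M_time3 r s : M time3 r s = M3 r s.
Proof.
have eS a : (((a * 3 + 0).+1 = a * 3 + 1)%N * ((a * 3 + 1).+1 = a * 3 + 2)%N * ((a * 3 + 2).+1 = a.+1 * 3 + 0)%N)%type.
  by split; [split|]; lia.
elim: s r => [|s IH] r.
  case: r => [|r]; first by rewrite M00 /M3 /= subrr mul0r mulr0.
  rewrite M_r0 q_time3 /q3 /M3 /=.
  have [a [i [i3 ->]]] := mod3_cases r.
  case: i i3 => [|[|[|//]]] _; rewrite eS !div3 //= /u3.
  by rewrite expr0 fact0 subr0 addr0 divr1 mulr1 divff ?F0 // mulr1.
have := M_rec time3 r s; rewrite addrC => /(canRL (addrK _)) ->.
rewrite IH !q_time3 {IH}.
have [a [i [i3 ->]]] := mod3_cases r; have [b [j [j3 ->]]] := mod3_cases s.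
have u3E c : u3 c.+1 = 2 / 3 * u3 c / (c%:R + 1).
  by rewrite natr1 -u3S mulrAC divff ?F0 // mul1r.
have f1 := F0 a; have f2 := F0 b; have f3 := F0 (a + b).
rewrite /q3 /M3; case: i i3 => [|[|[|//]]] _; case: j j3 => [|[|[|//]]] _;
  rewrite ?eS !div3 //= ?mulr0 ?mul0r ?subr0 ?sub0r ?oppr0 ?opprK //.
  rewrite u3E -!natr1 natrD in f2 f3 *; field.
  by rewrite F3 f2 [X in X != 0](_ : _ = a%:R + b%:R + 1) ?f3 //; ring.
rewrite u3E -!natr1 natrD in f1 f3 *; field.
by rewrite F3 f1 [X in X != 0](_ : _ = a%:R + b%:R + 1) ?f3 //; ring.
Qed.

(** The double factorial (2x - 1)!!. *)
Definition df x : F := \prod_(i < x) (i.*2.+1)%:R.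

Lemma dfS x : df x.+1 = (2 * x%:R + 1) * df x.
Proof. by rewrite /df big_ord_recr /= mulrC -natr1 -muln2 natrM; ring. Qed.

Lemma df_ratio x : (2 ^+ x / x`!%:R) = df x * (2 ^+ x.*2 / (x.*2)`!%:R).
Proof.
elim: x => [|x IH]; first by rewrite /df big_ord0 mul1r.
rewrite dfS doubleS !factS !natrM !exprS.
have e : 2 ^+ x / x`!%:R * (x.*2)`!%:R = df x * 2 ^+ x.*2 by rewrite IH mulrA divfK.
have -> : x.*2.+2%:R = 2 * (x%:R + 1) :> F by rewrite natr1 -natrM; congr _%:R; lia.
have -> : x.*2.+1%:R = 2 * x%:R + 1 :> F by rewrite -natr1 -muln2 natrM mulrC.
have f1 := F0 x; have f2 : 2 * x%:R + 1 != 0 :> F by rewrite -natrM natr1 F0.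
rewrite -natr1 in f1 *.
have -> : (2 * x%:R + 1) * df x * (2 * (2 * 2 ^+ x.*2) / (2 * (x%:R + 1) * ((2 * x%:R + 1) * (x.*2)`!%:R)))
  = 2 * (df x * 2 ^+ x.*2) / ((x%:R + 1) * (x.*2)`!%:R).
  by field; rewrite F2 f1 f2 Ff.
by rewrite -e; field; rewrite f1 !Ff.
Qed.

(** At r = 3k, [alpha] and [beta] are 48^k u_k and 48^k v_k, where u_k and v_k are the classical
    coefficients in the asymptotic expansions of the Airy functions and of their derivatives. *)
Definition alpha r : F := if (r %% 3 == 0)%N then df r * u3 (r %/ 3).*2 else 0.
Definition beta r : F := (1 + 2 * r%:R) / (1 - 2 * r%:R) * alpha r.
(** The array whose Pfaffians are the quotients of Q-values in the coefficients of tau; the double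
    factorials come from [df_ratio], as [Q_quotient] shows. *)
Definition coefc r s : F := df r * df s * M time3 r.*2 s.*2.

Let odd_neq0 r : 1 - 2 * r%:R != 0 :> F.
Proof.
case: r => [|r]; first by rewrite mulr0 subr0 oner_eq0.
by rewrite (_ : _ - _ = - r.*2.+1%:R) ?oppr_eq0 ?F0 // -!natr1 -muln2 natrM; ring.
Qed.

Lemma alpha0 : alpha 0 = 1.
Proof. by rewrite /alpha /= /df big_ord0 /u3 fact0 expr0 divr1 mulr1. Qed.

Lemma beta0 : beta 0 = 1.
Proof. by rewrite /beta alpha0 mulr0 addr0 subr0 divr1 mulr1. Qed.

Lemma beta_alpha r : (2 * r%:R - 1) * beta r = - ((2 * r%:R + 1) * alpha r).
Proof. by rewrite /beta; field; rewrite odd_neq0. Qed.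

Lemma alpha_lt3 r : (0 < r < 3)%N -> alpha r = 0.
Proof. by case: r => [|[|[|]]]. Qed.

Lemma beta_lt3 r : (0 < r < 3)%N -> beta r = 0.
Proof. by move=> r3; rewrite /beta alpha_lt3 // mulr0. Qed.

Let u3E c : u3 c.+1 = 2 / 3 * u3 c / (c%:R + 1).
Proof. by rewrite natr1 -u3S mulrAC divff ?F0 // mul1r. Qed.

Let natr3 a i : (a * 3 + i)%:R = 3 * a%:R + i%:R :> F.
Proof. by rewrite natrD natrM mulrC. Qed.

Let dbl_neq0 a : 2 * a%:R + 1 != 0 :> F.
Proof. by rewrite -natrM natr1 F0. Qed.

Let natr_dbl a : a.*2%:R = 2 * a%:R :> F.
Proof. by rewrite -muln2 natrM mulrC. Qed.

(** With [beta_alpha], this is the first-order Airy system in coefficients; [nabla_a] and [nabla_b]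
    below restate it for the series. *)
Lemma alpha_beta_rec r : beta r.+3 - alpha r.+3 = - (8 * (2 * r%:R + 1) * alpha r).
Proof.
have [a [i [i3 ->]]] := mod3_cases r.
have -> : ((a * 3 + i).+3 = a.+1 * 3 + i)%N by lia.
rewrite /beta /alpha !div3 //; case: i {i3} => [|i] /=; last by rewrite !mulr0 oppr0 addr0.
have -> : (a.+1 * 3 + 0 = (a * 3 + 0).+3)%N by lia.
have h := odd_neq0 (a * 3 + 0).+3.
have e1 : (a * 3 + 0).+1%:R = 3 * a%:R + 1 :> F by rewrite -natr1 natr3 addr0.
have e2 : (a * 3 + 0).+2%:R = 3 * a%:R + 2 :> F by rewrite -addn2 natrD natr3 addr0.
have e3 : (a * 3 + 0).+3%:R = 3 * a%:R + 3 :> F by rewrite -addn3 natrD natr3 addr0.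
have f1 := F0 a; have f2 := dbl_neq0 a; rewrite -natr1 in f1.
have e := @natr1 F a.*2; rewrite natr_dbl in e.
move: h; rewrite !dfS doubleS !u3E -e natr_dbl e1 e2 e3 natr3 addr0.
move=> h; field; rewrite F3 f2 h /= andbT.
by rewrite [X in X != 0](_ : _ = 2 * (a%:R + 1)) ?mulf_neq0 //; ring.
Qed.

(** The correction at r = 0 reflects that M_(0,0) is 0 by convention while alpha 0 is 1. In
    [trunc_kernel] it is matched by the summand [ratio]. *)
Lemma coefc_r0 r : coefc r 0 + (r == 0%N)%:R = alpha r.
Proof.
rewrite /coefc M_time3; have [a [i [i3 ->]]] := mod3_cases r.
have dbl3 : (((a * 3 + 0).*2 = a.*2 * 3 + 0)%N * ((a * 3 + 1).*2 = a.*2 * 3 + 2)%N * ((a * 3 + 2).*2 = a.*2.+1 * 3 + 1)%N)%type.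
  by split; [split|]; lia.
rewrite /M3 /alpha !div3 //; case: i i3 => [|[|[|//]]] _; rewrite !dbl3 !div3 //=.
- case: a {dbl3} => [|a].
    by rewrite subrr mul0r !mulr0 /df big_ord0 /u3 fact0 expr0 divr1 add0r mulr1.
  rewrite addn0 addr0 subr0 addr0 divff ?F0 // mulr1 {2}/df big_ord0 mulr1.
  by rewrite {2}/u3 fact0 expr0 divr1 mulr1.
- by rewrite addn1 mulr0 add0r.
- by rewrite addn2 mulr0 add0r.
Qed.

Lemma coefc_anti r s : coefc r s = - coefc s r.
Proof. by rewrite /coefc (M_anti F0) mulrN [df s * df r]mulrC. Qed.

(** This makes the generating series of [coefc] telescope: multiplied by 1/x_i + 1/x_j it becomes
    a_i b_j - b_i a_j, up to boundary terms. *)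
Lemma coefc_rec r s :
  coefc r s.+1 + coefc r.+1 s = alpha r * beta s.+1 - beta r.+1 * alpha s.
Proof.
rewrite /coefc !M_time3.
have [a [i [i3 ->]]] := mod3_cases r; have [b [j [j3 ->]]] := mod3_cases s.
have sumE : (a.*2 + b.*2.+1).+1%:R = 2 * (a%:R + b%:R + 1) :> F.
  by rewrite -natrD natr1 -natr_dbl; congr _%:R; lia.
have sumE' : (a.*2.+1 + b.*2).+1%:R = 2 * (a%:R + b%:R + 1) :> F.
  by rewrite -natrD natr1 -natr_dbl; congr _%:R; lia.
have dbl3 d : (((d * 3 + 0).*2 = d.*2 * 3 + 0)%N * ((d * 3 + 1).*2 = d.*2 * 3 + 2)%N * ((d * 3 + 2).*2 = d.*2.+1 * 3 + 1)%N)%type.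
  by split; [split|]; lia.
have eS d : (((d * 3 + 0).+1 = d * 3 + 1)%N * ((d * 3 + 1).+1 = d * 3 + 2)%N * ((d * 3 + 2).+1 = d.+1 * 3 + 0)%N)%type.
  by split; [split|]; lia.
have f1 := F0 a; have f2 := F0 b; have f3 := F0 (a + b); rewrite -natr1 in f1; rewrite -natr1 in f2; rewrite -natr1 natrD in f3.
have ed d : d.*2.+1%:R = 2 * d%:R + 1 :> F by rewrite -natr1 natr_dbl.
have e1 d : (d * 3 + 1)%:R = 3 * d%:R + 1 :> F by rewrite natr3.
have e2 d : (d * 3 + 2)%:R = 3 * d%:R + 2 :> F by rewrite natr3.
have e3 d : (d * 3 + 0)%:R = 3 * d%:R :> F by rewrite natr3 addr0.
have ea : a.+1%:R = a%:R + 1 :> F by rewrite natr1.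
have eb : b.+1%:R = b%:R + 1 :> F by rewrite natr1.
have g1 := dbl_neq0 a; have g2 := dbl_neq0 b.
have h1 := odd_neq0 (a.+1 * 3 + 0); have h2 := odd_neq0 (b.+1 * 3 + 0).
rewrite /beta /M3 /alpha; case: i i3 => [|[|[|//]]] _; case: j j3 => [|[|[|//]]] _;
  rewrite ?dfS ?eS ?dbl3 !div3 //= ?(mulr0, mul0r, subr0, sub0r, oppr0, opprK, addr0) //.
all: rewrite !e3 ea eb in h1 h2; rewrite ?sumE ?sumE' !(e1, e2, e3) ?(natr_dbl, ea, eb) ?doubleS !u3E ?(natr_dbl, ed).
all: field; rewrite ?F2 ?F3 ?g1 ?g2 ?h1 ?h2 ?f3 ?andbT //=; apply/andP; split.
- by rewrite [X in X != 0](_ : _ = 2 * (b%:R + 1)) ?mulf_neq0 //; ring.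
- by rewrite [X in X != 0](_ : _ = 2 * (a%:R + b%:R + 1)) ?mulf_neq0 //; ring.
- by rewrite [X in X != 0](_ : _ = 2 * (a%:R + 1)) ?mulf_neq0 //; ring.
- by rewrite [X in X != 0](_ : _ = 2 * (a%:R + b%:R + 1)) ?mulf_neq0 //; ring.
Qed.

End SpecialTimes.

(** * Naturality of Q-polynomials under ring morphisms *)

Section Naturality.
Variables (F1 F2 : fieldType) (A : comAlgType F1) (B : comAlgType F2) (phi : {rmorphism A -> B}).
Hypothesis F20 : forall n, n.+1%:R != 0 :> F2.
Hypothesis F10 : forall n, n.+1%:R != 0 :> F1.

(** The two base fields differ, so [phi] is not assumed linear; the only scalars in the definitions
    of q and of the Pfaffian are inverses of integers, which any ring morphism respects. *)
Lemma rmorph_invn n (x : A) : (0 < n)%N -> phi ((n%:R^-1 : F1) *: x) = (n%:R^-1 : F2) *: phi x.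
Proof.
case: n => // n _; rewrite -[x in RHS](scalerKV (F10 n)) scaler_nat rmorphMn -scaler_nat.
by rewrite scalerA mulVf ?scale1r.
Qed.

Lemma rmorph_pfaffian m (G : 'M[A]_m.*2) :
  phi (pfaffian G) = pfaffian (\matrix_(i, j) phi (G i j)).
Proof.
rewrite /pfaffian rmorph_invn ?muln_gt0 ?expn_gt0 ?fact_gt0 // rmorph_sum; congr (_ *: _).
apply: eq_bigr => s _; rewrite rmorphM rmorph_sign rmorph_prod; congr (_ * _).
by apply: eq_bigr => i _; rewrite mxE.
Qed.

Variable t : oddn -> A.

Lemma rmorph_q k : phi (q t k) = q (phi \o t) k.
Proof.
rewrite /q rmorph_sum; apply: eq_bigr => n _; rewrite rmorph_invn ?fact_gt0 //; congr (_ *: _).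
rewrite -coef_map rmorphXn; congr ((_ : {poly B}) ^+ _)`_ _.
rewrite /expo_trunc rmorphM rmorph_nat rmorph_sum; congr (_ * _); apply: eq_bigr => i _.
by rewrite rmorphM /= map_polyC map_polyXn.
Qed.

Lemma rmorph_M r s : phi (M t r s) = M (phi \o t) r s.
Proof.
rewrite /M; case: ifP => _; first exact: rmorph0.
rewrite rmorphD !rmorphM rmorph_nat !rmorph_q rmorph_sum; congr (_ + _ * _).
by apply: eq_bigr => i _; rewrite rmorphM rmorph_sign rmorphM !rmorph_q.
Qed.

Lemma rmorph_Q l : phi (Q t l) = Q (phi \o t) l.
Proof.
rewrite /Q /Q_even; case: ifP => _; rewrite rmorph_pfaffian; congr pfaffian;
by apply/matrixP => i j; rewrite !mxE rmorph_M.
Qed.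
End Naturality.

Section Reordering.
Variables (F : fieldType) (A : comAlgType F).
Hypothesis F0 : forall n, n.+1%:R != 0 :> F.

(** The sign is chosen before the kernel [B]: it depends on the two lists alone, so the product of
    two Pfaffians over the same list is insensitive to its order. *)
Lemma pfseq_perm (T : eqType) (x0 : T) (l1 l2 : seq T) : ~~ odd (size l1) -> perm_eq l1 l2 ->
  exists e : bool, forall B : T -> T -> A, pfseq x0 B l1 = (-1) ^+ e * pfseq x0 B l2.
Proof.
move=> el1 p12; have sz := perm_size p12.
have sl1 : size l1 = (size l1)./2.*2 by rewrite even_halfK.
move: sl1; set m := _./2 => sl1.
have sl2 : size l2 == m.*2 by rewrite -sz sl1.
have /tuple_permP[s e1] : perm_eq l1 (Tuple sl2) by [].
exists (odd_perm s) => B; rewrite (pfseqE _ _ sl1) (pfseqE _ _ (eqP sl2)) -pff_perm.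
apply: eq_pff => // i /=; rewrite e1 -tnth_nth tnth_mktuple (tnth_nth x0).
by [].
Qed.

Lemma pfseq_map (T U : Type) (x0 : T) (y0 : U) (f : T -> U) (B : U -> U -> A) l : ~~ odd (size l) ->
  pfseq y0 B (map f l) = pfseq x0 (fun x y => B (f x) (f y)) l.
Proof.
move=> el; have sl : size l = (size l)./2.*2 by rewrite even_halfK.
have sl' : size (map f l) = (size l)./2.*2 by rewrite size_map.
rewrite (pfseqE _ _ sl) (pfseqE _ _ sl') /pff; congr pfaffian; apply/matrixP => i j; rewrite !mxE.
have szl (k : 'I_(size l)./2.*2) : (k < size l)%N by apply: leq_trans (ltn_ord k) _; rewrite -sl.
by rewrite !(nth_map x0).
Qed.

Section Schur.
Variables (T : finType) (x0 : T) (s : T -> T -> F).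
Hypotheses (santi : forall x y, s y x = - s x y).
Hypothesis s_neq0 : forall x y, x != y -> s x y != 0.
Hypothesis s_row : forall i (Y : {set T}), i \notin Y -> odd #|Y| ->
  \sum_(j in Y) \prod_(k in Y :\ j) (s i k * s j k)^-1 = 1.

(** The case f = 0 of [npfset_add], in which only the empty subset contributes. *)
Lemma pfseq_schur (X : {set T}) : ~~ odd #|X| ->
  pfseq x0 (fun i j => (s i j)%:A : A) (enum X) = (vdm s (enum X))%:A.
Proof.
move=> eX; have vX : vdm s (enum X) != 0.
  by apply: vdm_neq0 => [|i j _ _]; [apply: enum_uniq | apply: s_neq0].
have z_anti (i j : T) : (0 : A) = - 0 by rewrite oppr0.
have := npfset_add (A := A) x0 F0 santi (f := fun _ _ => 0) z_anti s_neq0 s_row eX.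
rewrite (bigD1 set0) /= ?sub0set ?cards0 // npfset0 big1 ?addr0; last first.
  move=> I /andP[/andP[_ eI] I0].
  have [i hi] : exists i, ohead (enum I) = Some i.
    have : size (enum I) != 0%N by rewrite -cardE cards_eq0.
    by case: (enum I) => // i ? _; exists i.
  rewrite (npfset_rec F0 _ santi z_anti hi eI) big1 ?scaler0 // => y _.
  by rewrite mul0r scaler0.
rewrite /cross_inv big_set0 scale1r /npfset /npf => /(canRL (scalerKV vX)) <-.
apply: eq_pff => // i j; by rewrite addr0.
Qed.
End Schur.
End Reordering.

Section Ratios.
Variables (F : fieldType) (T : finType) (x : T -> F).
Hypothesis F0 : forall n, n.+1%:R != 0 :> F.
Hypothesis dx : forall i j, i != j -> (x i - x j != 0) && (x i + x j != 0).

Definition ratio i j := (x i - x j) / (x i + x j).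

Lemma ratio_anti i j : ratio j i = - ratio i j.
Proof. by rewrite /ratio -mulNr opprB [x i + _]addrC. Qed.

Lemma ratio_neq0 i j : i != j -> ratio i j != 0.
Proof. by move=> /dx/andP[h1 h2]; rewrite mulf_neq0 ?invr_eq0. Qed.

Lemma ratio_row i (Y : {set T}) : i \notin Y -> odd #|Y| ->
  \sum_(j in Y) \prod_(k in Y :\ j) (ratio i k * ratio j k)^-1 = 1.
Proof.
move=> iY oY; rewrite -[RHS](schur_row (x := x) (y := x i) F0 _ oY); first 1 last.
- by move=> p q _ _; apply: dx.
- by move=> k kY; rewrite andbC dx //; apply: contraNneq iY => ->.
by apply: eq_bigr => j _; apply: eq_bigr => k _; rewrite /ratio invfM !invf_div mulrACA -invfM.
Qed.
End Ratios.

(** * The coefficients of tau as Pfaffians *)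

Section TauCoefficients.
Variable F : fieldType.
Hypothesis F0 : forall n, n.+1%:R != 0 :> F.

Lemma natr_distinct i j : i != j -> (i%:R - j%:R != 0 :> F) && (i%:R + j%:R != 0 :> F).
Proof.
have natr0 n : (n%:R == 0 :> F) = (n == 0%N) by case: n => [|n]; rewrite ?eqxx ?(negPf (F0 n)).
wlog ij : i j / (i < j)%N => [hw|_].
  case: ltngtP => // h _; first by rewrite hw // ltn_eqF.
  by rewrite -oppr_eq0 opprB [i%:R + _]addrC hw // ltn_eqF.
rewrite -oppr_eq0 opprB -natrB ?(ltnW ij) // -natrD !natr0 subn_eq0 addn_eq0 -ltnNge ij.
by rewrite negb_and -!lt0n (leq_trans _ ij) ?orbT.
Qed.

Definition natratio (r s : nat) : F^o := (r%:R - s%:R) / (r%:R + s%:R).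

(** Schur's Pfaffian with the parts themselves as nodes is a product of nonzero ratios. This is what
    allows division by the Pfaffian in [Q_quotient]. *)
Lemma pfseq_natratio_neq0 l : uniq l -> ~~ odd (size l) -> pfseq 0%N natratio l != 0.
Proof.
move=> ul el; pose N := sumn l; have lN k : k \in l -> (k < N.+1)%N.
  by move=> kl; rewrite ltnS /N (perm_sumn (perm_to_rem kl)) leq_addr.
pose l' : seq 'I_N.+1 := map inord l.
have ll' : l = map val l' by rewrite -map_comp map_id_in // => k kl /=; rewrite inordK // lN.
have el' : ~~ odd (size l') by rewrite size_map.
rewrite ll' (pfseq_map ord0) //.
pose X := [set i in l']; have pX : perm_eq l' (enum X).
  apply: uniq_perm; rewrite ?enum_uniq //; last by move=> i; rewrite mem_enum inE.
  by rewrite -(map_inj_uniq val_inj) -ll'.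
have [e ->] := pfseq_perm F^o ord0 el' pX.
pose x (i : 'I_N.+1) : F := (val i)%:R.
have dx i j : i != j -> (x i - x j != 0) && (x i + x j != 0) by move=> ij; apply: natr_distinct.
rewrite mulf_neq0 ?signr_eq0 //.
have := pfseq_schur F^o F0 ord0 (ratio_anti x) (ratio_neq0 dx) (ratio_row F0 dx) (X := X).
rewrite cardE -(perm_size pX) => /(_ el') e1.
have -> : pfseq ord0 (fun i j : 'I_N.+1 => natratio i j) (enum X)
    = pfseq ord0 (fun i j => (ratio x i j)%:A : F^o) (enum X).
  by apply: eq_pff => // i j; rewrite [RHS]mulr1.
by rewrite e1 [_%:A]mulr1; apply: vdm_neq0 => [|i j _ _]; [apply: enum_uniq | apply: ratio_neq0].
Qed.

Definition complete_seq (l : seq nat) := if odd (size l) then rcons l 0%N else l.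

Lemma QE (A : comAlgType F) (t : oddn -> A) l : Q t l = pfseq 0%N (M t) (complete_seq l).
Proof. by rewrite /Q /complete_seq; case: ifP. Qed.

Lemma even_complete l : ~~ odd (size (complete_seq l)).
Proof. by rewrite /complete_seq; case: ifP => [ol|->//]; rewrite size_rcons /= ol. Qed.

Lemma complete_double l : complete_seq (map double l) = map double (complete_seq l).
Proof. by rewrite /complete_seq size_map; case: ifP => // _; rewrite map_rcons. Qed.

Lemma uniq_complete l : uniq l -> 0%N \notin l -> uniq (complete_seq l).
Proof. by rewrite /complete_seq; case: ifP => // _ ul l0; rewrite rcons_uniq l0. Qed.

(** At delta_(k,1) the entries are p_r p_s (r-s)/(r+s) with p_r = 2^r/r!. The ratio is the same for
    2r and 2s, so the Pfaffians of the ratios cancel; the quotients p_r / p_(2r) = (2r-1)!! are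
    absorbed into [coefc]. *)
Lemma Q_quotient l : uniq l -> 0%N \notin l ->
  Q (A := F^o) (time1 F) l * Q (A := F^o) (time3 F) (map double l) / Q (A := F^o) (time1 F) (map double l)
  = pfseq 0%N (coefc F : nat -> nat -> F^o) (complete_seq l).
Proof.
move=> ul l0; rewrite !QE complete_double.
have := even_complete l; have := uniq_complete ul l0; move: (complete_seq l) => l' ul' el.
have ed (B : nat -> nat -> F^o) : pfseq 0%N B (map double l') = pfseq 0%N (fun x y => B x.*2 y.*2) l'.
  exact: pfseq_map.
pose p r : F^o := 2 ^+ r / r`!%:R.
have p0 r : p r != 0.
  by rewrite mulf_neq0 ?expf_neq0 ?(F0 1) ?invr_eq0 //; case: (r`!) (fact_gt0 r) => // n _; apply: F0.
have r2 r s : natratio r.*2 s.*2 = natratio r s.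
  rewrite /natratio -!muln2 !natrM -mulrBl -mulrDl -mulf_div divff ?mulr1 //; exact: F0 1%N.
have e1 : pfseq 0%N (M (A := F^o) (time1 F)) l' = (\prod_(x <- l') p x) * pfseq 0%N natratio l'.
  by rewrite -pfseq_scale //; apply: eq_pff => // r s; rewrite M_time1.
have e2 : pfseq 0%N (fun x y => M (A := F^o) (time1 F) x.*2 y.*2) l' = (\prod_(x <- l') p x.*2) * pfseq 0%N natratio l'.
  rewrite -pfseq_scale //; apply: eq_pff => // r s; rewrite M_time1 //.
  by rewrite -[X in _ * X = _]/(natratio r.*2 s.*2) r2.
have e3 : pfseq 0%N (coefc F : nat -> nat -> F^o) l' = (\prod_(x <- l') df F x)
   * pfseq 0%N (fun x y => M (A := F^o) (time3 F) x.*2 y.*2) l'.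
  by rewrite -(pfseq_scale (A := F^o) 0%N (df F : nat -> F^o)).
have nz := pfseq_natratio_neq0 ul' el.
have P0 : \prod_(x <- l') p x.*2 != 0 by rewrite prodf_seq_neq0; apply/allP => k _ /=.
transitivity ((\prod_(x <- l') p x) * pfseq 0%N natratio l' * pfseq 0%N (fun x y => M (A := F^o) (time3 F) x.*2 y.*2) l'
   / ((\prod_(x <- l') p x.*2) * pfseq 0%N natratio l') : F).
  by congr (_ * _ / _); [exact: e1 | exact: ed | apply: etrans (ed _) e2].
apply: etrans (esym e3).
have -> : \prod_(x <- l') p x = (\prod_(x <- l') df F x) * \prod_(x <- l') p x.*2 :> F.
  by rewrite -big_split; apply: eq_bigr => x _; apply: (df_ratio F0).
move: nz; move: (pfseq _ natratio l') => a a0; move: (pfseq _ _ _) => b; field.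
apply/andP; split; [exact: a0 | exact: P0].
Qed.
End TauCoefficients.

(** * Q-polynomials at power sums *)

Section Miwa.
Variables (F : fieldType) (T : finType) (x : T -> F).
Hypothesis F0 : forall n, n.+1%:R != 0 :> F.
Hypothesis dx : forall i j, i != j -> (x i - x j != 0) && (x i + x j != 0).
Hypothesis x_neq0 : forall i, x i != 0.
Implicit Types (K : {set T}).

Definition miwa K (k : oddn) : F^o := \sum_(i in K) x i ^+ val k / (val k)%:R.

Lemma dlogq_miwa K i :
  dlogq (miwa K) i = if odd i then 0 else 2 * \sum_(j in K) x j ^+ i.+1.
Proof.
rewrite /dlogq; case: (boolP (odd i)) => // oi.
rewrite /miwa /= even_halfK // -mulrA mulr_sumr; congr (_ * _); apply: eq_bigr => j _.
by rewrite mulrCA divff ?F0 ?mulr1.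
Qed.

Lemma q_miwa1 i k : q (miwa [set i]) k = if k == 0%N then 1 else 2 * x i ^+ k.
Proof.
pose r k : F^o := if k == 0%N then 1 else 2 * x i ^+ k.
have d1 j : dlogq (miwa [set i]) j = if odd j then 0 else 2 * x i ^+ j.+1.
  by rewrite dlogq_miwa big_set1.
have d2 j : dlogq (miwa [set i]) j.+2 = x i ^+ 2 * dlogq (miwa [set i]) j.
  rewrite !d1 /= negbK; case: ifP => _; first by rewrite mulr0.
  by rewrite !exprS; ring.
apply/esym; apply: (q_unique F0 (r := r)) => // {k} k.
(* The coefficients [dlogq] vanish at odd indices and are geometric of ratio x_i^2 at even ones, so
   the recursion is checked two steps at a time. *)
have : (k.+1%:R * r k.+1 = \sum_(i0 < k.+1) dlogq (miwa [set i]) i0 * r (k - i0)%N) /\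
  (k.+2%:R * r k.+2 = \sum_(i0 < k.+2) dlogq (miwa [set i]) i0 * r (k.+1 - i0)%N); last by case.
elim: k => [|k [IH1 IH2]].
  rewrite !big_ord_recl !big_ord0 !d1 /r /= !addr0 mul0r addr0; split.
    by rewrite mul1r mulr1.
  by rewrite expr1 expr2; ring.
split=> //; rewrite big_ord_recl big_ord_recl /=.
rewrite (eq_bigr (fun i0 : 'I_k.+1 => x i ^+ 2 * (dlogq (miwa [set i]) i0 * r (k - i0)%N))) => [|j _]; last first.
  by rewrite /bump !add1n d2 !subSS mulrA.
rewrite -mulr_sumr -IH1 !d1 /r /= /bump /= !subSS !subn0 mul0r add0r.
have -> : k.+3%:R = k.+1%:R + 2 :> F by rewrite -addn2 natrD.
by rewrite !exprS expr0; ring.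
Qed.

(** The coefficient form of (1 - x_i z) Q_(K + i)(z) = (1 + x_i z) Q_K(z). *)
Lemma q_miwaU i K k : i \notin K ->
  q (miwa (i |: K)) k.+1 - x i * q (miwa (i |: K)) k = q (miwa K) k.+1 + x i * q (miwa K) k.
Proof.
move=> iK; have dD j : dlogq (miwa (i |: K)) j = dlogq (miwa [set i]) j + dlogq (miwa K) j.
  by rewrite !dlogq_miwa; case: ifP => _; rewrite ?addr0 // big_setU1 //= big_set1 mulrDr.
rewrite !(q_conv F0 dD) big_ord_recl q_miwa1 subn0 mul1r -addrA; congr (_ + _).
rewrite mulr_sumr -sumrB big_ord_recl big1 ?addr0 => [|j _].
  by rewrite /bump /= !q_miwa1 /= expr1 subSS; change (2 * x i * q (miwa K) (k - 0) - x i * (1 * q (miwa K) (k - 0)) = x i * q (miwa K) k :> F); rewrite subn0; ring.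
rewrite !lift0 !q_miwa1 /= subSS exprS.
by apply/eqP; rewrite subr_eq0; apply/eqP; change (2 * (x i * x i ^+ j.+1) * q (miwa K) (k - j.+1)%N = x i * (2 * x i ^+ j.+1 * q (miwa K) (k - j.+1)%N) :> F); ring.
Qed.

(** The partial fraction expansion of the product of (1 + x_j z)/(1 - x_j z) over K; the constant
    (-1)^|K| is the value at infinity. *)
Lemma q_miwa K k : q (miwa K) k = (if k == 0%N then (-1) ^+ #|K| else 0) + 2 * \sum_(j in K) gcoef x K j * x j ^+ k.
Proof.
pose R K k : F := (if k == 0%N then (-1) ^+ #|K| else 0) + 2 * \sum_(j in K) gcoef x K j * x j ^+ k.
have dX K' : distinct x K' by move=> i j _ _; apply: dx.
have R0 K' : R K' 0%N = 1.
  rewrite /R eqxx (eq_bigr (gcoef x K')) => [|j _]; last by rewrite expr0 mulr1.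
  by rewrite (sum_gcoef (dX K')); ring.
rewrite -/(R K k); have [n] := ubnP #|K|; elim: n K k => // n IH K k; rewrite ltnS => cK.
have [->|[i iK]] := set_0Vmem K.
  case: k => [|k]; first by rewrite R0 q0.
  rewrite /R big_set0 mulr0 addr0 /=; apply: (mulrnI_alg (A := F^o) F0 (n := k)).
  transitivity (0 : F^o); last by rewrite mulr0.
  apply: etrans (q_rec F0 _ _) _; apply: big1 => j _; rewrite dlogq_miwa big_set0.
  by rewrite mulr0 if_same mul0r.
rewrite -(setD1K iK); set K' := K :\ i.
have iK' : i \notin K' by rewrite !inE eqxx.
have cK' : (#|K'| < n)%N by move: cK; rewrite (cardsD1 i K) iK add1n.
elim: k => [|k IHk]; first by rewrite R0 q0.
have := q_miwaU k iK'; rewrite IHk (IH K' k.+1 cK') (IH K' k cK') => /(canRL (subrK _)) ->.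
have gU j : j \in K' -> gcoef x (i |: K') j = (x j + x i) / (x j - x i) * gcoef x K' j.
  move=> jK; have ji : j != i by apply: contraNneq iK' => <-.
  rewrite /gcoef (big_setD1 i) /=; last by rewrite !inE eq_sym ji eqxx.
  congr (_ * _); apply: eq_bigl => p; rewrite !inE; case: (eqVneq p i) => //= -> ; by rewrite andbF.
have key : \sum_(j in K') gcoef x (i |: K') j * x j ^+ k.+1
   = x i * (\sum_(j in K') gcoef x (i |: K') j * x j ^+ k)
     + \sum_(j in K') gcoef x K' j * x j ^+ k.+1 + x i * (\sum_(j in K') gcoef x K' j * x j ^+ k).
  rewrite !mulr_sumr -!big_split; apply: eq_bigr => j jK /=.
  have ji : j != i by apply: contraNneq iK' => <-.
  have /andP[h1 _] := dx ji; rewrite gU // exprS; field; exact: h1.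
rewrite /R !big_setU1 //= cardsU1 iK' add1n exprS key exprS.
by case: (k) => [|k'] /=; ring.
Qed.

Hypothesis even_T : ~~ odd #|T|.

Local Notation g := (gcoef x setT).
Let dX K : distinct x K. Proof. by move=> i j _ _; apply: dx. Qed.
Let sgnT : (-1) ^+ #|[set: T]| = 1 :> F. Proof. by rewrite cardsT -signr_odd (negPf even_T). Qed.
Let F2 : (2 : F) != 0. Proof. exact: F0 1%N. Qed.

Definition gpower k : F := \sum_j g j * x j ^+ k.
Local Notation G := gpower.

Let sum_g : \sum_j g j = 0.
Proof.
have := sum_gcoef (dX (K := setT)); rewrite sgnT subrr => /eqP; rewrite mulf_eq0 (negPf F2) /=.
by move/eqP; apply: etrans; apply: eq_bigl => j; rewrite inE.
Qed.

Lemma gpower0 : G 0 = 0.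
Proof. by rewrite -[RHS]sum_g; apply: eq_bigr => j _; rewrite expr0 mulr1. Qed.

Let sum_g_ratio i : \sum_j g j * ((x j - x i) / (x i + x j)) = 1.
Proof.
have h k : k \in [set: T] -> x i + x k != 0.
  move=> _; have [->|/dx/andP[_]] := eqVneq k i; last by rewrite addrC.
  by rewrite -mulr2n -mulr_natl mulf_neq0.
have := sum_gcoef_ratio (dX (K := setT)) h.
rewrite [\prod_(k in _) _](big_setD1 i) ?inE //= subrr !mul0r sub0r.
have -> : \sum_(j in [set: T]) gcoef x [set: T] j = 0 by rewrite -[RHS]sum_g; apply: eq_bigl => j; rewrite inE.
rewrite addr0 => /eqP; rewrite -eqr_oppLR => /eqP <-; rewrite -sumrN.
apply: eq_big => [j|j _]; first by rewrite inE.
by rewrite -mulrN -mulNr opprB.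
Qed.

Definition miwa_kernel i j : F := g i * g j * ((x j - x i) / (x i + x j)).
Definition miwa_M (r s : nat) : F := \sum_i \sum_j x i ^+ r * miwa_kernel i j * x j ^+ s.

Lemma q_miwaT k : q (miwa setT) k = if k == 0%N then 1 else 2 * G k.
Proof.
case: k => [|k]; first exact: q0.
rewrite q_miwa /= add0r; congr (_ * _); apply: eq_bigl => j; by rewrite inE.
Qed.

Let miwa_M_r0 r : miwa_M r 0 = G r.
Proof.
rewrite /miwa_M /G; apply: eq_bigr => i _; rewrite -[RHS]mulr1 -[X in _ = _ * X](sum_g_ratio i) mulr_sumr.
by apply: eq_bigr => j _; rewrite /miwa_kernel expr0; ring.
Qed.

Let miwa_M_anti r s : miwa_M s r = - miwa_M r s.
Proof.
rewrite /miwa_M exchange_big /= -sumrN; apply: eq_bigr => i _; rewrite -sumrN; apply: eq_bigr => j _.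
by rewrite /miwa_kernel [x j + x i]addrC -[x i - x j]opprB; ring.
Qed.

Let miwa_M_rec r s : miwa_M r.+1 s + miwa_M r s.+1 = G r * G s.+1 - G r.+1 * G s.
Proof.
rewrite /miwa_M /gpower !big_distrlr -big_split -sumrB; apply: eq_bigr => i _.
rewrite /= -big_split -sumrB; apply: eq_bigr => j _.
have h : x i + x j != 0.
  have [->|/dx/andP[]//] := eqVneq i j; by rewrite -mulr2n -mulr_natl mulf_neq0.
by rewrite /miwa_kernel !exprS /=; field.
Qed.

(** Since q_0 is 1 while q_k = 2 G_k for k > 0, each nonzero part contributes one factor 2; together
    they cancel the factor 2^(-l(lambda)) of tau. *)
Definition mult2 (r : nat) : F := if r == 0%N then 1 else 2.

Lemma M_miwa r s : M (miwa setT) r s = mult2 r * mult2 s * miwa_M r s.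
Proof.
have base r' : M (miwa setT) r'.+1 0 = mult2 r'.+1 * mult2 0 * miwa_M r'.+1 0.
  by rewrite M_r0 q_miwaT miwa_M_r0 /= mulr1.
elim: s r => [|s IH] [|r] //.
- by rewrite miwa_M_r0 gpower0 M00 mulr0.
- by rewrite (M_anti F0) base miwa_M_anti /=; ring.
have := M_rec (miwa setT) r.+1 s; rewrite addrC => /(canRL (addrK _)) ->.
have := miwa_M_rec r.+1 s; rewrite addrC => /(canRL (addrK _)) ->.
rewrite IH !q_miwaT /mult2 /=; case: s {IH} => [|s] /=; last by ring.
by rewrite miwa_M_r0; change (2 * G r.+1 * (2 * G 1) - 2 * G r.+2 * 1 - 2 * 1 * G r.+2 = 2 * 2 * (G r.+1 * G 1 - G r.+2 * G 0 - G r.+2) :> F);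
  rewrite gpower0; ring.
Qed.
End Miwa.

Section OrderedProducts.
Variables (F : fieldType) (T : finType) (s : T -> T -> F).
Hypothesis santi : forall x y, s y x = - s x y.

Lemma prod_ordered_pairs (l : seq T) : uniq l ->
  \prod_(i <- l) \prod_(k <- l | k != i) s i k = vdm s l * vdm (fun i j => - s i j) l.
Proof.
elim: l => [|x l IH] /=; first by rewrite big_nil mulr1.
case/andP=> xl ul; rewrite big_cons big_cons eqxx.
have -> : \prod_(k <- l | k != x) s x k = \prod_(k <- l) s x k.
  rewrite big_seq_cond [RHS]big_seq; apply: eq_bigl => k.
  by case: (boolP (k \in l)) => // kl; apply: contraNneq xl => <-.
have -> : \prod_(i <- l) \prod_(k <- x :: l | k != i) s i k
   = \prod_(i <- l) (- s x i * \prod_(k <- l | k != i) s i k).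
  rewrite big_seq [RHS]big_seq; apply: eq_bigr => i il; rewrite big_cons ifT -?santi //.
  by apply: contraNneq xl => ->.
rewrite big_split /= IH //; ring.
Qed.
End OrderedProducts.

Section SchurProduct.
Variables (F : fieldType) (A : comAlgType F) (T : finType) (x0 : T) (s : T -> T -> F) (f : T -> T -> A).
Hypothesis F0 : forall n, n.+1%:R != 0 :> F.
Hypothesis santi : forall x y, s y x = - s x y.
Hypothesis s_neq0 : forall x y, x != y -> s x y != 0.
Hypothesis s_row : forall i (Y : {set T}), i \notin Y -> odd #|Y| ->
  \sum_(j in Y) \prod_(k in Y :\ j) (s i k * s j k)^-1 = 1.
Local Notation g i := (\prod_(k in [set: T] :\ i) (s i k)^-1).

(** Turns a term of the Cauchy-Binet sum into a term of [npfset_add]. By Schur's Pfaffian the first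
    factor is the product of the g_i times [vdm] of - s. In the product of the g_i, the pairs inside
    I cancel that [vdm] and provide the normalization of the second factor; the other pairs form
    [cross_inv]. *)
Lemma pfseq_kernel (I : {set T}) : ~~ odd #|I| ->
  pfseq x0 (fun i j => (- (g i * g j * s i j))%:A : A) (enum I) * pfseq x0 f (enum I)
  = cross_inv s I (~: I) *: npfset x0 s f I.
Proof.
move=> eI; pose s' i j := - s i j; have eI' : ~~ odd (size (enum I)) by rewrite -cardE.
have s'anti i j : s' j i = - s' i j by rewrite /s' santi.
have s'neq0 i j : i != j -> s' i j != 0 by move=> ij; rewrite oppr_eq0 s_neq0.
have s'row i (Y : {set T}) : i \notin Y -> odd #|Y| ->
  \sum_(j in Y) \prod_(k in Y :\ j) (s' i k * s' j k)^-1 = 1.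
  by move=> iY oY; rewrite -[RHS](s_row iY oY); apply: eq_bigr => j _; apply: eq_bigr => k _; rewrite mulrNN.
have -> : pfseq x0 (fun i j => (- (g i * g j * s i j))%:A : A) (enum I)
   = (\prod_(i <- enum I) g i)%:A * (vdm s' (enum I))%:A.
  have -> : (\prod_(i <- enum I) g i)%:A = \prod_(i <- enum I) (g i)%:A :> A.
    exact: (rmorph_prod (in_alg A)).
  rewrite -(pfseq_schur A F0 x0 s'anti s'neq0 s'row eI) -pfseq_scale //.
  by apply: eq_pff => // i j; rewrite mulr_algl -scalerAl mulr_algl !scalerA; congr (_ *: _); rewrite /s'; ring.
rewrite mulr_algl -scalerAl mulr_algl /npfset /npf; move: (pfseq x0 f (enum I)) => P; rewrite !scalerA; congr (_ *: _).
have vs : vdm s (enum I) != 0 by apply: vdm_neq0 => [|i j _ _]; [apply: enum_uniq | apply: s_neq0].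
have vs' : vdm s' (enum I) != 0 by apply: vdm_neq0 => [|i j _ _]; [apply: enum_uniq | apply: s'neq0].
have -> : \prod_(i <- enum I) g i = cross_inv s I (~: I) * (vdm s (enum I) * vdm s' (enum I))^-1.
  rewrite -prod_ordered_pairs ?enum_uniq // /cross_inv -big_enum -prodfV -big_split /=.
  apply: eq_big_seq => i; rewrite mem_enum => iI; rewrite (bigID (fun k => k \in I)) /= mulrC; congr (_ * _).
    by apply: eq_bigl => k; rewrite !inE andbT; case: (eqVneq k i) => [->|_]; rewrite ?iI.
  rewrite prodfV big_enum_cond; congr _^-1; apply: eq_bigl => k; by rewrite !inE andbT andbC.
by field; rewrite vs vs'.
Qed.
End SchurProduct.

Section SubsetExpansion.
Variables (F : fieldType) (A : comAlgType F).
Hypothesis F0 : forall n, n.+1%:R != 0 :> F.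

Lemma sum_even_sets (V : nmodType) (S : finType) (G : {set S} -> V) M : (#|S| < M.*2)%N ->
  \sum_(X : {set S} | ~~ odd #|X|) G X = \sum_(m < M) \sum_(X : {set S} | #|X| == m.*2) G X.
Proof.
move=> SM; have hM (X : {set S}) : (#|X|./2 < M)%N by have := max_card X; lia.
rewrite (partition_big (fun X : {set S} => Ordinal (hM X)) predT) //=.
apply: eq_bigr => m _; apply: eq_bigl => X; rewrite -val_eqE /=.
by apply/andP/eqP => [[eX /eqP <-]|->]; rewrite ?even_halfK // odd_double doubleK.
Qed.

(** For each m, both sides of [pff_cauchy_binet] are (2m)! times sums over subsets of size 2m,
    because a product of two Pfaffians is symmetric and vanishes on repeated indices. *)
Lemma pfseq_cauchy_binet (S T : finType) (s0 : S) (t0 : T) (V : S -> T -> A) (c : S -> S -> A) (J : T -> T -> A) :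
  (forall x y, c y x = - c x y) -> (forall x y, J y x = - J x y) ->
  \sum_(X : {set S} | ~~ odd #|X|) pfseq s0 c (enum X) * pfseq s0 (congruence V J) (enum X)
  = \sum_(I : {set T} | ~~ odd #|I|) pfseq t0 J (enum I) * pfseq t0 (contraction V c) (enum I).
Proof.
move=> canti Janti; pose M := (maxn #|S| #|T|).+1.
rewrite (sum_even_sets _ (M := M)) ?(sum_even_sets _ (S := T) (M := M)); try by rewrite /M; lia.
apply: eq_bigr => m _.
have expand (U : finType) (u0 : U) (c1 c2 : U -> U -> A) :
    (forall x y, c1 y x = - c1 x y) ->
    \sum_(s : {ffun 'I_m.*2 -> U}) pff c1 s * pff c2 s
    = (\sum_(X : {set U} | #|X| == m.*2) pfseq u0 c1 (enum X) * pfseq u0 c2 (enum X)) *+ (m.*2)`!.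
  move=> anti; pose G (f : 'I_m.*2 -> U) := pff c1 f * pff c2 f.
  have Gext f f' : f =1 f' -> G f = G f' by move=> e; congr (_ * _); apply: eq_pff.
  have Gsym f (s : 'S_m.*2) : G (f \o s) = G f.
    rewrite /G (pff_perm c1) (pff_perm c2) mulrACA -expr2 sqrr_sign; exact: mul1r.
  have Gninj f : ~~ injectiveb f -> G f = 0 by move=> nf; rewrite /G pff_ninj ?mul0r.
  apply: etrans (sum_ffun_sym u0 Gext Gsym Gninj) _; congr (_ *+ _).
  apply: eq_bigr => X /eqP cX; have sX : size (enum X) = m.*2 by rewrite -cardE.
  by rewrite !(pfseqE _ _ sX).
have e1 := expand S s0 c (congruence V J) canti.
have e2 := expand T t0 J (contraction V c) Janti.
have e3 := pff_cauchy_binet V c J m.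
have e4 := etrans (esym e1) e3.
have e5 := etrans e4 e2.
move: e5 (fact_gt0 m.*2); clear -F0.
set a := \sum_(X | _) _; set b := \sum_(X | _) _.
move: (_`!) => [//|n] e5 _.
apply: (mulrnI_alg F0 (n := n)); rewrite !mulr_natl; exact: e5.
Qed.
End SubsetExpansion.

(** * Strict partitions as subsets of even size *)

Section StrictPartitions.
Variable W : nat.
Implicit Types X : {set 'I_W.+1}.

(* A subset of even size of {0, ..., W} stands for a strict partition with parts at
   most W: the part 0 is only there to make the length even. *)
Definition strict_of X : seq nat := [seq k <- rev (map val (enum X)) | k != 0%N].

Lemma enum_ord_sorted X : sorted ltn (map val (enum X)).
Proof.
rewrite sorted_map; apply: sorted_filter => [i j k|]; first exact: ltn_trans.
by rewrite -enumT -sorted_map val_enum_ord iota_ltn_sorted.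
Qed.

(** A subset of even size contains 0 exactly when its number of nonzero elements is odd, that is,
    when [complete_seq] appends a 0. *)
Lemma complete_strict_of X : ~~ odd #|X| ->
  complete_seq (strict_of X) = rev (map val (enum X)).
Proof.
rewrite cardE -(size_map val) /strict_of; have := enum_ord_sorted X.
move: (map val (enum X)) => [|k l] //= sl eX.
have al : all (fun i => i != 0%N) l.
  by apply/allP => i il; rewrite -lt0n (leq_ltn_trans (leq0n k)) // (allP (order_path_min ltn_trans sl)).
have fl : [seq i <- rev l | i != 0%N] = rev l by apply/all_filterP; rewrite all_rev.
rewrite rev_cons filter_rcons fl; case: (eqVneq k 0%N) => [->|k0] /=; rewrite /complete_seq.
  by rewrite size_rev ifT // -[odd _]negbK.
by rewrite size_rcons size_rev /= (negPf eX).
Qed.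

Lemma strict_strict_of X : strict (strict_of X).
Proof.
apply/andP; split; last by rewrite mem_filter eqxx.
apply: sorted_filter => [i j k ij jk|]; first exact: ltn_trans jk ij.
by rewrite rev_sorted enum_ord_sorted.
Qed.

Lemma sumn_strict_of X : sumn (strict_of X) = (\sum_(k in X) k)%N.
Proof.
have -> : sumn (strict_of X) = sumn (rev (map val (enum X))).
  by rewrite /strict_of; elim: (rev _) => //= k l <-; case: eqP => [->|].
by rewrite sumn_rev sumnE big_map big_enum.
Qed.

Lemma strict_of_inj (X Y : {set 'I_W.+1}) : ~~ odd #|X| -> ~~ odd #|Y| -> strict_of X = strict_of Y -> X = Y.
Proof.
move=> eX eY e; have := complete_strict_of eX; rewrite e complete_strict_of // => /(can_inj revK)/(inj_map val_inj) h.
by apply/setP => i; rewrite -[LHS]mem_enum -h mem_enum.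
Qed.

Lemma strict_of_surj l : strict l -> (forall k, k \in l -> (k <= W)%N) ->
  exists2 X : {set 'I_W.+1}, ~~ odd #|X| & strict_of X = l.
Proof.
move=> /andP[sl l0] lW; pose X := [set i : 'I_W.+1 | val i \in complete_seq l].
have gtn_trans : transitive gtn by move=> i j k ij jk; apply: ltn_trans jk ij.
have ul : uniq l by apply: (sorted_uniq gtn_trans ltnn).
have cW k : k \in complete_seq l -> (k < W.+1)%N.
  by rewrite /complete_seq; case: ifP => _; rewrite ?mem_rcons ?inE; [case/orP => [/eqP->//|]|]; rewrite ltnS; apply: lW.
have scl : sorted gtn (complete_seq l).
  rewrite /complete_seq; case: ifP => // _; rewrite -[rcons _ _]revK rev_sorted rev_rcons /=.
  rewrite path_min_sorted ?rev_sorted //; apply/allP => k; rewrite mem_rev => kl.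
  by rewrite lt0n; apply: contraNneq l0 => <-.
have eE : rev (map val (enum X)) = complete_seq l.
  apply: (irr_sorted_eq gtn_trans ltnn) => //; first by rewrite rev_sorted enum_ord_sorted.
  move=> k; rewrite mem_rev; apply/mapP/idP => [[i iX ->]|kl].
    by move: iX; rewrite mem_enum inE.
  by exists (Ordinal (cW k kl)); rewrite ?mem_enum ?inE.
exists X; first by rewrite cardE -(size_map val) -size_rev eE even_complete.
rewrite /strict_of eE; have fl : [seq k <- l | k != 0%N] = l.
  by apply/all_filterP/allP => k kl; apply: contraNneq l0 => <-.
by rewrite /complete_seq; case: ifP => _ //; rewrite filter_rcons.
Qed.
End StrictPartitions.

(** * Tau at power sums as a single Pfaffian *)

Section MiwaSum.
Variables (F : fieldType) (N W : nat) (x : 'I_N -> F) (o : 'I_N).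
Hypothesis F0 : forall n, n.+1%:R != 0 :> F.
Hypothesis dx : forall i j, i != j -> (x i - x j != 0) && (x i + x j != 0).
Hypothesis x_neq0 : forall i, x i != 0.
Hypothesis even_N : ~~ odd N.
Implicit Types X : {set 'I_W.+1}.

Definition miwa_term X : F :=
  2 ^- size (strict_of X) * pfseq 0%N (coefc F : nat -> nat -> F^o) (complete_seq (strict_of X))
    * Q (miwa x setT) (strict_of X).

(** The variable 'X marks the weight: a part r brings 'X^r, so a partition brings 'X^|lambda|. *)
Definition miwa_V (r : 'I_W.+1) (i : 'I_N) : {poly F} := (x i ^+ r)%:P * 'X^r.
Definition miwa_c (r s : 'I_W.+1) : {poly F} := (coefc F r s)%:P.

Let even_T : ~~ odd #|'I_N|. Proof. by rewrite card_ord. Qed.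

Lemma pfseq_polyC (T : Type) (t0 : T) (B : T -> T -> F^o) l :
  pfseq t0 (fun i j => (B i j)%:P : {poly F}) l = (pfseq t0 B l)%:P.
Proof.
have := rmorph_pfaffian (polyC : {rmorphism F^o -> {poly F}}) F0 F0.
move=> h; rewrite /pfseq /pff h; congr pfaffian; apply/matrixP => i j; by rewrite !mxE.
Qed.

(** Subsets are enumerated increasingly and parts decreasingly; the reversal costs the same sign in
    both Pfaffians, hence none in their product. *)
Lemma miwa_termE X : ~~ odd #|X| ->
  (miwa_term X)%:P * 'X^(sumn (strict_of X))
  = pfseq ord0 miwa_c (enum X) * pfseq ord0 (congruence miwa_V (fun i j => (miwa_kernel x i j)%:P)) (enum X).
Proof.
move=> eX; set L := map val (enum X); have eL : ~~ odd (size L) by rewrite size_map -cardE.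
have eE : ~~ odd (size (enum X)) by rewrite -cardE.
have cE : complete_seq (strict_of X) = rev L by apply: complete_strict_of.
have erL : ~~ odd (size (rev L)) by rewrite size_rev.
have pr : perm_eq (rev L) L by rewrite perm_rev.
have [e eqL] := pfseq_perm F^o 0%N erL pr.
have -> : pfseq ord0 (congruence miwa_V (fun i j => (miwa_kernel x i j)%:P)) (enum X)
   = 'X^(sumn (strict_of X)) * (pfseq 0%N (miwa_M x : nat -> nat -> F^o) L)%:P.
  rewrite sumn_strict_of; transitivity ((\prod_(r <- enum X) 'X^r) * pfseq ord0 (fun r s : 'I_W.+1 => (miwa_M x r s : F^o)%:P : {poly F}) (enum X)).
    rewrite -pfseq_scale //; apply: eq_pff => // r s; rewrite /congruence /miwa_M.
    rewrite raddf_sum mulr_sumr; apply: eq_bigr => i _; rewrite raddf_sum mulr_sumr; apply: eq_bigr => j _.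
    rewrite -[X in _ = _ * X]/((x i ^+ r * miwa_kernel x i j * x j ^+ s)%:P) /miwa_V !polyCM; ring.
  congr (_ * _); first by rewrite big_enum -expr_sum.
  rewrite (pfseq_polyC ord0 (fun r s : 'I_W.+1 => miwa_M x r s : F^o)); congr _%:P.
  by rewrite (pfseq_map (A := F^o) ord0 0%N val).
have -> : pfseq ord0 miwa_c (enum X) = (pfseq 0%N (coefc F : nat -> nat -> F^o) L)%:P.
  rewrite (pfseq_polyC ord0 (fun r s : 'I_W.+1 => coefc F r s : F^o)); congr _%:P.
  by rewrite (pfseq_map (A := F^o) ord0 0%N val).
rewrite mulrCA -polyCM mulrC; congr (_ * _%:P); rewrite /miwa_term QE cE.
have -> : pfseq 0%N (M (miwa x setT)) (rev L) = 2 ^+ size (strict_of X) * pfseq 0%N (miwa_M x : nat -> nat -> F^o) (rev L).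
  transitivity ((\prod_(r <- rev L) (mult2 F r : F^o)) * pfseq 0%N (miwa_M x : nat -> nat -> F^o) (rev L)).
    rewrite -pfseq_scale //; apply: eq_pff => // r s; apply: (M_miwa F0 dx x_neq0 even_T).
  congr (_ * _); rewrite /strict_of -/L; elim: (rev L) => [|k l IH]; first by rewrite big_nil.
  by rewrite big_cons /= IH /mult2; case: (eqVneq k 0%N) => _ /=; rewrite ?mul1r ?exprS.
rewrite !eqL; have F2 : 2 != 0 :> F := F0 1.
have s2 : (-1) ^+ e * (-1) ^+ e = 1 :> F by rewrite -expr2 sqrr_sign.
have nz : 2 ^+ size (strict_of X) != 0 :> F by rewrite expf_neq0.
move: (pfseq _ _ L) (pfseq _ _ L) => P2 P1.
transitivity ((2 ^+ size (strict_of X))^-1 * 2 ^+ size (strict_of X) * ((-1) ^+ e * (-1) ^+ e) * (P1 * P2) : F).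
  by change (2 ^- size (strict_of X) * ((-1) ^+ e * P1) * (2 ^+ size (strict_of X) * ((-1) ^+ e * P2)) = (2 ^+ size (strict_of X))^-1 * 2 ^+ size (strict_of X) * ((-1) ^+ e * (-1) ^+ e) * (P1 * P2) :> F); ring.
by rewrite mulVf // s2 !mul1r.
Qed.

(** Cauchy-Binet moves the sum from subsets of parts to subsets of variables, and [npfset_add], read
    from right to left with s = [ratio], sums the latter. *)
Theorem miwa_sum :
  \sum_(X : {set 'I_W.+1} | ~~ odd #|X|) (miwa_term X)%:P * 'X^(sumn (strict_of X))
  = npfset o (ratio x) (fun i j => (ratio x i j)%:A + contraction miwa_V miwa_c i j) setT.
Proof.
rewrite (eq_bigr _ miwa_termE).
have canti (r s : 'I_W.+1) : miwa_c s r = - miwa_c r s by rewrite /miwa_c (coefc_anti F0) polyCN.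
have Janti i j : (miwa_kernel x j i)%:P = - (miwa_kernel x i j)%:P :> {poly F}.
  by rewrite -polyCN /miwa_kernel [x j + x i]addrC -[x i - x j]opprB; congr _%:P; ring.
rewrite (pfseq_cauchy_binet F0 ord0 o miwa_V canti Janti).
have fanti i j : contraction miwa_V miwa_c j i = - contraction miwa_V miwa_c i j.
  rewrite /contraction exchange_big /= -sumrN; apply: eq_bigr => r _; rewrite -sumrN; apply: eq_bigr => s _.
  by rewrite [miwa_c s r]canti; ring.
rewrite (npfset_add o F0 (ratio_anti x) fanti (ratio_neq0 dx) (ratio_row F0 dx)) ?cardsT ?card_ord //.
apply: eq_big => [I|I eI]; first by rewrite subsetT.
rewrite setTD -(pfseq_kernel o _ F0 (ratio_anti x) (ratio_neq0 dx) (ratio_row F0 dx) eI); congr (_ * _).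
apply: eq_pff => // i j; rewrite -alg_polyC; congr (_ *: _).
rewrite /miwa_kernel; have gE k : gcoef x setT k = \prod_(p in [set: 'I_N] :\ k) (ratio x k p)^-1.
  by apply: eq_bigr => p _; rewrite invf_div.
by rewrite !gE /ratio -[x j - x i]opprB; ring.
Qed.
End MiwaSum.

(** * From the Airy equation to the Virasoro operators *)

Section Conjugation.
Variables (F : fieldType) (N : nat) (x : 'I_N -> F) (o : 'I_N) (D : 'I_N -> F -> F).
Hypothesis F0 : forall n, n.+1%:R != 0 :> F.
Hypothesis dx : forall i j, i != j -> (x i - x j != 0) && (x i + x j != 0).
Hypothesis x_neq0 : forall i, x i != 0.
Hypothesis dD : forall i, derivation (D i).
Hypothesis Dx : forall i j, D i (x j) = (i == j)%:R.

Let F2 : 2 != 0 :> F. Proof. exact: F0 1%N. Qed.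
Let F4 : 4 != 0 :> F. Proof. exact: F0 3%N. Qed.
Let F16 : 16 != 0 :> F. Proof. exact: F0 15%N. Qed.

Local Notation lam j := (x j)^-1.

Definition euler j f : F := x j * D j f.
Definition dressing j : F := 2^-1 + \sum_(k | k != j) x k / (x j + x k).
(** The operator x_j^3 D_j + x_j^2/2, conjugated by the factor of [dressed_conj]. *)
Definition dressed j f : F := x j ^+ 3 * D j f + x j ^+ 2 * dressing j * f.
Definition mu_diff j : F := ((lam o) ^+ 2 - (lam j) ^+ 2)^-1.
Lemma mu_diffE j : mu_diff j = x o ^+ 2 * x j ^+ 2 / ((x j - x o) * (x j + x o)).
Proof. by rewrite /mu_diff -invf_div; congr _^-1; field; rewrite !x_neq0. Qed.

(** Multiplied by x_o^2, this is the generating function of the operators L_m without their 1/hbar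
    term, written in the variables x; [ev_virasoro] makes the link. *)
Definition virasoro_wave f : F :=
  4^-1 * euler o (euler o f) + 3 / 4 * euler o f
  + (4^-1 * (\sum_i x i) ^+ 2 / x o ^+ 2 + 16^-1) * f
  + 2^-1 * \sum_(j | j != o) (x o * x j * euler o f - x j ^+ 4 / x o ^+ 2 * euler j f) / (x o ^+ 2 - x j ^+ 2).

Let DX i f k : D i (f ^+ k) = k%:R * D i f * f ^+ k.-1.
Proof.
elim: k => [|k IH]; first by rewrite expr0 (der1 (dD i)) !mul0r.
case: k IH => [_|k IH]; first by rewrite expr1 mul1r mulr1.
by rewrite exprS (derM (dD i)) IH /= -[k.+2]addn1 natrD exprS; ring.
Qed.

Let D_dressing : D o (dressing o) = - \sum_(k | k != o) x k / (x o + x k) ^+ 2.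
Proof.
rewrite /dressing (derD (dD o)) (derV (dD o)) (der_nat (dD o)) oppr0 mul0r add0r (der_sum (dD o)) -sumrN.
apply: eq_bigr => k ko; rewrite (derM (dD o)) (derV (dD o)) (derD (dD o)) !Dx eqxx eq_sym (negPf ko).
by have /andP[_ h] := dx ko; rewrite addrC in h; rewrite /= ?mulr0n ?mulr1n addr0; field.
Qed.

Lemma sum_sym (P : pred 'I_N) (b : 'I_N -> 'I_N -> F) :
  \sum_(j | P j) \sum_(k | P k && (k != j)) b j k = \sum_(j | P j) \sum_(k | P k && (k != j)) b k j.
Proof.
rewrite (exchange_big_dep P) /=; last by move=> j k _ /andP[].
by apply: eq_bigr => k Pk; apply: eq_bigl => j; rewrite Pk /= eq_sym.
Qed.

Lemma sum_square (P : pred 'I_N) (f : 'I_N -> F) :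
  (\sum_(j | P j) f j) ^+ 2 = \sum_(j | P j) f j ^+ 2 + \sum_(j | P j) \sum_(k | P k && (k != j)) f j * f k.
Proof.
rewrite expr2 big_distrlr -big_split; apply: eq_bigr => j Pj /=.
by rewrite (bigD1 j) //= expr2.
Qed.

(** The zeroth-order part of [dressed_square]. Squares of sums are separated into terms with one and
    with two indices other than o. The two-index terms collapse only after symmetrization in j and
    k. *)
Lemma dressing_identity :
  2 * x o ^+ 4 * dressing o + x o ^+ 5 * D o (dressing o) + x o ^+ 4 * dressing o ^+ 2
    - 2 * \sum_(j | j != o) mu_diff j * (x o ^+ 2 * dressing o - x j ^+ 2 * dressing j)
  = x o ^+ 2 * (\sum_i x i) ^+ 2 + x o ^+ 4 / 4.
Proof.
pose P j := j != o; pose h k := x k / (x o + x k).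
(* [a j] and [b j k] are the parts of the cross terms involving one, respectively two, indices other
   than o. *)
pose a j := - 2 * mu_diff j * (x o ^+ 2 / 2 + x o ^+ 2 * h j - x j ^+ 2 / 2 - x j ^+ 2 * (x o / (x j + x o))).
pose b j k := - 2 * mu_diff j * (x o ^+ 2 * h k - x j ^+ 2 * (x k / (x j + x k))).
have nz j : P j -> [&& x o - x j != 0, x o + x j != 0, x j - x o != 0 & x j + x o != 0].
  move=> jo; have /andP[-> ->] := dx jo; have oj : o != j by rewrite eq_sym.
  by have /andP[-> ->] := dx oj.
have step1 : - (2 * \sum_(j | j != o) mu_diff j * (x o ^+ 2 * dressing o - x j ^+ 2 * dressing j))
   = \sum_(j | P j) a j + \sum_(j | P j) \sum_(k | P k && (k != j)) b j k.
  rewrite mulr_sumr -sumrN -big_split; apply: eq_bigr => j jo /=.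
  have -> : dressing j = 2^-1 + x o / (x j + x o) + \sum_(k | P k && (k != j)) x k / (x j + x k).
    rewrite /dressing (bigD1 o) 1?eq_sym //= addrA; congr (_ + _).
    by apply: eq_bigl => k; rewrite andbC.
  have -> : dressing o = 2^-1 + h j + \sum_(k | P k && (k != j)) h k by rewrite /dressing (bigD1 j) //= addrA.
  rewrite /b -mulr_sumr sumrB -!mulr_sumr /a; ring.
have step2 : \sum_(j | P j) \sum_(k | P k && (k != j)) b j k
   = \sum_(j | P j) \sum_(k | P k && (k != j)) 2^-1 * (b j k + b k j).
  transitivity (2^-1 * (\sum_(j | P j) \sum_(k | P k && (k != j)) b j k + \sum_(j | P j) \sum_(k | P k && (k != j)) b k j)).
    by rewrite -(sum_sym P b); field; exact: F2.
  rewrite -big_split mulr_sumr; apply: eq_bigr => j _; rewrite -big_split mulr_sumr; exact: eq_bigr.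
have two_body j k : P j -> P k && (k != j) -> x o ^+ 4 * (h j * h k) + 2^-1 * (b j k + b k j) = x o ^+ 2 * (x j * x k).
  move=> jo /andP[ko kj]; have /and4P[h1 h2 h3 h4] := nz j jo; have /and4P[k1 k2 k3 k4] := nz k ko.
  have /andP[_ jk] := dx kj; have jk' : x j + x k != 0 by rewrite addrC.
  by rewrite /b /h !mu_diffE; field; rewrite ?h1 ?h2 ?h3 ?h4 ?k1 ?k2 ?k3 ?k4 ?jk ?jk' ?F2.
have one_body j : P j -> 3 * x o ^+ 4 * h j - x o ^+ 5 * (x j / (x o + x j) ^+ 2) + x o ^+ 4 * h j ^+ 2 + a j
    = 2 * x o ^+ 3 * x j + x o ^+ 2 * x j ^+ 2.
  move=> jo; have /and4P[h1 h2 h3 h4] := nz j jo.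
  by rewrite /a /h !mu_diffE; field; rewrite ?h1 ?h2 ?h3 ?h4 ?F2.
rewrite step1 step2 D_dressing.
have -> : dressing o = 2^-1 + \sum_(j | P j) h j by [].
have -> : \sum_i x i = x o + \sum_(j | P j) x j by rewrite (bigD1 o).
have e1 : \sum_(j | P j) (3 * x o ^+ 4 * h j - x o ^+ 5 * (x j / (x o + x j) ^+ 2) + x o ^+ 4 * h j ^+ 2 + a j)
   = \sum_(j | P j) (2 * x o ^+ 3 * x j + x o ^+ 2 * x j ^+ 2) by apply: eq_bigr => j; apply: one_body.
have e2 : \sum_(j | P j) \sum_(k | P k && (k != j)) (x o ^+ 4 * (h j * h k) + 2^-1 * (b j k + b k j))
   = \sum_(j | P j) \sum_(k | P k && (k != j)) x o ^+ 2 * (x j * x k).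
  by apply: eq_bigr => j Pj; apply: eq_bigr => k; apply: two_body.
have spl (u v : 'I_N -> 'I_N -> F) : \sum_(j | P j) \sum_(k | P k && (k != j)) (u j k + v j k)
   = \sum_(j | P j) \sum_(k | P k && (k != j)) u j k + \sum_(j | P j) \sum_(k | P k && (k != j)) v j k.
  by rewrite -big_split; apply: eq_bigr => j _; rewrite -big_split.
have pull (c : F) (u : 'I_N -> 'I_N -> F) : \sum_(j | P j) \sum_(k | P k && (k != j)) c * u j k
   = c * \sum_(j | P j) \sum_(k | P k && (k != j)) u j k.
  by rewrite mulr_sumr; apply: eq_bigr => j _; rewrite mulr_sumr.
rewrite spl !pull in e2.
rewrite !big_split sumrN -!mulr_sumr in e1.
have hh := sum_square P h; have xx := sum_square P x.
move: e1 e2 hh xx; rewrite /= -/(P).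
set s1 := \sum_(i | P i) h i; set s2 := \sum_(i | P i) h i ^+ 2; set s3 := \sum_(i | P i) a i.
rewrite pull; set s4 := \sum_(i | P i) x i / (x o + x i) ^+ 2; set s5 := \sum_(i | P i) x i.
set s6 := \sum_(i | P i) x i ^+ 2; set d1 := \sum_(j | P j) \sum_(k | _) h j * h k.
set d2 := \sum_(j | P j) \sum_(k | _) (b j k + b k j); set d3 := \sum_(j | P j) \sum_(k | _) x j * x k.
move=> e1 e2 hh xx.
have -> : (2^-1 + s1) ^+ 2 = 4^-1 + s1 + s2 + d1 by rewrite sqrrD hh; field; rewrite F2 F4.
have -> : (x o + s5) ^+ 2 = x o ^+ 2 + 2 * x o * s5 + s6 + d3 by rewrite sqrrD xx; ring.
have -> : s3 = 2 * x o ^+ 3 * s5 + x o ^+ 2 * s6 - (3 * x o ^+ 4 * s1 - x o ^+ 5 * s4 + x o ^+ 4 * s2) by rewrite -e1; ring.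
have -> : 2^-1 * d2 = x o ^+ 2 * d3 - x o ^+ 4 * d1 by rewrite -e2; ring.
by field; rewrite F2 F4.
Qed.

(** After conjugation [nabla j] is 1/x_j - 16 'X^3 [dressed j]. The left side is the 'X^6 part of
    the Airy operator divided by 256; the factor 2 is 32 times 16 over 256. *)
Lemma dressed_square f :
  dressed o (dressed o f) - 2 * \sum_(j | j != o) mu_diff j * (dressed o f - dressed j f)
  = 4 * x o ^+ 4 * virasoro_wave f.
Proof.
have nz j : j != o -> [&& x o - x j != 0, x o + x j != 0, x j - x o != 0 & x j + x o != 0].
  move=> jo; have /andP[-> ->] := dx jo; have oj : o != j by rewrite eq_sym.
  by have /andP[-> ->] := dx oj.
have step j : j != o -> 2 * (mu_diff j * (dressed o f - dressed j f)) =
   2 * (mu_diff j * (x o ^+ 2 * dressing o - x j ^+ 2 * dressing j)) * f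
   + 2 * x o ^+ 5 * D o f * (x j / (x o + x j))
   - 2 * x o ^+ 4 * ((x o * x j * euler o f - x j ^+ 4 / x o ^+ 2 * euler j f) / (x o ^+ 2 - x j ^+ 2)).
  move=> jo; have /and4P[h1 h2 h3 h4] := nz j jo.
  rewrite mu_diffE /dressed /euler subr_sqr; field.
  by rewrite ?h1 ?h2 ?h3 ?h4 ?x_neq0.
rewrite mulr_sumr (eq_bigr _ step) big_split big_split /= sumrN -!mulr_sumr -mulr_suml.
have := dressing_identity; rewrite mulr_sumr.
set S := \sum_(j | j != o) _; set V := \sum_(j | j != o) (_ / (x o ^+ 2 - _)).
rewrite /virasoro_wave -/V.
have dE g : dressed o g = x o ^+ 3 * D o g + x o ^+ 2 * dressing o * g by [].
have -> : \sum_(j | j != o) x j / (x o + x j) = dressing o - 2^-1 by rewrite /dressing addrC addKr.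
move=> id; have {id}-> : S = 2 * x o ^+ 4 * dressing o + x o ^+ 5 * D o (dressing o) + x o ^+ 4 * dressing o ^+ 2
  - (x o ^+ 2 * (\sum_i x i) ^+ 2 + x o ^+ 4 / 4) by rewrite -id; ring.
rewrite !dE; move: (dressing o) V (\sum_i x i) {step S dE} => e V p.
rewrite (derD (dD o)) (derM (dD o) (x o ^+ 3) (D o f)) (derM (dD o) (x o ^+ 2 * e) f) (derM (dD o) (x o ^+ 2) e).
rewrite !DX /euler (derM (dD o) (x o) (D o f)) Dx eqxx mulr1n /=.
by field; rewrite F2 F4 F16 x_neq0.
Qed.

(** The 'X^3 part of the conjugated Airy operator divided by - 16. The [dressing] terms cancel, and
    a plain derivative remains. *)
Lemma dressed_first_order f :
  dressed o (lam o * f) + lam o * dressed o f - 2 * (\sum_(j | j != o) mu_diff j * (lam o - lam j)) * f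
  = 2 * x o ^+ 2 * D o f.
Proof.
have -> : \sum_(j | j != o) mu_diff j * (lam o - lam j) = x o * (dressing o - 2^-1).
  rewrite /dressing addrC addKr mulr_sumr; apply: eq_bigr => j jo.
  have /andP[_ h2] := dx jo; have oj : o != j by rewrite eq_sym.
  have /andP[h3 h4] := dx oj; have h5 : x j - x o != 0 by rewrite -oppr_eq0 opprB.
  by rewrite mu_diffE; field; rewrite ?h2 ?h3 ?h4 ?h5 ?x_neq0.
by rewrite /dressed (derM (dD o)) (derV (dD o)) Dx eqxx mulr1n; field; rewrite F2 x_neq0.
Qed.

(** The constant [c] undoes the factor between [miwa_poly] and the Airy sum in [trunc_miwa_poly].
    Only the factors of [pair_sum] that contain index j contribute to its logarithmic derivative. *)
Lemma dressed_conj (m : nat) j f (c := ((-1) ^+ m * pair_sum (fun i => lam i) setT)^-1) :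
  c != 0 /\ x j ^+ 3 * D j (c * f) + x j ^+ 2 / 2 * (c * f) = c * dressed j f.
Proof.
have lnz i k : i != k -> lam i + lam k != 0.
  move=> ik; have /andP[_ h] := dx ik; rewrite -[X in X != 0](_ : (x i + x k) / (x i * x k) = _).
    by rewrite mulf_neq0 ?invr_eq0 ?mulf_neq0.
  by field; rewrite !x_neq0.
pose l i := lam i.
have unz : pair_sum l setT != 0.
  by apply/prodf_neq0 => i _; apply/prodf_neq0 => k /andP[_ ik]; rewrite lnz // neq_ltn ik.
have cnz : c != 0 by rewrite invr_eq0 mulf_neq0 ?signr_eq0.
have Dl k : D j (lam k) = if k == j then - (lam j) ^+ 2 else 0.
  rewrite (derV (dD j)) Dx eq_sym; case: eqVneq => [->|_]; last by rewrite oppr0 mul0r.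
  by rewrite exprVn mulN1r.
have D0 : D j (pair_sum l (setT :\ j)) = 0.
  rewrite /pair_sum (der_prod_log (dD j)) => [|i _]; last first.
    by apply/prodf_neq0 => k /andP[_ ik]; rewrite lnz // neq_ltn ik.
  rewrite [X in _ * X]big1 ?mulr0 // => i ij; rewrite (der_prod_log (dD j)) => [|k /andP[_ ik]]; last first.
    by rewrite lnz // neq_ltn ik.
  rewrite [X in _ * X / _]big1 ?mulr0 ?mul0r // => k /andP[kj _]; rewrite (derD (dD j)) !Dl.
  by move: ij kj; rewrite !inE => /andP[/negPf-> _] /andP[/negPf-> _]; rewrite addr0 mul0r.
have DU : D j (pair_sum l setT) = - (pair_sum l setT * (\sum_(k | k != j) x k / (x j + x k)) / x j).
  rewrite (@pair_sumD1 _ _ l setT j) ?inE // (derM (dD j)) D0 mulr0 addr0 (der_prod_log (dD j)) => [|k]; last first.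
    by rewrite !inE andbT => kj; rewrite lnz // eq_sym.
  suff -> : \sum_(i in [set: 'I_N] :\ j) D j (l j + l i) / (l j + l i) = - ((\sum_(k | k != j) x k / (x j + x k)) / x j) by ring.
  rewrite mulr_suml -sumrN; apply: eq_big => [k|k kj]; first by rewrite !inE andbT.
  have kj' : k != j by move: kj; rewrite !inE andbT.
  have /andP[_ h] := dx kj'; have h' : x j + x k != 0 by rewrite addrC.
  have g : lam j + lam k != 0 by rewrite lnz // eq_sym.
  rewrite (derD (dD j)) !Dl eqxx (negPf kj') addr0 /l.
  have -> : lam j + lam k = (x j + x k) / (x j * x k) by field; rewrite !x_neq0.
  by field; rewrite h' !x_neq0.
split=> //; rewrite (derM (dD j)).
have -> : D j c = c * (\sum_(k | k != j) x k / (x j + x k)) / x j.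
  have sg g : D j ((-1) ^+ m * g) = (-1) ^+ m * D j g.
    by rewrite -signr_odd; case: odd; rewrite ?expr1 ?expr0 ?mulN1r ?mul1r ?(derN (dD j)).
  rewrite /c (derV (dD j)) sg -/l DU; field.
  by rewrite x_neq0 unz signr_eq0.
by rewrite /dressed /dressing; field; rewrite F2 x_neq0.
Qed.
End Conjugation.

(** * Truncation in the scale variable *)

Section Truncation.
Variables (F : fieldType) (W : nat).

Definition trunc : {poly F} -> {poly %/ 'X^(W.+1)} := in_qpoly ('X^(W.+1) : {poly F}).
HB.instance Definition _ := GRing.RMorphism.on trunc.

Lemma truncP (p q : {poly F}) : (trunc p = trunc q) <-> (forall i, (i <= W)%N -> p`_i = q`_i).
Proof.
have mkE : mk_monic ('X^(W.+1) : {poly F}) = 'X^(W.+1) by rewrite /mk_monic size_polyXn monicXn.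
have tE r : polyn (trunc r) = take_poly W.+1 r by rewrite Pdiv.RingMonic.take_poly_rmodp /= mkE.
split=> [e i iW|e].
  by have := congr1 (fun r : {poly F} => r`_i) (congr1 (@polyn _ _) e); rewrite !tE !coef_take_poly ltnS iW.
apply: val_inj; rewrite /= -[LHS]/(polyn (trunc p)) -[RHS]/(polyn (trunc q)) !tE.
by apply/polyP => i; rewrite !coef_take_poly ltnS; case: ifP => // /e.
Qed.
End Truncation.

(** The target is a bare ring, so scalars are transported as the images of [k%:A]. *)
Lemma rmorph_npfset (F : fieldType) (A : comAlgType F) (R : comNzRingType) (phi : {rmorphism A -> R})
    (T : finType) (x0 : T) (s : T -> T -> F) (B B' : T -> T -> A) (X : {set T}) :
  (forall i j, phi (B i j) = phi (B' i j)) -> phi (npfset x0 s B X) = phi (npfset x0 s B' X).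
Proof.
move=> e; have phiZ k y : phi (k *: y) = phi k%:A * phi y by rewrite -rmorphM mulr_algl.
rewrite /npfset /npf phiZ [RHS]phiZ; congr (_ * _); rewrite /pfseq !pffE phiZ [RHS]phiZ; congr (_ * _).
rewrite !rmorph_sum; apply: eq_bigr => u _; rewrite !rmorphM; congr (_ * _).
by rewrite /pairing !rmorph_prod; apply: eq_bigr => k _; apply: e.
Qed.

(** * The differential equation of tau in the variables x *)

Section MiwaPDE.
Variables (F : fieldType) (n W : nat).
Local Notation N := n.*2.
Variables (x : 'I_N -> F) (o : 'I_N) (D : 'I_N -> F -> F).
Hypothesis F0 : forall n, n.+1%:R != 0 :> F.
Hypothesis dx : forall i j, i != j -> (x i - x j != 0) && (x i + x j != 0).
Hypothesis x_neq0 : forall i, x i != 0.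
Hypothesis dD : forall i, derivation (D i).
Hypothesis Dx : forall i j, D i (x j) = (i == j)%:R.

Let F2 : 2 != 0 :> F. Proof. exact: F0 1%N. Qed.

Local Notation lam j := (x j)^-1.
Definition mu_node j : F := (lam j) ^+ 2.
(** The derivative with respect to mu_j, as mu_j = x_j^(-2). *)
Definition D_mu j f : F := - 2^-1 * x j ^+ 3 * D j f.
Definition poly_D_mu j (p : {poly F}) : {poly F} := \poly_(i < size p) D_mu j p`_i.
(** This stands for 2 hbar, because 'X^3 stands for hbar/16. *)
Definition airy_w : {poly F} := 32%:P * 'X^3.
Definition airy_dl j p : {poly F} := airy_w * poly_D_mu j p.
(** The operator w d/d mu applied to the logarithm of mu^(-1/4) exp((2/3) mu^(3/2) / w), the
    prefactor in the asymptotics of the growing Airy solution: the exponential gives the square root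
    of mu, which is 1/x, and the power gives - w/(4 mu). *)
Definition airy_s j : {poly F} := (lam j)%:P - (8 * x j ^+ 2)%:P * 'X^3.
Definition airy_a j : {poly F} := \poly_(r < W.+1) (alpha F r * x j ^+ r).
Definition airy_b j : {poly F} := \poly_(r < W.+1) (beta F r * (lam j * x j ^+ r)).
Definition airy_nabla j p : {poly F} := airy_dl j p + airy_s j * p.

Lemma derivation_D_mu j : derivation (D_mu j).
Proof.
split=> f g; rewrite /D_mu; first by rewrite (derD (dD j)) mulrDr.
by rewrite (derM (dD j)); ring.
Qed.

Let D_mu0 j : D_mu j 0 = 0. Proof. exact: der0 (derivation_D_mu j). Qed.

Lemma D_mu_node j k : D_mu j (mu_node k) = (j == k)%:R.
Proof.
rewrite /D_mu /mu_node expr2 (derM (dD j)) (derV (dD j)) Dx; case: eqVneq => [->|_].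
  by rewrite mulr1n; field; rewrite F2 x_neq0.
by rewrite mulr0n oppr0 !mul0r mulr0 addr0 mulr0.
Qed.

Lemma coef_poly_D_mu j p i : (poly_D_mu j p)`_i = D_mu j p`_i.
Proof. by rewrite coef_poly; case: ltnP => // h; rewrite nth_default // D_mu0. Qed.

Lemma coef_airy_dl j p i : (airy_dl j p)`_i = if (i < 3)%N then 0 else 32 * D_mu j p`_(i - 3).
Proof. by rewrite /airy_dl /airy_w -mulrA coefCM coefXnM coef_poly_D_mu; case: ifP => _; rewrite ?mulr0. Qed.

Lemma coef_nabla j p i : (airy_nabla j p)`_i = lam j * p`_i
  + if (i < 3)%N then 0 else - 16 * (x j ^+ 3 * D j p`_(i - 3) + x j ^+ 2 / 2 * p`_(i - 3)).
Proof.
have sE : airy_s j * p = (lam j)%:P * p - (8 * x j ^+ 2)%:P * ('X^3 * p) by rewrite /airy_s; ring.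
rewrite /airy_nabla coefD coef_airy_dl sE coefB !coefCM coefXnM.
case: ifP => _; first by rewrite mulr0 subr0 add0r addr0.
rewrite /D_mu; field.
by rewrite F2 x_neq0.
Qed.

Lemma derivation_dl j : derivation (airy_dl j).
Proof.
have d := derivation_D_mu j; split=> p q; rewrite /airy_dl.
  rewrite -mulrDr; congr (_ * _); apply/polyP => i; by rewrite !(coefD, coef_poly_D_mu) (derD d).
suff -> : poly_D_mu j (p * q) = poly_D_mu j p * q + p * poly_D_mu j q by ring.
apply/polyP => i; rewrite coef_poly_D_mu coefD !coefM (der_sum d) -big_split; apply: eq_bigr => k _ /=.
by rewrite (derM d) !coef_poly_D_mu.
Qed.

Lemma dl_alg j (c : F) : airy_dl j c%:A = airy_w * (D_mu j c)%:A.
Proof.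
congr (_ * _); apply/polyP => i; rewrite coef_poly_D_mu !alg_polyC !coefC.
by case: eqP => //; rewrite D_mu0.
Qed.

Lemma dl_w j : airy_dl j airy_w = 0.
Proof.
rewrite /airy_dl (_ : poly_D_mu j airy_w = 0) ?mulr0 //; apply/polyP => i; rewrite coef_poly_D_mu coef0.
rewrite /airy_w coefCM coefXn -natrM; exact: der_nat (derivation_D_mu j) _.
Qed.

Lemma trunc_dl j p q : trunc W p = trunc W q -> trunc W (airy_dl j p) = trunc W (airy_dl j q).
Proof.
move/truncP=> e; apply/truncP => i iW; rewrite !coef_airy_dl; case: ltnP => // _.
by rewrite e // (leq_trans (leq_subr _ _)).
Qed.

Let D_exp j i k : D j (x i ^+ k) = if i == j then k%:R * x j ^+ k / x j else 0.
Proof.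
elim: k => [|k IH]; first by rewrite expr0 (der1 (dD j)) !mul0r if_same.
rewrite exprS (derM (dD j)) IH Dx eq_sym; case: eqVneq => [->|_]; last by rewrite mulr0n mul0r mulr0 addr0.
by rewrite mulr1n -natr1 exprS; field; exact: x_neq0.
Qed.

Hypothesis alpha_const : forall j r, D j (alpha F r) = 0.
Hypothesis beta_const : forall j r, D j (beta F r) = 0.

Lemma dl_a j i : j != i -> airy_dl j (airy_a i) = 0.
Proof.
move=> ji; rewrite /airy_dl (_ : poly_D_mu j _ = 0) ?mulr0 //; apply/polyP => r.
rewrite coef_poly_D_mu coef0 coef_poly; case: ifP => _; last exact: D_mu0.
by rewrite /D_mu (derM (dD j) (alpha F r)) alpha_const D_exp eq_sym (negPf ji) mul0r mulr0 addr0 mulr0.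
Qed.

Lemma dl_b j i : j != i -> airy_dl j (airy_b i) = 0.
Proof.
move=> ji; rewrite /airy_dl (_ : poly_D_mu j _ = 0) ?mulr0 //; apply/polyP => r.
rewrite coef_poly_D_mu coef0 coef_poly; case: ifP => _; last exact: D_mu0.
rewrite /D_mu (derM (dD j) (beta F r)) (derM (dD j) (lam i)) beta_const (derV (dD j)) D_exp Dx (negPf ji) eq_sym (negPf ji).
by rewrite /= mulr0n !(mul0r, mulr0, oppr0, addr0).
Qed.

Lemma nabla_a j : trunc W (airy_nabla j (airy_a j)) = trunc W (airy_b j).
Proof.
apply/truncP => i iW; rewrite coef_nabla !coef_poly ltnS iW; case: ltnP => i3.
  rewrite addr0; case: i i3 iW => [|i] i3 _; first by rewrite alpha0 beta0 expr0; ring.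
  by rewrite alpha_lt3 ?beta_lt3 // !mul0r mulr0.
rewrite ltnS (leq_trans (leq_subr _ _)) //; case: i i3 iW => [|[|[|r]]] // _ _.
have -> : (r.+3 - 3 = r)%N by lia.
rewrite (derM (dD j) (alpha F r)) alpha_const D_exp eqxx.
have -> : beta F r.+3 = alpha F r.+3 - 8 * (2 * r%:R + 1) * alpha F r by rewrite -alpha_beta_rec // addrC subrK.
by rewrite !exprS; field; rewrite F2 x_neq0.
Qed.

Lemma nabla_b j : trunc W (airy_nabla j (airy_b j)) = trunc W (mu_node j *: airy_a j).
Proof.
apply/truncP => i iW; rewrite coef_nabla coefZ !coef_poly ltnS iW; case: ltnP => i3.
  rewrite addr0; case: i i3 iW => [|i] i3 _; first by rewrite alpha0 beta0 expr0 /mu_node; ring.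
  by rewrite alpha_lt3 ?beta_lt3 // !mul0r !mulr0.
rewrite ltnS (leq_trans (leq_subr _ _)) //; case: i i3 iW => [|[|[|r]]] // _ _.
have -> : (r.+3 - 3 = r)%N by lia.
rewrite (derM (dD j) (beta F r)) (derM (dD j) (lam j)) beta_const (derV (dD j)) D_exp Dx eqxx mulr1n.
have e1 := alpha_beta_rec F0 r; have e2 := beta_alpha F0 r.
have -> : beta F r.+3 = alpha F r.+3 + 8 * ((2 * r%:R - 1) * beta F r).
  by rewrite e2 -[LHS](subrK (alpha F r.+3)) e1; ring.
by rewrite /mu_node !exprS; field; rewrite F2 x_neq0.
Qed.

Lemma mu_node_inj : injective mu_node.
Proof.
move=> i j e; apply/eqP; apply: contraT => /dx/andP[h1 h2].
have : (x i - x j) * (x i + x j) != 0 by rewrite mulf_neq0.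
have e' : x i ^+ 2 = x j ^+ 2 by apply: invr_inj; rewrite -!exprVn.
by rewrite -subr_sqr e' subrr eqxx.
Qed.

Lemma sum_antidiagonal (V : nmodType) m (g : nat -> nat -> V) : (m <= W)%N ->
  \sum_(r < W.+1) \sum_(s < W.+1) (if (r + s == m)%N then g r s else 0) = \sum_(r < m.+1) g r (m - r)%N.
Proof.
move=> mW; rewrite (big_ord_widen W.+1 (fun r => g r (m - r)%N)) // [RHS]big_mkcond; apply: eq_bigr => r _.
rewrite ltnS; case: leqP => rm; last by rewrite big1 // => s _; rewrite ifF //; lia.
have sW : (m - r < W.+1)%N by lia.
rewrite (bigD1 (Ordinal sW)) //= subnKC // eqxx big1 ?addr0 // => s; rewrite -val_eqE /= => h.
by rewrite ifF //; apply/eqP => e; case/eqP: h; lia.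
Qed.

(** Multiplication by 1/x_i + 1/x_j lowers an exponent of x_i or of x_j by one; after realignment
    [coefc_rec] cancels all but the boundary terms. The summand [ratio] supplies the entry at (0,0),
    which [coefc] lacks. On the diagonal both sides vanish by antisymmetry. *)
Lemma trunc_kernel i j :
  trunc W ((ratio x i j)%:A + contraction (miwa_V (W := W) x) (miwa_c F (W := W)) i j)
  = trunc W ((lam i + lam j)^-1 *: (airy_a i * airy_b j - airy_b i * airy_a j)).
Proof.
have [->|ij] := eqVneq i j.
  rewrite /ratio subrr mul0r scale0r add0r [airy_b j * _]mulrC subrr scaler0; congr (trunc W _).
  apply: (mulr2n_eq0 F0); rewrite {1}/contraction exchange_big /= -sumrN; apply: eq_bigr => r _.
  rewrite -sumrN; apply: eq_bigr => s _.
  by rewrite /miwa_c (coefc_anti F0) polyCN; ring.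
have /andP[_ xx] := dx ij; have ll : lam i + lam j != 0.
  have -> : lam i + lam j = (x i + x j) / (x i * x j) by field; rewrite !x_neq0.
  by rewrite mulf_neq0 ?invr_eq0 ?mulf_neq0.
apply/truncP => m mW; apply: (mulfI ll); rewrite coefZ mulrA divff // mul1r coefB !coefM coefD.
have -> : (contraction (miwa_V (W := W) x) (miwa_c F (W := W)) i j)`_m
    = \sum_(r < m.+1) coefc F r (m - r) * x i ^+ r * x j ^+ (m - r).
  rewrite -(sum_antidiagonal (fun r s => coefc F r s * x i ^+ r * x j ^+ s)) // /contraction coef_sum.
  apply: eq_bigr => r _; rewrite coef_sum; apply: eq_bigr => s _; rewrite /miwa_V /miwa_c.
  have -> : (x i ^+ r)%:P * 'X^r * (coefc F r s)%:P * ((x j ^+ s)%:P * 'X^s)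
     = (coefc F r s * x i ^+ r * x j ^+ s)%:P * 'X^(r + s) by rewrite exprD !polyCM; ring.
  by rewrite coefCM coefXn eq_sym; case: eqP => _; rewrite ?mulr1 ?mulr0.
rewrite mulrDr alg_polyC coefC.
(* Monomials with one power of x_i, respectively x_j, removed; the relation Y (r + 1) = Z r is what
   aligns the two sums. *)
pose Y r := x i ^+ r / x i * x j ^+ (m - r).
pose Z r := x i ^+ r * (x j ^+ (m - r) / x j).
have cm r : (r < m.+1)%N -> ((airy_a i)`_r = alpha F r * x i ^+ r) * ((airy_b i)`_r = beta F r * (lam i * x i ^+ r))
   * ((airy_a j)`_(m - r) = alpha F (m - r) * x j ^+ (m - r)) * ((airy_b j)`_(m - r) = beta F (m - r) * (lam j * x j ^+ (m - r))).
  by move=> rm; rewrite !coef_poly !ifT //; lia.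
have -> : \sum_(r < m.+1) (airy_a i)`_r * (airy_b j)`_(m - r) = \sum_(r < m.+1) alpha F r * beta F (m - r) * Z r.
  by apply: eq_bigr => r _; rewrite !(cm r) // /Z; ring.
have -> : \sum_(r < m.+1) (airy_b i)`_r * (airy_a j)`_(m - r) = \sum_(r < m.+1) beta F r * alpha F (m - r) * Y r.
  by apply: eq_bigr => r _; rewrite !(cm r) // /Y; ring.
have -> : (lam i + lam j) * \sum_(r < m.+1) coefc F r (m - r) * x i ^+ r * x j ^+ (m - r)
   = \sum_(r < m.+1) coefc F r (m - r) * Y r + \sum_(r < m.+1) coefc F r (m - r) * Z r.
  by rewrite mulr_sumr -big_split; apply: eq_bigr => r _ /=; rewrite /Y /Z; ring.
have YZ r : (r < m)%N -> Y r.+1 = Z r.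
  move=> rm; rewrite /Y /Z; have -> : (m - r = (m - r.+1).+1)%N by lia.
  by rewrite !exprS; field; rewrite !x_neq0.
rewrite big_ord_recl [X in _ + (_ + X)]big_ord_recr [X in _ = X - _]big_ord_recr [X in _ = _ - X]big_ord_recl /=.
rewrite !subnn !subn0.
have c0 : coefc F 0 m = (m == 0%N)%:R - alpha F m by rewrite (coefc_anti F0) -(coefc_r0 F0); ring.
have cl : coefc F m 0 = alpha F m - (m == 0%N)%:R by rewrite -(coefc_r0 F0) addrK.
rewrite c0 cl beta0.
have -> : \sum_(r < m) coefc F (bump 0 r) (m - bump 0 r) * Y (bump 0 r) = \sum_(r < m) coefc F r.+1 (m - r.+1) * Z r.
  by apply: eq_bigr => r _; rewrite /bump add1n YZ.
have -> : \sum_(r < m) beta F (bump 0 r) * alpha F (m - bump 0 r) * Y (bump 0 r) = \sum_(r < m) beta F r.+1 * alpha F (m - r.+1) * Z r.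
  by apply: eq_bigr => r _; rewrite /bump add1n YZ.
have key : \sum_(r < m) coefc F r.+1 (m - r.+1) * Z r + \sum_(r < m) coefc F r (m - r) * Z r
   = \sum_(r < m) alpha F r * beta F (m - r) * Z r - \sum_(r < m) beta F r.+1 * alpha F (m - r.+1) * Z r.
  rewrite -big_split -sumrB; apply: eq_bigr => r _ /=; rewrite -!mulrDl -mulrBl; congr (_ * _).
  have rm : (m - r = (m - r.+1).+1)%N by have := ltn_ord r; lia.
  by rewrite rm addrC (coefc_rec F0).
have -> : (lam i + lam j) * (if m == 0%N then ratio x i j else 0) = (m == 0%N)%:R * (lam j - lam i).
  by case: eqP => _; rewrite ?mulr0 ?mul0r // mul1r /ratio; field; rewrite xx !x_neq0.
have YZ0 : (m == 0%N)%:R * (Y 0%N - lam i) = 0 by rewrite /Y; case: eqP => [->|_]; rewrite ?mul0r // subnn !expr0; ring.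
have YZm : (m == 0%N)%:R * (Z m - lam j) = 0 by rewrite /Z; case: eqP => [->|_]; rewrite ?mul0r // subnn !expr0; ring.
move: key YZ0 YZm; set s1 := \sum_(r < m) _; set s2 := \sum_(r < m) _; set s3 := \sum_(r < m) _; set s4 := \sum_(r < m) _.
move=> key h1 h2; have -> : s2 = s3 - s4 - s1 by rewrite -key; ring.
apply/eqP; rewrite -subr_eq0; apply/eqP.
transitivity ((m == 0%N)%:R * (Y 0%N - lam i) - (m == 0%N)%:R * (Z m - lam j)); last by rewrite h1 h2 subrr.
ring.
Qed.

Definition miwa_poly : {poly F} :=
  \sum_(X : {set 'I_W.+1} | ~~ odd #|X|) (miwa_term x X)%:P * 'X^(sumn (strict_of X)).

Lemma trunc_miwa_poly :
  trunc W miwa_poly = trunc W (((-1) ^+ 'C(n, 2) * pair_sum (fun i => lam i) setT) *: airy_psi mu_node n airy_a airy_b).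
Proof.
rewrite /miwa_poly (miwa_sum W o F0 dx x_neq0) ?odd_double // (rmorph_npfset _ _ _ trunc_kernel).
have dl i j : i != j -> (lam i - lam j != 0) && (lam i + lam j != 0).
  move=> ij; have /andP[h1 h2] := dx ij; have h3 : x j - x i != 0 by rewrite -oppr_eq0 opprB.
  have -> : lam i - lam j = (x j - x i) / (x i * x j) by field; rewrite !x_neq0.
  have -> : lam i + lam j = (x i + x j) / (x i * x j) by field; rewrite !x_neq0.
  by rewrite !mulf_neq0 ?invr_eq0 ?mulf_neq0.
have rE : (fun i j => ratio x i j) =2 (fun i j => (lam j - lam i) / (lam i + lam j)).
  move=> i j; rewrite /ratio; have [->|ij] := eqVneq i j; first by rewrite !subrr !mul0r.
  have /andP[_ h1] := dx ij; have /andP[_ h2] := dl _ _ ij.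
  have -> : lam i + lam j = (x i + x j) / (x i * x j) by field; rewrite !x_neq0.
  by field; rewrite h1 !x_neq0.
have := npfset_bipartite (A := {poly F}) F0 o airy_a airy_b dl (X := setT) (m := n).
rewrite cardsT card_ord => /(_ erefl).
have -> : bipartite_sum (fun i => lam i) airy_a airy_b setT n = airy_psi mu_node n airy_a airy_b.
  apply: eq_big => [I|I _]; first by rewrite subsetT.
  rewrite setTD /bimono /mono; congr (_ *: _).
  rewrite [RHS](bigID (fun i => i \in I)) /=; congr (_ * _).
    by apply: eq_bigr => i ->.
  by apply: eq_big => [i|i]; rewrite inE // => /negPf ->.
move=> <-.
have vE (l : seq 'I_N) : vdm (ratio x) l = vdm (fun i j => (lam j - lam i) / (lam i + lam j)) l.
  by elim: l => //= i l ->; congr (_ * _); apply: eq_bigr => j _; apply: rE.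
by rewrite /npfset /npf vE.
Qed.

(** This is the coefficient of 'X^(w+6) in the matrix Airy equation, within the truncation as w + 6
    <= W. The terms in T_(w+6) cancel because mu_o = x_o^(-2). Those in T_(w+3) form the first-order
    identity and those in T_w the square, with weights - 16 and 256; a division by 32 x_o^2
    follows. *)
Theorem miwa_pde w : (w + 6 <= W)%N ->
  32 * x o ^+ 2 * virasoro_wave x o D miwa_poly`_w = D o miwa_poly`_(w + 3).
Proof.
move=> wW; set T := miwa_poly.
pose m := 'C(n, 2); pose c := ((-1) ^+ m * pair_sum (fun i => lam i) setT)^-1.
have cP j f := dressed_conj F0 dx x_neq0 dD Dx m j f.
have c0 : c != 0 := (cP o 0).1.
have cE j f : x j ^+ 3 * D j (c * f) + x j ^+ 2 / 2 * (c * f) = c * dressed x D j f := (cP j f).2.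
have psiE : trunc W (airy_psi mu_node n airy_a airy_b) = trunc W (c *: T).
  apply/truncP => i iW; have /truncP/(_ i iW) := trunc_miwa_poly; rewrite -/T !coefZ => ->.
  by rewrite mulrA mulVf ?mul1r // -invr_eq0.
clearbody T.
have cT : #|'I_N| = n.*2 by rewrite card_ord.
have airy := matrix_airy o mu_node_inj cT derivation_D_mu D_mu_node derivation_dl dl_alg dl_w dl_a dl_b trunc_dl nabla_a nabla_b.
pose nab := airy_nabla.
have nabE j p q : trunc W p = trunc W q -> trunc W (nab j p) = trunc W (nab j q).
  by move=> e; rewrite /nab /airy_nabla rmorphD [RHS]rmorphD; congr (_ + _); [exact: trunc_dl | rewrite rmorphM [RHS]rmorphM; congr (_ * _)].
have opE : trunc W (airy_op mu_node o airy_w airy_dl airy_s (c *: T)) = 0.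
  rewrite -airy /airy_op rmorphB rmorphD [RHS]rmorphB [X in _ = X - _]rmorphD.
  have sc k p q : trunc W p = trunc W q -> trunc W (k *: p) = trunc W (k *: q).
    by move=> e; rewrite -[k *: p]mul_polyC -[k *: q]mul_polyC rmorphM [RHS]rmorphM; congr (_ * _).
  congr (_ + _ - _).
  - exact: (nabE o _ _ (nabE o _ _ (esym psiE))).
  - rewrite rmorphM [RHS]rmorphM; congr (_ * _); rewrite rmorph_sum [RHS]rmorph_sum.
    apply: eq_bigr => j _; apply: sc; rewrite rmorphB [RHS]rmorphB.
    by congr (_ - _); [exact: (nabE o _ _ (esym psiE)) | exact: (nabE j _ _ (esym psiE))].
  - by apply: sc; apply: esym.
have nabT j k : (nab j (c *: T))`_(k + 3) = c * (lam j * T`_(k + 3) - 16 * dressed x D j T`_k).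
  rewrite coef_nabla ifF; last by lia.
  by rewrite addnK !coefZ cE; ring.
have nabT2 k : (nab o (nab o (c *: T)))`_(k + 6) =
   c * (lam o * (lam o * T`_(k + 6) - 16 * dressed x D o T`_(k + 3)) - 16 * dressed x D o (lam o * T`_(k + 3) - 16 * dressed x D o T`_k)).
  have -> : (k + 6 = k + 3 + 3)%N by lia.
  rewrite coef_nabla ifF; last by lia.
  by rewrite addnK !nabT cE; ring.
have /truncP/(_ (w + 6)%N wW) : trunc W (airy_op mu_node o airy_w airy_dl airy_s (c *: T)) = trunc W 0 by rewrite opE rmorph0.
have wC p : (airy_w * p)`_(w + 6) = 32 * p`_(w + 3).
  rewrite /airy_w -mulrA coefCM coefXnM ifF; last by lia.
  by have -> : (w + 6 - 3 = w + 3)%N by lia.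
have -> : airy_op mu_node o airy_w airy_dl airy_s (c *: T) = nab o (nab o (c *: T))
  + airy_w * (\sum_(j | j != o) (mu_node o - mu_node j)^-1 *: (nab o (c *: T) - nab j (c *: T))) - mu_node o *: (c *: T) by [].
rewrite coef0 coefB coefD nabT2 wC !coefZ coef_sum.
have -> : \sum_(j | j != o) ((mu_node o - mu_node j)^-1 *: (nab o (c *: T) - nab j (c *: T)))`_(w + 3)
   = c * (T`_(w + 3) * (\sum_(j | j != o) mu_diff x o j * (lam o - lam j)) - 16 * \sum_(j | j != o) mu_diff x o j * (dressed x D o T`_w - dressed x D j T`_w)).
  rewrite !mulr_sumr -sumrB mulr_sumr; apply: eq_bigr => j _.
  rewrite coefZ coefB !nabT /mu_diff /mu_node; ring.
have lin a b : dressed x D o (a - b) = dressed x D o a - dressed x D o b.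
  by rewrite /dressed (derB (dD o)); ring.
have lin16 a : dressed x D o (16 * a) = 16 * dressed x D o a.
  by rewrite /dressed (derM (dD o)) (der_nat (dD o)); ring.
have I1 := dressed_first_order o F0 dx x_neq0 dD Dx T`_(w + 3).
have I2 := dressed_square o F0 dx x_neq0 dD Dx T`_w.
rewrite lin lin16 /mu_node => e.
have {e} : 256 * (4 * x o ^+ 4 * virasoro_wave x o D T`_w) - 16 * (2 * x o ^+ 2 * D o T`_(w + 3)) = 0.
  rewrite -I2 -I1; apply: (mulfI c0); rewrite mulr0 -[RHS]e; ring.
move/eqP; rewrite subr_eq0 => /eqP e.
have nz : 32 * x o ^+ 2 != 0 by rewrite mulf_neq0 ?expf_neq0 //; exact: F0 31%N.
by apply: (mulfI nz); apply: etrans (etrans e _); ring.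
Qed.
End MiwaPDE.

(** * Evaluation of polynomials in the times at power sums *)

Module RationalFunctions.
Import -(notations) mpoly.
Local Open Scope quotient_scope.

Section QuotientRules.
Variables (F : fieldType) (p q p' q' dp dq dp' dq' : F).
Hypotheses (q0 : q != 0) (q'0 : q' != 0).

Lemma add_fractions : p / q + p' / q' = (p * q' + p' * q) / (q * q').
Proof. by field; rewrite q0 q'0. Qed.

Lemma quotient_rule_add :
  ((dp * q' + p * dq' + (dp' * q + p' * dq)) * (q * q') - (p * q' + p' * q) * (dq * q' + q * dq')) / (q * q') ^+ 2
  = (dp * q - p * dq) / q ^+ 2 + (dp' * q' - p' * dq') / q' ^+ 2.
Proof. by field; rewrite q0 q'0. Qed.

Lemma quotient_rule_mul :
  ((dp * p' + p * dp') * (q * q') - p * p' * (dq * q' + q * dq')) / (q * q') ^+ 2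
  = (dp * q - p * dq) / q ^+ 2 * (p' / q') + p / q * ((dp' * q' - p' * dq') / q' ^+ 2).
Proof. by field; rewrite q0 q'0. Qed.
End QuotientRules.

Section FractionDerivation.
Variables (R : idomainType) (d : R -> R).
Hypothesis dd : derivation d.
Local Notation F := {fraction R}.

Lemma fractionP (f : F) : exists p q : R, q != 0 /\ f = tofrac p / tofrac q.
Proof.
elim/quotW: f => r; exists (frac r).1, (frac r).2; split; first exact: denom_ratioP.
have d0 := denom_ratioP r.
have invE : (tofrac (frac r).2)^-1 = \pi_F (Ratio 1 (frac r).2).
  apply: (mulfI (_ : tofrac (frac r).2 != 0)); first by rewrite tofrac_eq0.
  rewrite divff ?tofrac_eq0 //.
  rewrite -[RHS]/(FracField.mul (tofrac (frac r).2) (\pi_F (Ratio 1 (frac r).2))) -[LHS]/(tofrac 1) !piE.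
  apply/eqP; rewrite FracField.equivf_def /= /FracField.equivf /FracField.mulf /= !numden_Ratio ?oner_eq0 ?mul1r ?mulf_neq0 //.
  by rewrite !mulr1.
rewrite invE -[RHS]/(FracField.mul (tofrac (frac r).1) (\pi_F (Ratio 1 (frac r).2))) !piE.
apply/eqP; rewrite FracField.equivf_def /= /FracField.equivf /FracField.mulf /= !numden_Ratio ?oner_eq0 ?mul1r ?mulf_neq0 //.
by rewrite mulr1 mulrC.
Qed.

Lemma fraction_ex (f : F) : exists u : R * R, (u.2 != 0) && (f == tofrac u.1 / tofrac u.2).
Proof. by have [p [q [q0 e]]] := fractionP f; exists (p, q); rewrite q0 e eqxx. Qed.

Local Notation num f := (xchoose (fraction_ex f)).1.
Local Notation den f := (xchoose (fraction_ex f)).2.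

Definition frac_der (f : F) : F :=
  tofrac (d (num f) * den f - num f * d (den f)) / tofrac (den f) ^+ 2.

(** The quotient rule does not depend on the chosen representative: this follows from the
    cross-multiplied equality of two representatives and its derivative. *)
Lemma frac_derE p q : q != 0 -> frac_der (tofrac p / tofrac q) = tofrac (d p * q - p * d q) / tofrac q ^+ 2.
Proof.
move=> q0; set f := tofrac p / tofrac q.
have /andP[h0 /eqP e] := xchooseP (fraction_ex f).
rewrite /frac_der; move: (num f) (den f) h0 e => n m m0 e.
have Fq : tofrac q != 0 by rewrite tofrac_eq0.
have Fm : tofrac m != 0 by rewrite tofrac_eq0.
have pm : p * m = n * q.
  by apply/eqP; rewrite -tofrac_eq !tofracM -(eqr_div _ _ Fq Fm) -/f e.
have dpm : d p * m + p * d m = d n * q + n * d q by rewrite -!(derM dd) pm.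
apply: (mulIf (_ : tofrac (m ^+ 2 * q ^+ 2) != 0)); first by rewrite tofrac_eq0 mulf_neq0 ?expf_neq0.
rewrite {1}tofracM mulrA -tofracXn divfK ?tofrac_eq0 ?expf_neq0 // -tofracM.
have -> : tofrac (m ^+ 2 * q ^+ 2) = tofrac q ^+ 2 * tofrac (m ^+ 2) by rewrite mulrC (tofracM (q ^+ 2)) tofracXn.
rewrite [RHS]mulrA divfK ?expf_neq0 // -[RHS]tofracM.
congr tofrac.
transitivity (q * m * (d n * q + n * d q) - (n * q) * (m * d q + q * d m)); first ring.
rewrite -dpm -pm; ring.
Qed.

Lemma frac_der_tofrac p : frac_der (tofrac p) = tofrac (d p).
Proof.
have := @frac_derE p 1 (oner_neq0 _); rewrite tofrac1 divr1 => ->.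
by rewrite (der1 dd) mulr0 subr0 mulr1 expr1n divr1.
Qed.

Lemma derivation_frac_der : derivation frac_der.
Proof.
split=> f g; have [p [q [q0 ->]]] := fractionP f; have [p' [q' [q'0 ->]]] := fractionP g.
all: have Fq : tofrac q != 0 by rewrite tofrac_eq0.
all: have Fq' : tofrac q' != 0 by rewrite tofrac_eq0.
  rewrite add_fractions // -!tofracM -tofracD !frac_derE ?mulf_neq0 // (derD dd) !(derM dd) !(tofracB, tofracD, tofracM).
  exact: quotient_rule_add.
rewrite mulf_div -!tofracM !frac_derE ?mulf_neq0 // !(derM dd) !(tofracB, tofracD, tofracM).
exact: quotient_rule_mul.
Qed.
End FractionDerivation.

(** Only these properties of the variables are used later. Even x_i != 0 and x_i != +- x_j follow
    from them, by applying D_i. *)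
Lemma rational_functions (K : fieldType) (N : nat) :
  exists (F : fieldType) (iota : {rmorphism K -> F}) (x : 'I_N -> F) (D : 'I_N -> F -> F),
    [/\ forall i, derivation (D i), forall i j, D i (x j) = (i == j)%:R & forall i c, D i (iota c) = 0].
Proof.
pose R : idomainType := mpoly N K; pose F : fieldType := {fraction R}.
have dm i : derivation (mderiv i : R -> R) by split=> p q; [exact: mderivD | exact: mderivM].
pose iota : {rmorphism K -> F} := (@tofrac R \o @mpolyC N K)%FUN.
exists F, iota, (fun i => tofrac (mpolyX K (mnm1 i) : R)), (fun i => frac_der (mderiv i : R -> R)).
split=> [i|i j|i c].
- exact: derivation_frac_der.
- rewrite (frac_der_tofrac (dm i)) mderivX mnm1E eq_sym; case: eqVneq => [->|_].
    have -> : mnm_sub (mnm1 j) (mnm1 j) = @mnm0 N by apply/mnmP => k; rewrite mnmBE subnn mnm0E.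
    by rewrite scale1r mpolyX0 tofrac1.
  by rewrite scale0r tofrac0.
- by rewrite /= (frac_der_tofrac (dm i)) mderivC tofrac0.
Qed.

End RationalFunctions.
Import RationalFunctions.

Section OddIndices.

Lemma odd_idxP (k : oddn) : odd_idx (val k)./2 = k.
Proof. by apply: val_inj; rewrite /= -[RHS]odd_double_half (valP k) add1n. Qed.

Lemma odd_idx_inj : injective odd_idx.
Proof. by move=> i j /(congr1 val) /= [] /double_inj. Qed.

Lemma sum_oddn (V : nmodType) (s : {fset oddn}) (g : oddn -> V) J :
  (forall k, k \in s -> ((val k)./2 < J)%N) ->
  \sum_(k <- s) g k = \sum_(j < J | odd_idx j \in s) g (odd_idx j).
Proof.
move=> sJ; transitivity (\sum_(k <- [seq odd_idx j | j <- iota 0 J & odd_idx j \in s]) g k).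
  apply: perm_big; apply: uniq_perm; rewrite ?fset_uniq ?(map_inj_uniq odd_idx_inj) ?filter_uniq ?iota_uniq //.
  move=> k; apply/idP/mapP => [ks|[j]]; last by rewrite mem_filter => /andP[? _] ->.
  by exists (val k)./2; rewrite ?odd_idxP // mem_filter odd_idxP ks mem_iota /= sJ.
rewrite big_map big_filter -{1}[J]subn0 -/(index_iota 0 J) big_mkord.
by [].
Qed.
End OddIndices.

Lemma sum_fset_pick (V : nmodType) (T : choiceType) (s : {fset T}) (c : T) (e : V) :
  \sum_(a <- s) (if a == c then e else 0) = if c \in s then e else 0.
Proof.
case: ifP => [cs|/negP cs].
  rewrite (big_fsetD1 c cs) /= eqxx big1_seq ?addr0 // => a /andP[_].
  by rewrite in_fsetD1 => /andP[/negPf -> _].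
by rewrite big1_seq // => a /andP[_ aP]; case: eqP => // e'; case: cs; rewrite -e'.
Qed.

(** * Formal derivatives and weights of polynomials in the times *)

Section FormalDerivative.
Variable K : fieldType.
Local Notation A := {malg K[tmonom]}.
Implicit Types (P : A) (a b : tmonom) (k : oddn).

Lemma divcmK a k : a k != 0%N -> mmul (divcm a (ucm k)) (ucm k) = a.
Proof.
move=> ak; apply/eqP/cmP => j; rewrite cmM divcmE ucmE subnK //; case: eqP => [<-|//].
by rewrite lt0n.
Qed.

Lemma mulcmK b k : divcm (mmul b (ucm k)) (ucm k) = b.
Proof. by apply/eqP/cmP => j; rewrite divcmE cmM addnK. Qed.

Lemma mulcm_at b k : mmul b (ucm k) k = (b k).+1.
Proof. by rewrite cmM ucmE eqxx addn1. Qed.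

(** For a monomial without t_k the truncated division is meaningless, but its coefficient is then
    0. *)
Definition dmal k P : A := \sum_(a <- msupp P) << P@_a * (a k)%:R *g divcm a (ucm k) >>.

Lemma coef_dmal k P b : (dmal k P)@_b = (b k).+1%:R * P@_(mmul b (ucm k)).
Proof.
rewrite /dmal raddf_sum; set c := mmul b (ucm k).
have term a : (<< P@_a * (a k)%:R *g divcm a (ucm k) >> : A)@_b = if a == c then (b k).+1%:R * P@_c else 0.
  rewrite mcoeffU; case: (eqVneq a c) => [->|ac]; first by rewrite mulcmK eqxx mulr1n mulrC mulcm_at.
  have [a0|a0] := eqVneq (a k) 0%N; first by rewrite a0 mulr0 mul0rn.
  by case: eqP => // e; rewrite /c -e divcmK ?eqxx in ac.
rewrite (eq_bigr (fun a => if a == c then (b k).+1%:R * P@_c else 0)); last by move=> a _; apply: term.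
rewrite sum_fset_pick; case: ifP => // /negbT/mcoeff_outdom ->.
by rewrite mulr0.
Qed.

Lemma coef_mulU k P b : (<< ucm k >> * P)@_b = if b k == 0%N then 0 else P@_(divcm b (ucm k)).
Proof.
rewrite mcoeffMl msuppU1 big_seq_fset1 mcoeffUU; set c := divcm b (ucm k).
have term a : (1 * P@_a) *+ (mmul (ucm k) a == b) = if (b k != 0%N) && (a == c) then P@_a else 0.
  rewrite mul1r; case: eqP => [eb|e] /=.
    have e : b = mmul a (ucm k) by rewrite -eb; exact: mulcmC.
    by rewrite /c e mulcmK mulcm_at /= eqxx mulr1n.
  case: ifP => // /andP[b0 /eqP ac]; case: e; rewrite ac; apply: etrans (mulcmC _ _) _; exact: divcmK.
rewrite (eq_bigr _ (fun a _ => term a)); case: eqP => b0 /=; first by rewrite big1.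
rewrite (eq_bigr (fun a => if a == c then P@_c else 0)) => [|a _]; last by case: eqP => [->|].
by rewrite sum_fset_pick; case: ifP => // /negbT/mcoeff_outdom ->.
Qed.

Definition homog w P := forall a, P@_a != 0 -> wt a = w.

Lemma wtU k : wt (ucm k) = val k.
Proof. by rewrite /wt mdomU big_seq_fset1 cmUU mul1n. Qed.

Lemma wt_ge a k : (a k * val k <= wt a)%N.
Proof.
rewrite /wt; have [a0|a0] := eqVneq (a k) 0%N; first by rewrite a0.
by rewrite (big_fsetD1 k) /= ?leq_addr // -cmE_neq0.
Qed.

Lemma wt_dmal k P w b : homog w P -> (dmal k P)@_b != 0 -> (wt b + val k = w)%N.
Proof.
move=> hP; rewrite coef_dmal mulf_eq0 negb_or => /andP[_ /hP]; by rewrite wtM wtU.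
Qed.

Lemma wt_mulU k P w b : homog w P -> (<< ucm k >> * P)@_b != 0 -> (wt b = w + val k)%N.
Proof.
move=> hP; rewrite coef_mulU; have [_|b0] := eqVneq (b k) 0%N; first by rewrite eqxx.
by move/hP => <-; rewrite -{1}(divcmK b0) wtM wtU.
Qed.
End FormalDerivative.

(** * Evaluation at power sums and algebraic independence *)

Section Evaluation.
Variables (K F : fieldType) (iota : {rmorphism K -> F}) (N : nat).
Variables (x : 'I_N -> F) (D : 'I_N -> F -> F) (o0 : 'I_N).
Hypothesis F0 : forall n, n.+1%:R != 0 :> F.
Hypothesis dD : forall i, derivation (D i).
Hypothesis Dx : forall i j, D i (x j) = (i == j)%:R.
Hypothesis Diota : forall i c, D i (iota c) = 0.
Local Notation A := {malg K[tmonom]}.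
Implicit Types (P : A) (a b : tmonom) (k : oddn).

Lemma x_neq0 i : x i != 0.
Proof.
apply/eqP => e; have := Dx i i; rewrite e (der0 (dD i)) eqxx mulr1n => /esym/eqP.
by rewrite oner_eq0.
Qed.

Lemma x_distinct i j : i != j -> (x i - x j != 0) && (x i + x j != 0).
Proof.
move=> ij; apply/andP; split; apply/eqP => e; have := congr1 (D i) e.
  by rewrite (derB (dD i)) !Dx eqxx (negPf ij) subr0 (der0 (dD i)) mulr1n => /eqP; rewrite oner_eq0.
by rewrite (derD (dD i)) !Dx eqxx (negPf ij) addr0 (der0 (dD i)) mulr1n => /eqP; rewrite oner_eq0.
Qed.

Definition power_sum k : F := miwa x setT k.

Lemma D_exp i j n : D i (x j ^+ n) = if i == j then n%:R * x i ^+ n.-1 else 0.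
Proof.
elim: n => [|n IH]; first by rewrite expr0 (der1 (dD i)) mul0r if_same.
rewrite exprS (derM (dD i)) IH Dx; case: eqVneq => [->|_] /=; last by rewrite mul0r mulr0 addr0.
case: n {IH} => [|n]; first by rewrite mul0r mulr0 addr0 expr0 mulr1.
by rewrite -[n.+2]add1n natrD /= exprS; ring.
Qed.

Lemma D_power_sum i k : D i (power_sum k) = x i ^+ (val k).-1.
Proof.
rewrite /power_sum /miwa (der_sum (dD i)) (bigD1 i) ?inE //= big1 ?addr0 => [|j /andP[_ ji]].
  have k0 : (val k)%:R != 0 :> F by case: (val k) (valP k) => // n _; apply: F0.
  rewrite (derM (dD i)) D_exp eqxx (derV (dD i)) (der_nat (dD i)) oppr0 mul0r mulr0 addr0.
  by rewrite mulrAC divff ?mul1r.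
rewrite (derM (dD i)) D_exp eq_sym (negPf ji) mul0r add0r (derV (dD i)) (der_nat (dD i)).
by rewrite oppr0 mul0r mulr0.
Qed.

Lemma power_sum_neq0 k : power_sum k != 0.
Proof.
apply: contraTneq (oner_neq0 F) => e; have := D_power_sum o0 k; rewrite e (der0 (dD o0)) => /esym/eqP.
by rewrite expf_eq0 (negPf (x_neq0 o0)) andbF.
Qed.

Definition hmon a : F := \prod_(k <- finsupp a) power_sum k ^+ a k.

Lemma hmonE (s : {fset oddn}) a : (finsupp a `<=` s)%fset -> hmon a = \prod_(k <- s) power_sum k ^+ a k.
Proof.
move=> le; rewrite /hmon (big_fset_incl _ le) // => k _.
by rewrite -cmE_neq0 negbK => /eqP->; rewrite expr0.
Qed.

Fact hmon_mmorphism : mmorphism hmon.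
Proof.
split=> [a b|]; last by rewrite /hmon mdom1 big_seq_fset0.
pose s := (finsupp a `|` finsupp b)%fset.
rewrite (@hmonE s a) ?fsubsetUl // (@hmonE s b) ?fsubsetUr // (@hmonE s (mmul a b)) ?mdomD //.
by rewrite -big_split; apply: eq_bigr => k _; rewrite cmM exprD.
Qed.
HB.instance Definition _ := monalg.isMultiplicative.Build tmonom F hmon hmon_mmorphism.

Definition ev : A -> F := mmap iota hmon.
HB.instance Definition _ := GRing.RMorphism.on ev.

Lemma ev_U c a : ev << c *g a >> = iota c * hmon a.
Proof. exact: mmapU. Qed.

Lemma hmon_U k : hmon (ucm k) = power_sum k.
Proof. by rewrite /hmon mdomU big_seq_fset1 cmUU. Qed.

Lemma ev_t k : ev << ucm k >> = power_sum k.
Proof. by rewrite ev_U rmorph1 mul1r hmon_U. Qed.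

Lemma ev_Z c P : ev (c *: P) = iota c * ev P.
Proof. exact: mmapZ. Qed.

Lemma D_hmon i a : D i (hmon a) = \sum_(k <- finsupp a) (a k)%:R * x i ^+ (val k).-1 * hmon (divcm a (ucm k)).
Proof.
rewrite {1}/hmon (der_prod_log (dD i)) => [|k _]; last by rewrite expf_neq0 ?power_sum_neq0.
rewrite -/(hmon a) mulr_sumr; apply: eq_big_seq => k ka.
have ak : a k != 0%N by rewrite cmE_neq0.
have -> : hmon a = power_sum k * hmon (divcm a (ucm k)).
  by rewrite -{1}(divcmK ak) (hmon_mmorphism.1 _ _) hmon_U mulrC.
have p0 := power_sum_neq0 k.
have -> : D i (power_sum k ^+ a k) = (a k)%:R * power_sum k ^+ (a k).-1 * x i ^+ (val k).-1.
  elim: (a k) => [|n IH]; first by rewrite expr0 (der1 (dD i)) !mul0r.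
  rewrite exprS (derM (dD i)) IH D_power_sum /=; case: n {IH} => [|n]; first by rewrite !mul0r mulr0 addr0 expr0 !mulr1 mul1r.
  by rewrite -[n.+2]add1n natrD /= exprS; ring.
case: (a k) ak => // n _; rewrite /= exprS; field.
by rewrite p0 expf_neq0.
Qed.

(** The chain rule, with D_i of the power sum p_k/k equal to x_i^(k-1), which is x_i^(2j) for k = 2j
    + 1. *)
Lemma D_ev i P J : (forall a, a \in msupp P -> (wt a < J.*2)%N) ->
  D i (ev P) = \sum_(j < J) x i ^+ j.*2 * ev (dmal (odd_idx j) P).
Proof.
move=> hJ; rewrite {1}/ev mmapE (der_sum (dD i)).
rewrite (eq_bigr (fun j : 'I_J => \sum_(a <- msupp P) x i ^+ j.*2 * (iota (P@_a * (a (odd_idx j))%:R) * hmon (divcm a (ucm (odd_idx j)))))); last first.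
  by move=> j _; rewrite /dmal raddf_sum mulr_sumr; apply: eq_bigr => a _; congr (_ * _); exact: ev_U.
rewrite exchange_big /=; apply: eq_big_seq => a aP.
rewrite (derM (dD i)) Diota mul0r add0r D_hmon (@sum_oddn _ _ _ J) => [|k ka]; last first.
  have ak : (0 < a k)%N by rewrite lt0n cmE_neq0.
  have := leq_trans (leq_pmull (val k) ak) (wt_ge a k); have := hJ a aP.
  by have := odd_double_half (val k); rewrite (valP k); lia.
rewrite mulr_sumr big_mkcond; apply: eq_bigr => j _ /=; rewrite -cmE_neq0.
case: eqP => [->|_] /=; first by rewrite mulr0 rmorph0 mul0r mulr0.
by rewrite rmorphM rmorph_nat; ring.
Qed.

(** A polynomial with at most N coefficients vanishes if it has the N distinct roots x_i^2. *)
Lemma square_vandermonde J (c : nat -> F) : (J <= N)%N ->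
  (forall i, \sum_(j < J) (x i ^+ 2) ^+ j * c j = 0) -> forall j, (j < J)%N -> c j = 0.
Proof.
move=> JN h j jJ; pose p := \poly_(j < J) c j.
suff p0 : p = 0 by have := coef_poly J c j; rewrite -/p p0 coef0 jJ.
apply: (@roots_geq_poly_eq0 _ p [seq x i ^+ 2 | i : 'I_N]).
- apply/allP => _ /mapP[i _ ->]; rewrite /root horner_poly; apply/eqP; rewrite -[RHS](h i).
  by apply: eq_bigr => q _; rewrite mulrC.
- rewrite map_inj_uniq ?enum_uniq // => i q e; apply/eqP; apply: contraT => /x_distinct/andP[h1 h2].
  have : (x i - x q) * (x i + x q) != 0 by rewrite mulf_neq0.
  by rewrite -subr_sqr e subrr eqxx.
- by rewrite size_map size_enum_ord (leq_trans (size_poly _ _)).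
Qed.

Hypothesis iota_inj : injective iota.

(** Induction on the weight. Applying all D_i to [ev P = 0] and separating the powers of x_i^2 shows
    that every partial derivative of P evaluates to 0. These have smaller weight, hence vanish, so P
    is a constant, and [iota] is injective. *)
Lemma ev_inj w P : homog w P -> (w./2 < N)%N -> ev P = 0 -> P = 0.
Proof.
have [n] := ubnP w; elim: n w P => // n IH w P; rewrite ltnS => wn hP wN eP.
have K0 m : m.+1%:R != 0 :> K.
  by apply: contraNneq (F0 m) => e; rewrite -(rmorph_nat iota) e rmorph0.
have dP j : (j < w./2.+1)%N -> ev (dmal (odd_idx j) P) = 0.
  apply: (square_vandermonde (c := fun j => ev (dmal (odd_idx j) P))) => // i.
  rewrite (eq_bigr (fun j : 'I_(w./2.+1) => x i ^+ j.*2 * ev (dmal (odd_idx j) P))) => [|q _].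
    rewrite -D_ev ?eP ?(der0 (dD i)) // => a; rewrite -mcoeff_neq0 => /hP ->; lia.
  by rewrite -exprM mul2n.
have P0 a : a != mone -> P@_a = 0.
  move=> a1; have [k ak] : exists k, a k != 0%N.
    have : finsupp a != fset0 by apply: contraNneq a1 => e; apply/eqP/eqP/cmP => k; rewrite cm1; apply/eqP; rewrite cmE_eq0 e.
    by case/fset0Pn => k; exists k; rewrite cmE_neq0.
  apply/eqP; apply: contraT => Pa; have wa := hP a Pa.
  have kw : (val k <= w)%N by rewrite -wa (leq_trans _ (wt_ge a k)) // leq_pmull // lt0n.
  have k0 : (0 < val k)%N by case: (val k) (valP k).
  have d0 : dmal k P = 0.
    apply: (IH (w - val k)%N); try lia.
      by move=> b /(wt_dmal hP) <-; rewrite addnK.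
    by rewrite -(odd_idxP k); apply: dP; rewrite ltnS half_leq.
  have := coef_dmal k P (divcm a (ucm k)); rewrite d0 mcoeff0 divcmK // => /esym/eqP.
  by rewrite mulf_eq0 (negPf (K0 _)) (negPf Pa).
have PC : P = << P@_mone *g mone >>.
  apply/malgP => a; rewrite mcoeffU; case: eqVneq => [<-|a1]; first by rewrite mulr1n.
  by rewrite mulr0n P0 // eq_sym.
move: eP; rewrite PC ev_U mmorph1 mulr1 -[RHS](rmorph0 iota) => /iota_inj ->.
by rewrite monalgU0.
Qed.
End Evaluation.

(** * The Virasoro operators on homogeneous components *)

Section Virasoro.
Variable K : fieldType.
Local Notation A := {malg K[tmonom]}.
Implicit Types (P : A) (a b : tmonom).
Local Notation d j := (dmal (odd_idx j)).
Local Notation t j := (<< ucm (odd_idx j) >> : A).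

(* The graded component of L_(M-1): [P] and [P'] are the homogeneous parts of tau, of
   weights w and w + 3 and stripped of their powers of hbar / 16; the bound [J] makes
   the sums finite. *)
Definition virasoro J M P P' : A :=
  4^-1 *: (\sum_(k < J) \sum_(l < J) (if (k + l + 2 == M)%N then d l (d k P) else 0))
  + 2^-1 *: (\sum_(k < J) \sum_(i < J.+1) (if (k.+1 == i + M)%N then (i.*2.+1)%:R *: (t i * d k P) else 0))
  + (if M == 0%N then 4^-1 *: (t 0 * (t 0 * P)) else 0)
  + (if M == 1%N then 16^-1 *: P else 0)
  - 32^-1 *: d M P'.

Lemma homogD w P P' : homog w P -> homog w P' -> homog w (P + P').
Proof.
move=> h h' a; rewrite mcoeffD; have [->|/h//] := eqVneq P@_a 0.
by rewrite add0r => /h'.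
Qed.

Lemma homogZ w c P : homog w P -> homog w (c *: P).
Proof. by move=> h a; rewrite mcoeffZ mulf_eq0 negb_or => /andP[_ /h]. Qed.

Lemma homog0 w : homog w (0 : A).
Proof. by move=> a; rewrite mcoeff0 eqxx. Qed.

Lemma homog_sum w I (r : seq I) (Q : pred I) (f : I -> A) :
  (forall i, Q i -> homog w (f i)) -> homog w (\sum_(i <- r | Q i) f i).
Proof. by move=> h; apply: big_ind => //; [exact: homog0 | exact: homogD]. Qed.

Lemma homog_virasoro J M P P' w : homog w P -> homog (w + 3) P' -> homog (w + 2 - M.*2) (virasoro J M P P').
Proof.
(* The weight condition is stated additively, so that the truncated subtraction of the conclusion is
   needed only once. *)
move=> hP hP'; pose H (Q : A) := forall b, Q@_b != 0 -> (wt b + M.*2 = w + 2)%N.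
suff h : H (virasoro J M P P') by move=> b /h <-; rewrite addnK.
have H0 : H 0 by move=> b; rewrite mcoeff0 eqxx.
have HD Q Q' : H Q -> H Q' -> H (Q + Q').
  move=> h h' b; rewrite mcoeffD; have [->|/h//] := eqVneq Q@_b 0.
  by rewrite add0r => /h'.
have HZ c Q : H Q -> H (c *: Q) by move=> h b; rewrite mcoeffZ mulf_eq0 negb_or => /andP[_ /h].
have hd k : forall b, (d k P)@_b != 0 -> (wt b + k.*2.+1 = w)%N by move=> b /(wt_dmal hP).
have hd' k : homog (w - k.*2.+1) (d k P) by move=> b /hd <-; rewrite addnK.
apply: (HD); last first.
  rewrite -scaleNr; apply: (HZ) => b /(wt_dmal hP') /=; lia.
apply: (HD); last first.
  case: eqP => // M1; apply: (HZ) => b /hP; lia.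
apply: (HD); last first.
  case: eqP => // M0; apply: (HZ) => b.
  have h1 : homog (w + 1) (t 0 * P) by move=> b' /(wt_mulU hP).
  by move=> /(wt_mulU h1) /=; lia.
apply: (HD); apply: (HZ); apply: big_ind => // k _; apply: big_ind => // l _; case: eqP => // e.
  move=> b hb; have /(wt_dmal (hd' k)) /= h1 := hb; move: hb; rewrite coef_dmal mulf_eq0 negb_or => /andP[_ /hd].
  by rewrite wtM wtU /=; lia.
apply: (HZ) => b; rewrite coef_mulU; have [_|b0] := eqVneq (b _) 0%N; first by rewrite eqxx.
by move=> /hd; have := wtM (divcm b (ucm (odd_idx l))) (ucm (odd_idx l)); rewrite divcmK // wtU /=; lia.
Qed.

Section Evaluated.
Variables (F : fieldType) (iota : {rmorphism K -> F}) (N : nat).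
Variables (x : 'I_N -> F) (D : 'I_N -> F -> F) (o : 'I_N).
Hypothesis F0 : forall n, n.+1%:R != 0 :> F.
Hypothesis dD : forall i, derivation (D i).
Hypothesis Dx : forall i j, D i (x j) = (i == j)%:R.
Hypothesis Diota : forall i c, D i (iota c) = 0.
Local Notation ev := (ev iota x).
Local Notation p i := (power_sum x (odd_idx i)).

Let F2 : 2 != 0 :> F. Proof. exact: F0 1%N. Qed.
Let F4 : 4 != 0 :> F. Proof. exact: F0 3%N. Qed.

Let evD P Q : ev (P + Q) = ev P + ev Q. Proof. exact: rmorphD. Qed.
Let evB P Q : ev (P - Q) = ev P - ev Q. Proof. exact: rmorphB. Qed.
Let evM P Q : ev (P * Q) = ev P * ev Q. Proof. exact: rmorphM. Qed.
Let ev0 : ev 0 = 0. Proof. exact: rmorph0. Qed.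
Let ev_sum n (f : 'I_n -> A) : ev (\sum_(i < n) f i) = \sum_(i < n) ev (f i).
Proof. exact: rmorph_sum. Qed.

Lemma power_sumE i : i.*2.+1%:R * p i = \sum_j x j ^+ i.*2.+1.
Proof.
rewrite /power_sum /miwa mulr_sumr; apply: eq_big => [j|j _]; first by rewrite inE.
by rewrite /= mulrCA divff ?mulr1 // F0.
Qed.

Lemma sum_pick J' c (y e : F) : (c < J')%N -> \sum_(M < J') y ^+ M * (if c == M then e else 0) = y ^+ c * e.
Proof.
move=> cJ; rewrite (bigD1 (Ordinal cJ)) //= eqxx big1 ?addr0 // => M; rewrite -val_eqE /= eq_sym => /negPf ->.
by rewrite mulr0.
Qed.

(** The generating function in y = x_o^2 of the operators. By the chain rule, D_o brings y^k with
    the derivative in t_(2k+1), so second derivatives arise from [euler] applied twice. The products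
    of times with derivatives arise from the interaction terms with the other variables. *)
Lemma ev_virasoro J w P P' : homog w P -> homog (w + 3) P' -> (0 < J)%N -> (w + 3 < J.*2)%N ->
  x o ^+ 2 * virasoro_wave x o D (ev P) - 32^-1 * D o (ev P')
  = \sum_(M < J.*2.+1) (x o ^+ 2) ^+ M * ev (virasoro J M P P').
Proof.
move=> hP hP' J0 wJ; set y := x o ^+ 2.
have dx := x_distinct dD Dx; have x0 := x_neq0 dD Dx.
pose E k := ev (d k P); pose E2 k l := ev (d l (d k P)).
have hd k : homog (w - k.*2.+1) (d k P) by move=> b /(wt_dmal hP) /= <-; rewrite addnK.
have h1 i : D i (ev P) = \sum_(k < J) x i ^+ k.*2 * E k.
  by apply: (D_ev o) => // a; rewrite -mcoeff_neq0 => /hP ->; lia.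
have h2 k : D o (E k) = \sum_(l < J) x o ^+ l.*2 * E2 k l.
  by apply: (D_ev o) => // a; rewrite -mcoeff_neq0 => /hd ->; lia.
have h3 : D o (ev P') = \sum_(M < J.*2.+1) y ^+ M * ev (d M P').
  rewrite (@D_ev _ _ _ _ _ _ o F0 dD Dx Diota o P' J.*2.+1) => [|a]; last by rewrite -mcoeff_neq0 => /hP' ->; lia.
  by apply: eq_bigr => M _; rewrite -exprM mul2n.
have iotaV n : iota (n.+1%:R^-1) = n.+1%:R^-1 by rewrite fmorphV rmorph_nat.
have rhs : \sum_(M < J.*2.+1) y ^+ M * ev (virasoro J M P P') =
   4^-1 * (\sum_(k < J) \sum_(l < J) y ^+ (k + l + 2) * E2 k l)
   + 2^-1 * (\sum_(k < J) \sum_(i < k.+2) y ^+ (k.+1 - i) * (i.*2.+1%:R * p i * E k))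
   + 4^-1 * (p 0 * (p 0 * ev P)) + y * (16^-1 * ev P) - 32^-1 * D o (ev P').
  have evV M : ev (virasoro J M P P') = 4^-1 * (\sum_(k < J) \sum_(l < J) (if (k + l + 2 == M)%N then E2 k l else 0))
    + 2^-1 * (\sum_(k < J) \sum_(i < J.+1) (if (k.+1 == i + M)%N then i.*2.+1%:R * p i * E k else 0))
    + (if M == 0%N then 4^-1 * (p 0 * (p 0 * ev P)) else 0) + (if M == 1%N then 16^-1 * ev P else 0) - 32^-1 * ev (d M P').
    have evZ c Q : ev (c *: Q) = iota c * ev Q by exact: ev_Z.
    have evif (b : bool) Q q : ev Q = q -> ev (if b then Q else 0) = if b then q else 0.
      by move=> e; case: b.
    apply: etrans (evB _ _) _; congr (_ - _); last by apply: etrans (evZ _ _) _; congr (_ * _); exact: iotaV.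
    apply: etrans (evD _ _) _; congr (_ + _); last first.
      by apply: evif; apply: etrans (evZ _ _) _; congr (_ * _); exact: iotaV.
    apply: etrans (evD _ _) _; congr (_ + _); last first.
      apply: evif; apply: etrans (evZ _ _) _; congr (_ * _); first exact: iotaV.
      apply: etrans (evM _ _) _; congr (_ * _); first exact: ev_t.
      apply: etrans (evM _ _) _; congr (_ * _); exact: ev_t.
    apply: etrans (evD _ _) _; congr (_ + _).
      apply: etrans (evZ _ _) _; congr (_ * _); first exact: iotaV.
      apply: etrans (ev_sum _) _; apply: eq_bigr => k _; apply: etrans (ev_sum _) _; apply: eq_bigr => l _.
      exact: evif.
    apply: etrans (evZ _ _) _; congr (_ * _); first exact: iotaV.
    apply: etrans (ev_sum _) _; apply: eq_bigr => k _; apply: etrans (ev_sum _) _; apply: eq_bigr => l _.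
    apply: evif; apply: etrans (evZ _ _) _; rewrite -mulrA; congr (_ * _); first exact: rmorph_nat.
    apply: etrans (evM _ _) _; congr (_ * _); exact: ev_t.
  rewrite (eq_bigr (fun M : 'I_J.*2.+1 =>
     4^-1 * (\sum_(k < J) \sum_(l < J) y ^+ M * (if (k + l + 2 == M)%N then E2 k l else 0))
    + 2^-1 * (\sum_(k < J) \sum_(i < J.+1) y ^+ M * (if (k.+1 == i + M)%N then i.*2.+1%:R * p i * E k else 0))
    + y ^+ M * (if 0%N == M then 4^-1 * (p 0 * (p 0 * ev P)) else 0) + y ^+ M * (if 1%N == M then 16^-1 * ev P else 0)
    - 32^-1 * (y ^+ M * ev (d M P')))); last first.
    move=> M _; rewrite evV (eq_sym (M : nat) 0%N) (eq_sym (M : nat) 1%N).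
    have dist (S : nat -> nat -> F) n : \sum_(k < J) \sum_(l < n) y ^+ M * S k l = y ^+ M * \sum_(k < J) \sum_(l < n) S k l.
      by rewrite mulr_sumr; apply: eq_bigr => k _; rewrite mulr_sumr.
    rewrite (dist (fun k l => if (k + l + 2 == M)%N then E2 k l else 0)).
    rewrite (dist (fun k i => if (k.+1 == i + M)%N then i.*2.+1%:R * p i * E k else 0)).
    ring.
  rewrite sumrB !big_split /= -!mulr_sumr !sum_pick //; last by lia.
  rewrite expr0 mul1r expr1 h3; congr (_ * _ + _ * _ + _ + _ - _).
    rewrite exchange_big; apply: eq_bigr => k _; rewrite exchange_big; apply: eq_bigr => l _.
    by apply: sum_pick; have := ltn_ord k; have := ltn_ord l; lia.
  rewrite exchange_big; apply: eq_bigr => k _; rewrite exchange_big /=.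
  rewrite (big_ord_widen J.+1 (fun i => y ^+ (k.+1 - i) * (i.*2.+1%:R * p i * E k))); last by rewrite ltnS.
  rewrite [RHS]big_mkcond; apply: eq_bigr => i _; case: ltnP => ik.
    have kJ : (k.+1 - i < J.*2.+1)%N by have := ltn_ord k; lia.
    apply: etrans (sum_pick y (i.*2.+1%:R * p i * E k) kJ).
    have ik' : (i <= k.+1)%N by rewrite -ltnS.
    by apply: eq_bigr => M _; rewrite -{1}(subnKC ik') eqn_add2l.
  rewrite big1 // => M _; rewrite (_ : (k.+1 == i + M)%N = false) ?mulr0 //.
  by apply: ltn_eqF; apply: leq_trans ik (leq_addr _ _).
rewrite rhs; congr (_ - _); rewrite {rhs h3 hP' P'}.
set e := ev P in h1 *; clearbody e E E2; clear iotaV hd hP.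
pose S := \sum_(k < J) x o ^+ k.*2 * E k.
have eP : euler x D o (e) = x o * S by rewrite /euler h1.
have exp2 i k : x i ^+ k.*2 = (x i ^+ 2) ^+ k by rewrite -exprM mul2n.
have eeP : euler x D o (euler x D o (e)) = x o * S + x o * \sum_(k < J) ((2 * k%:R) * y ^+ k * E k + x o * \sum_(l < J) y ^+ (k + l) * E2 k l).
  rewrite eP /euler (derM (dD o)) Dx eqxx mulr1n mul1r mulrDr; congr (_ + _ * _).
  rewrite /S (der_sum (dD o)) mulr_sumr; apply: eq_bigr => k _; rewrite (derM (dD o)) (D_exp dD Dx) eqxx h2 mulrDr; congr (_ + _).
    rewrite !mulrA -exp2 -[k.*2%:R]/(k.*2%:R) -mul2n natrM; case: (val k) => [|k']; first by rewrite !mulr0 !mul0r.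
    by rewrite (_ : (2 * k'.+1)%N = k'.*2.+2) ?mul2n // /= !exprS; ring.
  congr (_ * _); rewrite mulr_sumr; apply: eq_bigr => l _.
  by rewrite mulrA !exp2 -exprD.
(* For each j the quotient is a divided difference of powers of x_o^2 and x_j^2, hence a geometric
   sum. Summing over j != o gives power sums without their term at o; the k + 2 missing terms are
   all equal to x_o y^(k+1). *)
have cross : y * \sum_(j | j != o) (x o * x j * euler x D o (e) - x j ^+ 4 / x o ^+ 2 * euler x D j (e)) / (x o ^+ 2 - x j ^+ 2)
   = \sum_(k < J) ((\sum_(i < k.+2) y ^+ (k.+1 - i) * (i.*2.+1%:R * p i)) - k.+2%:R * (x o * y ^+ k.+1)) * E k.
  have termj j : j != o -> y * ((x o * x j * euler x D o (e) - x j ^+ 4 / x o ^+ 2 * euler x D j (e)) / (x o ^+ 2 - x j ^+ 2))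
     = \sum_(k < J) (\sum_(i < k.+2) y ^+ (k.+1 - i) * x j ^+ i.*2.+1) * E k.
    move=> jo; have oj : o != j by rewrite eq_sym.
    have xx : x o ^+ 2 - x j ^+ 2 != 0 by rewrite subr_sqr; have /andP[g1 g2] := dx o j oj; rewrite mulf_neq0.
    have -> : euler x D j (e) = \sum_(k < J) x j * (x j ^+ k.*2 * E k) by rewrite /euler h1 mulr_sumr.
    have -> : euler x D o (e) = \sum_(k < J) x o * (x o ^+ k.*2 * E k) by rewrite /euler h1 mulr_sumr.
    rewrite !mulr_sumr -sumrB mulr_suml mulr_sumr; apply: eq_bigr => k _.
    have -> : \sum_(i < k.+2) y ^+ (k.+1 - i) * x j ^+ i.*2.+1 = x j * ((y ^+ k.+2 - (x j ^+ 2) ^+ k.+2) / (y - x j ^+ 2)).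
      rewrite subrXX mulrAC divff // mul1r mulr_sumr; apply: eq_bigr => i _.
      by rewrite exprS exp2; ring.
    by rewrite /y !exp2 !exprS; field; rewrite xx x0.
  rewrite mulr_sumr (eq_bigr _ termj) exchange_big; apply: eq_bigr => k _; rewrite -mulr_suml; congr (_ * _).
  rewrite exchange_big /= (eq_bigr (fun i : 'I_k.+2 => y ^+ (k.+1 - i) * (i.*2.+1%:R * p i) - x o * y ^+ k.+1)) => [|i _].
    by rewrite sumrB sumr_const card_ord; congr (_ - _); rewrite mulr_natl.
  have -> : x o * y ^+ k.+1 = y ^+ (k.+1 - i) * x o ^+ i.*2.+1.
    have ik : (i <= k.+1)%N by rewrite -ltnS.
    by rewrite [x o ^+ i.*2.+1]exprS exp2 -/y -{1}(subnK ik) exprD; ring.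
  by rewrite -mulr_sumr power_sumE [in RHS](bigD1 o) //= mulrDr [RHS]addrC addKr.
have p0E : \sum_i x i = p 0 by rewrite -[RHS]mul1r (power_sumE 0); apply: eq_bigr.
move: cross; rewrite /virasoro_wave; set V := \sum_(j | j != o) _ => cross.
rewrite eeP eP p0E.
set S2 := \sum_(k < J) (_ + _).
transitivity (4^-1 * y * (x o * S + x o * S2) + 3 / 4 * y * x o * S + 4^-1 * (p 0 * (p 0 * e)) + y * (16^-1 * e) + 2^-1 * (y * V)).
  have F16 : 16 != 0 :> F := F0 15%N.
  move: S S2 V (p 0) (e) (x0 o) {h1 cross eP eeP} => S' S2' V' p' e' xo.
  by rewrite /y; field; rewrite F2 F4 F16 xo.
rewrite {}/S2 cross.
have -> : \sum_(k < J) \sum_(l < J) y ^+ (k + l + 2) * E2 k l = y ^+ 2 * \sum_(k < J) \sum_(l < J) y ^+ (k + l) * E2 k l.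
  rewrite mulr_sumr; apply: eq_bigr => k _; rewrite mulr_sumr; apply: eq_bigr => l _; by rewrite exprD; ring.
have -> : \sum_(k < J) \sum_(i < k.+2) y ^+ (k.+1 - i) * (i.*2.+1%:R * p i * E k)
   = \sum_(k < J) (\sum_(i < k.+2) y ^+ (k.+1 - i) * (i.*2.+1%:R * p i)) * E k.
  by apply: eq_bigr => k _; rewrite mulr_suml; apply: eq_bigr => i _; rewrite mulrA.
have SE : S = \sum_(k < J) y ^+ k * E k by apply: eq_bigr => k _; rewrite exp2.
rewrite big_split /= -mulr_sumr.
have -> : \sum_(k < J) (\sum_(i < k.+2) y ^+ (k.+1 - i) * (i.*2.+1%:R * p i) - k.+2%:R * (x o * y ^+ k.+1)) * E k
   = \sum_(k < J) (\sum_(i < k.+2) y ^+ (k.+1 - i) * (i.*2.+1%:R * p i)) * E k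
     - x o * y * (2 * S + \sum_(k < J) k%:R * y ^+ k * E k).
  rewrite SE mulr_sumr -big_split mulr_sumr -sumrB; apply: eq_bigr => k _ /=.
  by rewrite mulrBl -[k.+2]addn2 natrD exprS; ring.
have -> : \sum_(k < J) 2 * k%:R * y ^+ k * E k = 2 * \sum_(k < J) k%:R * y ^+ k * E k.
  by rewrite mulr_sumr; apply: eq_bigr => k _; rewrite !mulrA.
set q1 := \sum_(k < J) \sum_(l < J) _; set q2 := \sum_(k < J) k%:R * _ * _.
set q3 := \sum_(k < J) _ * E k.
clearbody q1 q2 q3 S.
have F16 : 16 != 0 :> F := F0 15%N.
by rewrite /y; field; rewrite F2 F4 F16.
Qed.

End Evaluated.

Theorem virasoro_eq0 (F : fieldType) (iota : {rmorphism K -> F}) (N : nat) (x : 'I_N -> F) (D : 'I_N -> F -> F) (o : 'I_N)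
    J w P P' M :
  (forall n, n.+1%:R != 0 :> F) -> (forall i, derivation (D i)) -> (forall i j, D i (x j) = (i == j)%:R) ->
  (forall i c, D i (iota c) = 0) ->
  homog w P -> homog (w + 3) P' -> (w + 3 < J.*2)%N -> (J.*2.+1 <= N)%N ->
  (forall i, 32 * x i ^+ 2 * virasoro_wave x i D (ev iota x P) = D i (ev iota x P')) ->
  (M < J.*2.+1)%N -> virasoro J M P P' = 0.
Proof.
move=> F0 dD Dx Diota hP hP' wJ JN pde MJ.
apply: (ev_inj o F0 dD Dx Diota (fmorph_inj iota) (homog_virasoro hP hP')); first by lia.
have V := @square_vandermonde _ _ x D dD Dx (J.*2.+1) (fun M => ev iota x (virasoro J M P P')) JN.
apply: V => // i.
rewrite -(ev_virasoro i F0 dD Dx Diota hP hP') //; last by lia.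
have F32 : 32 != 0 :> F := F0 31%N.
by rewrite -pde; field.
Qed.
End Virasoro.

(* From the homogeneous parts of tau to the formal series *)
From mathcomp Require Import boolp classical_sets fsbigop.

Lemma Khbar_char0 n : n.+1%:R != 0 :> Khbar.
Proof. by rewrite -(rmorph_nat (@tofrac _)) tofrac_eq0 -polyC_natr polyC_eq0 Num.Theory.pnatr_eq0. Qed.

Lemma hbar_neq0 : hbar != 0.
Proof. by rewrite tofrac_eq0 polyX_eq0. Qed.

Definition tau_factor (l : seq nat) : Khbar :=
  2 ^- size l * (Q_val delta1 l * Q_val delta3 (map double l) / Q_val delta1 (map double l)).

(** [W] bounds the parts, so all strict partitions of w are present as soon as w <= W. *)
Definition tau_part W w : {malg Khbar[tmonom]} :=
  \sum_(X : {set 'I_W.+1} | ~~ odd #|X| && (sumn (strict_of X) == w)) tau_factor (strict_of X) *: Q_poly (strict_of X).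

Lemma homog_tau_part W w : homog w (tau_part W w).
Proof.
apply: homog_sum => X /andP[_ /eqP <-]; apply: homogZ => a; exact: Q_poly_homog.
Qed.

Lemma tau_part_eq0 W w : ~~ (3 %| w)%N -> tau_part W w = 0.
Proof.
move=> w3; rewrite /tau_part big1 // => X /andP[_ /eqP e].
by rewrite /tau_factor Q_delta3_eq0 ?e // mulr0 mul0r mulr0 scale0r.
Qed.

(** By homogeneity only partitions of [wt b] contribute at [b]. Their parts are at most [wt b],
    hence at most [W], so they all come from subsets of {0, ..., W}. *)
Lemma tau_MME W b : (wt b <= W)%N ->
  tau_MM b = (hbar / 16) ^+ (wt b %/ 3) * (tau_part W (wt b))@_b.
Proof.
move=> bW; pose s := filter (fun X : {set 'I_W.+1} => ~~ odd #|X|) (index_enum {set 'I_W.+1}).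
have us : uniq [seq strict_of X | X <- s].
  rewrite map_inj_in_uniq ?filter_uniq ?index_enum_uniq // => X Y.
  by rewrite !mem_filter => /andP[eX _] /andP[eY _]; apply: strict_of_inj.
rewrite /tau_MM (fsbigE _ _ us); first last.
- move=> l sl lr; apply/eqP; apply: contraT; rewrite mulf_eq0 negb_or => /andP[_ /Q_poly_homog wl].
  have [X eX Xl] : exists2 X : {set 'I_W.+1}, ~~ odd #|X| & strict_of X = l.
    apply: strict_of_surj => // k kl; apply: leq_trans bW; rewrite wl.
    by rewrite (perm_sumn (perm_to_rem kl)) leq_addr.
  case/negP: lr; apply/mapP; exists X => //; by rewrite mem_filter eX mem_index_enum.
- move=> l /= /mapP[X _ ->]; exact: strict_strict_of.
rewrite big_map big_filter_cond /tau_part raddf_sum mulr_sumr /= big_mkcond [RHS]big_mkcond.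
apply: eq_bigr => X _; rewrite mcoeffZ.
have -> : strict_of X \in DP by apply/mem_set; apply: strict_strict_of.
rewrite andbT; case: (boolP (odd #|X|)) => //= _; case: eqP => [e|ne].
  by rewrite /tau_coef /tau_factor e -!mulrA.
have [->|/Q_poly_homog e] := eqVneq (Q_poly (strict_of X))@_b 0; first by rewrite mulr0.
by case: ne.
Qed.

Lemma ev_Q (K F : fieldType) N (x : 'I_N -> F) (K0 : forall n, n.+1%:R != 0 :> K) (iota : {rmorphism K -> F}) l :
  ev iota x (Q (fun k => << ucm k >> : {malg K[tmonom]}) l) = Q (miwa x [set: 'I_N]%SET : _ -> F^o) l.
Proof.
have F0 n : n.+1%:R != 0 :> F by rewrite -(rmorph_nat iota) fmorph_eq0.
pose phi : {rmorphism {malg K[tmonom]} -> F^o} := GRing.RMorphism.clone _ _ (ev iota x) _.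
have e : phi \o (fun k => << ucm k >>) = miwa x [set: 'I_N]%SET.
  by apply: funext => k; apply: (ev_t iota x k).
by apply: etrans (rmorph_Q phi F0 K0 _ l) _; rewrite e.
Qed.

Section MiwaEvaluation.
Variables (F : fieldType) (iota : {rmorphism Khbar -> F}) (N : nat).
Variables (x : 'I_N -> F).

Let F0 n : n.+1%:R != 0 :> F.
Proof. by rewrite -(rmorph_nat iota) fmorph_eq0 Khbar_char0. Qed.

Lemma iota_tau_factor l : strict l -> iota (tau_factor l) =
  2 ^- size l * pfseq 0%N (coefc F : nat -> nat -> F^o) (complete_seq l).
Proof.
case/andP=> sl l0; have gtn_trans : transitive gtn by move=> i j k ij jk; apply: ltn_trans jk ij.
have ul : uniq l by apply: (sorted_uniq gtn_trans ltnn).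
rewrite -(Q_quotient F0 ul l0) /tau_factor rmorphM fmorphV rmorphXn rmorph_nat; congr (_ * _).
rewrite rmorphM fmorphV rmorphM.
have iQ (t : oddn -> Khbar) (t' : oddn -> F^o) l' : (forall k, iota (t k) = t' k) -> iota (Q_val t l') = Q t' l'.
  move=> e; have <- : (iota : {rmorphism Khbar^o -> F^o}) \o t = t' by apply: funext => k; apply: e.
  exact: (rmorph_Q (iota : {rmorphism Khbar^o -> F^o}) F0 Khbar_char0).
have i1 k : iota (delta1 k) = time1 F k by rewrite /delta1 rmorph_nat.
have i3 k : iota (delta3 k) = time3 F k by rewrite /delta3 rmorphM fmorphV !rmorph_nat.
by congr (_ * _ / _); apply: iQ.
Qed.

Lemma ev_Q_poly l : ev iota x (Q_poly l) = Q (miwa x [set: 'I_N]%SET : _ -> F^o) l.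
Proof. exact: (ev_Q x Khbar_char0 iota l). Qed.

Lemma iota_alpha r : iota (alpha Khbar r) = alpha F r.
Proof.
rewrite /alpha; case: ifP => _; last exact: rmorph0.
rewrite rmorphM /df rmorph_prod /u3 rmorphM fmorphV rmorph_nat rmorphXn rmorphM fmorphV !rmorph_nat.
by congr (_ * _); apply: eq_bigr => i _; rewrite rmorph_nat.
Qed.

Lemma iota_beta r : iota (beta Khbar r) = beta F r.
Proof.
by rewrite /beta rmorphM iota_alpha rmorphM fmorphV rmorphD rmorphB !rmorphM rmorph1 !rmorph_nat.
Qed.
End MiwaEvaluation.

Lemma ev_tau_part (F : fieldType) (iota : {rmorphism Khbar -> F}) n (x : 'I_(n.*2) -> F) W w :
  ev iota x (tau_part W w) = (miwa_poly W x)`_w.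
Proof.
rewrite /tau_part /miwa_poly coef_sum raddf_sum big_mkcondr; apply: eq_bigr => X _.
rewrite coefCM coefXn eq_sym; case: eqP => _; rewrite ?mulr0 // mulr1 [LHS]ev_Z.
by rewrite iota_tau_factor ?strict_strict_of // ev_Q_poly.
Qed.

Lemma virasoro_tau_part w W J M : (w + 6 <= W)%N -> (w + 3 < J.*2)%N -> (M < J.*2.+1)%N ->
  virasoro J M (tau_part W w) (tau_part W (w + 3)) = 0.
Proof.
(* With 2J + 2 variables the number is even, as the formulas at power sums require, and at least the
   2J + 1 asked for by [virasoro_eq0]. *)
move=> wW wJ MJ; pose n := J.+1.
have [F [iota [x [D [dD Dx Diota]]]]] := rational_functions Khbar n.*2.
have F0 k : k.+1%:R != 0 :> F by rewrite -(rmorph_nat iota) fmorph_eq0 Khbar_char0.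
have o : 'I_(n.*2) by exists 0%N.
have V := @virasoro_eq0 _ F iota _ x D o J w (tau_part W w) (tau_part W (w + 3)) M F0 dD Dx Diota.
apply: V => //; first exact: homog_tau_part.
- exact: homog_tau_part.
move=> i; rewrite !ev_tau_part.
apply: (miwa_pde i F0 (x_distinct dD Dx) (x_neq0 dD Dx) dD Dx) => // j r.
- by rewrite -(iota_alpha iota) Diota.
- by rewrite -(iota_beta iota) Diota.
Qed.

Lemma mcoeff_virasoro (K : fieldType) J M (P P' : {malg K[tmonom]}) a : (virasoro J M P P')@_a =
  4^-1 * (\sum_(k < J) \sum_(l < J) (if (k + l + 2 == M)%N then dmal (odd_idx l) (dmal (odd_idx k) P) else 0))@_a
  + 2^-1 * (\sum_(k < J) \sum_(i < J.+1) (if (k.+1 == i + M)%N then i.*2.+1%:R *: (<< ucm (odd_idx i) >> * dmal (odd_idx k) P) else 0))@_a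
  + (if M == 0%N then 4^-1 *: (<< ucm (odd_idx 0) >> * (<< ucm (odd_idx 0) >> * P)) else 0)@_a
  + (if M == 1%N then 16^-1 *: P else 0)@_a
  - 32^-1 * (dmal (odd_idx M) P')@_a.
Proof.
rewrite /virasoro [LHS]mcoeffB; congr (_ - _); last exact: mcoeffZ.
rewrite [LHS]mcoeffD; congr (_ + _).
rewrite [LHS]mcoeffD; congr (_ + _).
by rewrite [LHS]mcoeffD; congr (_ + _); apply: mcoeffZ.
Qed.

(** The zero polynomial is homogeneous of every weight, so a nonzero coefficient at [a] would give
    [a] two different weights. *)
Lemma virasoro0 (K : fieldType) J M a : (virasoro J M 0 0 : {malg K[tmonom]})@_a = 0.
Proof.
have h w : homog (w + 2 - M.*2) (virasoro J M 0 0 : {malg K[tmonom]}).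
  by apply: homog_virasoro; apply: homog0.
by apply/eqP/contraT => na; have := h M.*2 a na; have := h M.*2.+1 a na; lia.
Qed.

(** The component [P'] carries one more power of hbar/16 than [P], which turns 1/(2 hbar) into
    1/32. *)
Lemma L_algebra (K : fieldType) (h c A B C D E : K) : 2 != 0 :> K -> h != 0 ->
  4^-1 * (c * A) + 2^-1 * (c * B) - (2 * h)^-1 * (c * (h / 16) * C) + c * D + c * E
  = c * (4^-1 * A + 2^-1 * B + D + E - 32^-1 * C).
Proof.
move=> k2 h0; have e (n : nat) : 2 ^+ n != 0 :> K by rewrite expf_neq0.
have := e 2%N; have := e 4%N; have := e 5%N; rewrite -!natrX => k5 k4 k2'.
by field; rewrite k2 h0 k5 k4 k2'.
Qed.

Lemma ddt_odd j (f : series) : ddt (j.*2.+1)%:Z f = diff_t (odd_idx j) f.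
Proof.
by rewrite /ddt; case: insubP => [k _ e|]; [congr (diff_t _ f); apply: val_inj | rewrite /= odd_double].
Qed.

Local Arguments ddt : simpl never.

Section Coefficients.
Variables (f : series) (P P' : {malg Khbar[tmonom]}) (c : Khbar) (M : nat) (a : tmonom).
Let v := wt a.
Hypothesis fP : forall b, (wt b + 2 = v + M.*2)%N -> f b = c * P@_b.
Hypothesis fP' : forall b, (wt b = v + M.*2.+1)%N -> f b = c * (hbar / 16) * P'@_b.
Variable J : nat.
Hypothesis vJ : (v + M < J)%N.
Let m : int := M%:Z - 1.

(** With indices 2l + 1 and 2k + 1 and m = M - 1, the condition that they add up to 2m reads k + l +
    2 = M. *)
Lemma pair_term : \sum_(p \in [set p : oddn * oddn | (val p.1 + val p.2)%N%:Z = 2 * m]%classic)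
    ddt (val p.1)%:Z (ddt (val p.2)%:Z f) a
  = c * (\sum_(k < J) \sum_(l < J) (if (k + l + 2 == M)%N then dmal (odd_idx l) (dmal (odd_idx k) P) else 0))@_a.
Proof.
pose r := [seq (odd_idx u.2, odd_idx u.1) | u : 'I_J * 'I_J <- index_enum _ & (u.1 + u.2 + 2 == M)%N].
have ur : uniq r.
  rewrite map_inj_in_uniq ?filter_uniq ?index_enum_uniq // => -[k l] [k' l'] _ _ /= [/double_inj e1 /double_inj e2].
  by congr pair; apply: val_inj.
have rA u : u \in r -> (val u.1 + val u.2)%N%:Z = 2 * m.
  case/mapP => -[k l]; rewrite mem_filter => /andP[/eqP /= e _] -> /=; rewrite /m -e; lia.
rewrite (fsbigE _ _ ur); first last.
- move=> [k l] e; case/negP; apply/mapP.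
  have kM : ((val l)./2 + (val k)./2 + 2 = M)%N.
    have := odd_double_half (val k); have := odd_double_half (val l); rewrite (valP k) (valP l) !add1n.
    have : (val k + val l)%N%:Z = 2 * m := e.
    by rewrite /m; move: (val k) (val l) => kk ll; lia.
  have lJ : ((val l)./2 < J)%N by lia.
  have kJ : ((val k)./2 < J)%N by lia.
  exists (Ordinal lJ, Ordinal kJ); last by rewrite /= !odd_idxP.
  by rewrite mem_filter /= kM eqxx mem_index_enum.
- by move=> u; apply: rA.
rewrite big_seq_cond (eq_bigl [in r]) => [|u]; last first.
  by case: (boolP (u \in r)) => // ur'; apply/mem_set/rA.
rewrite -big_seq /r big_map big_filter pair_big /= [LHS]big_mkcond raddf_sum mulr_sumr; apply: eq_bigr => -[k l] _ /=.
case: eqP => [e|_]; last by rewrite mcoeff0 mulr0.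
rewrite !ddt_odd /diff_t !coef_dmal fP; last by rewrite !wtM !wtU /= -e; lia.
by rewrite !(mulrCA _ c).
Qed.

(** The sum over k is cut at J because [mul_t k] gives 0 at a monomial that does not contain t_k. *)
Lemma euler_term : \sum_(k \in [set: oddn]%classic) (val k)%:R * mul_t k (ddt ((val k)%:Z + 2 * m) f) a
  = c * (\sum_(k < J) \sum_(i < J.+1) (if (k.+1 == i + M)%N then i.*2.+1%:R *: (<< ucm (odd_idx i) >> * dmal (odd_idx k) P) else 0))@_a.
Proof.
have az i : (v < i.*2.+1)%N -> a (odd_idx i) = 0%N.
  move=> vi; have := wt_ge a (odd_idx i); rewrite -/v /=; case: (a _) => // q; rewrite mulSn => h.
  by have := leq_trans (leq_addr _ _) h; rewrite leqNgt vi.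
rewrite (fsbigE [seq odd_idx i | i <- iota 0 J.+1]); first last.
- move=> k _ kr.
  have kJ : (J < (val k)./2)%N.
    rewrite ltnNge; apply: contra kr => kJ; apply/mapP; exists (val k)./2; last by rewrite odd_idxP.
    by rewrite mem_iota ltnS.
  have ka : a k = 0%N by rewrite -(odd_idxP k) az //; lia.
  by rewrite /mul_t ka eqxx mulr0.
- by [].
- by rewrite map_inj_uniq ?iota_uniq //; apply: odd_idx_inj.
rewrite (eq_bigl (fun=> true)) => [|u]; last by rewrite in_setT.
rewrite big_map -[iota 0 _]/(index_iota 0 J.+1) big_mkord exchange_big raddf_sum mulr_sumr.
apply: eq_bigr => i _; rewrite raddf_sum mulr_sumr /mul_t.
case: (eqVneq (a (odd_idx i)) 0%N) => [a0|a0].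
  rewrite mulr0 big1 // => k _ /=; case: eqP => _; last by rewrite mcoeff0 mulr0.
  by rewrite mcoeffZ coef_mulU /mul_t a0 eqxx !mulr0.
have iv : (i.*2.+1 <= v)%N by rewrite leqNgt; apply: contra a0 => /az ->.
(* For i = M = 0 the derivative has index 1 - 2 = -1, where [ddt] is zero by convention. *)
case: (posnP (i + M)%N) => [iM|iM].
  have -> : (val (odd_idx i))%:Z + 2 * m = Negz 0 by rewrite /m /=; lia.
  by rewrite mulr0 big1 // => k _; rewrite iM /= mcoeff0 mulr0.
have kJ : ((i + M).-1 < J)%N by lia.
rewrite (bigD1 (Ordinal kJ)) //= big1 ?addr0; last first.
  move=> k; rewrite -val_eqE /= => kn; case: eqP => [e|_]; last by rewrite mcoeff0 mulr0.
  by case/eqP: kn; rewrite -e.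
rewrite prednK // eqxx.
have -> : (i.*2.+1)%:Z + 2 * m = (((i + M).-1).*2.+1)%:Z by rewrite /m; lia.
rewrite ddt_odd /diff_t mcoeffZ coef_mulU /mul_t (negPf a0) coef_dmal fP; first by rewrite !(mulrCA _ c).
rewrite wtM wtU /= /v -[in RHS](divcmK a0) wtM wtU /=; lia.
Qed.

(** At [a] the operator reads [f] only in the two weights v + 2M - 2 and v + 2M + 1, so hypotheses
    on these two components suffice. *)
Lemma L_coef : L m f a = c * (virasoro J M P P')@_a.
Proof.
have eC : ddt (2 * m + 3) f a = c * (hbar / 16) * (dmal (odd_idx M) P')@_a.
  rewrite (_ : 2 * m + 3 = (M.*2.+1)%:Z); last by rewrite /m; lia.
  rewrite ddt_odd /diff_t coef_dmal fP'; last by rewrite wtM wtU.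
  exact: mulrCA.
have eD : (if m == -1 then 4^-1 * mul_t (odd_idx 0) (mul_t (odd_idx 0) f) a else 0)
   = c * (if M == 0%N then 4^-1 *: (<< ucm (odd_idx 0) >> * (<< ucm (odd_idx 0) >> * P)) else 0)@_a.
  have -> : (m == -1) = (M == 0%N) by rewrite /m; lia.
  case: eqP => M0; last by rewrite mcoeff0 mulr0.
  rewrite mcoeffZ !coef_mulU /mul_t; case: (eqVneq (a _) 0%N) => [_|a0]; first by rewrite !mulr0.
  case: (eqVneq (divcm _ _ _) 0%N) => [_|b0]; first by rewrite !mulr0.
  rewrite fP; first exact: mulrCA.
  rewrite /v -{2}(divcmK a0) -{2}(divcmK b0) !wtM wtU M0 /=; lia.
have eE : (if m == 0 then 16^-1 * f a else 0) = c * (if M == 1%N then 16^-1 *: P else 0)@_a.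
  have -> : (m == 0) = (M == 1%N) by rewrite /m; lia.
  case: eqP => M1; last by rewrite mcoeff0 mulr0.
  by rewrite mcoeffZ fP ?M1 //; apply: mulrCA.
rewrite /L pair_term euler_term eC eD eE mcoeff_virasoro.
exact: (L_algebra _ _ _ _ _ _ (Khbar_char0 1) hbar_neq0).
Qed.
End Coefficients.

Theorem theorem1p1 (m : int) (hm : -1 <= m) (a : {cmonom oddn}) :
  L m tau_MM a = 0.
Proof.
have [M ->] : exists M : nat, m = M%:Z - 1 by exists (absz (m + 1)); lia.
pose v := wt a; pose J := (v + M.*2 + 10)%N.
(* The lower component has weight v + 2M - 2. When this is negative it does not exist, and M = 0
   with v <= 1. *)
case: (leqP 2 (v + M.*2)) => hw.
  pose w := (v + M.*2 - 2)%N; pose W := (w + 6)%N.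
  have e := @L_coef tau_MM (tau_part W w) (tau_part W (w + 3)) ((hbar / 16) ^+ (w %/ 3)) M a _ _ J.
  rewrite e ?virasoro_tau_part ?mcoeff0 ?mulr0 //; try by rewrite /J /w; lia.
  - move=> b hb; have wb : wt b = w by rewrite /w; lia.
    by rewrite (@tau_MME W) ?wb // /W leq_addr.
  - move=> b hb; have wb : wt b = (w + 3)%N by rewrite /w; lia.
    rewrite (@tau_MME W) ?wb; last by rewrite /W; lia.
    by rewrite divnDr // divnn addn1 exprSr.
(* The lower component is 0, and c = 16/hbar makes the factor c hbar/16 of the upper one equal to 1.
   The upper component has weight v + 1, which is 1 or 2, not divisible by 3, so it vanishes as
   well. *)
have e := @L_coef tau_MM 0 (tau_part 2 (v + 1)) (16 / hbar) M a _ _ J.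
have M0 : M = 0%N by lia.
rewrite e; try by rewrite /J; lia.
- rewrite tau_part_eq0; last by apply/negP => /dvdnP[[|[|q]]]; lia.
  by rewrite virasoro0 mulr0.
- move=> b hb; have wb : wt b = (v + 1)%N by rewrite -/v in hb; lia.
  rewrite (@tau_MME 2) ?wb; last by lia.
  rewrite divn_small; last by lia.
  by rewrite mulrA divfK ?hbar_neq0 // divff ?mul1r //; apply: (Khbar_char0 15).
Qed.
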